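(* Let $n$ be a fixed positive integer and let $0<\alpha<1$. For each $N$ let $G$ be an $N\times N$ GUE matrix, let $\mathbf b_N\in\mathbf R^N$ be a unit vector, and consider the matrix $$W=G+\sqrt{-1}\,N\cdot\mathbf b_N\mathbf b_N^{\intercal}.$$ Then there is $\epsilon>0$ such that for all sufficiently large $N$, for each integer $i\in[\alpha N,(1-\alpha)N]$ and each $j=0,\dots,n-1$, with probability at least $1-N^{-\epsilon}$ the matrix $W$ has an eigenvalue (labelled $\lambda_{i+j}(W)$) with $$\lambda_{i+j}(G)<\Re\lambda_{i+j}(W)<\lambda_{i+j+1}(G).$$
   Context: $\lambda_1(G)\le\dots\le\lambda_N(G)$ are the ordered eigenvalues of $G$. The GUE matrix $G$ is the Hermitian Gaussian matrix with independent (up to Hermitian symmetry) centered entries, complex Gaussian with $\mathbf E|G_{ij}|^2=1$ and $\mathbf E\, G_{ij}^2=0$ off the diagonal, and real Gaussian with variance $1$ on the diagonal, so that its spectrum is asymptotically concentrated on $[-2\sqrt N,2\sqrt N]$. *)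

(* Defs.v *)
From HB Require Import structures.
From mathcomp Require Import all_boot all_order all_algebra.
From mathcomp Require Import sesquilinear spectral.
From mathcomp Require Import complex.
From mathcomp Require Import all_classical all_reals all_analysis.

Set Implicit Arguments.
Unset Strict Implicit.
Unset Printing Implicit Defensive.

Import Order.TTheory GRing.Theory Num.Theory.
Import numFieldNormedType.Exports.

Local Open Scope classical_set_scope.
Local Open Scope complex_scope.
Local Open Scope ring_scope.

(* The product rule is required for every finite subfamily of (X i)_(i in D). *)
Definition mutually_independent {R : realType} {d d' : measure_display}
    {T : measurableType d} {S : measurableType d'} (P : probability T R)
    (I : finType) (D : {set I}) (X : I -> T -> S) : Prop :=
  forall (J : {set I}) (A : I -> set S),
    J \subset D -> (forall i, measurable (A i)) ->
    P (\bigcap_(i in [set` J]) (X i @^-1` A i)) =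
    (\prod_(i in J) P (X i @^-1` A i))%E.

(* The event E contains a measurable event of probability at least p; when E
   is itself measurable this says that E has probability at least p. *)
Definition with_probability_at_least {R : realType} {d : measure_display}
    {T : measurableType d} (P : probability T R) (p : R) (E : set T) : Prop :=
  exists A : set T, [/\ measurable A, A `<=` E & (p%:E <= P A)%E].

(* R[i] carries no sigma-algebra in the libraries; complex random variables are
   handled through this identification with R * R. *)
Definition ReIm {R : realType} (z : R[i]) : R * R := (complex.Re z, complex.Im z).

Definition real_standard_gaussian {R : realType} {d : measure_display}
    {T : measurableType d} (P : probability T R) (X : T -> R) : Prop :=
  forall A : set R, measurable A -> P (X @^-1` A) = normal_prob 0 1 A.

(* The centered complex Gaussian law with E|Z|^2 = 1 and E Z^2 = 0: the moment
   conditions say that the Gaussian vector (Re Z, Im Z) has covariance matrix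
   (1/2) I, i.e. its coordinates are independent, centered, of variance 1/2.
   The second argument of normal_prob is the standard deviation. *)
Definition complex_standard_gaussian {R : realType} {d : measure_display}
    {T : measurableType d} (P : probability T R) (Z : T -> R[i]) : Prop :=
  forall A : set (R * R), measurable A ->
    P ((ReIm \o Z) @^-1` A) =
    (normal_prob 0 (Num.sqrt 2^-1) \x normal_prob 0 (Num.sqrt 2^-1))%E A.

Record GUE {R : realType} {d : measure_display} {T : measurableType d}
    (P : probability T R) (N : nat) (G : T -> 'M[R[i]]_N) : Prop := {
  GUE_hermitian : forall w, G w \is hermsymmx;
  GUE_measurable : forall i j, measurable_fun setT (fun w => ReIm (G w i j));
  GUE_independent :
    mutually_independent P [set p : 'I_N * 'I_N | (p.1 <= p.2)%N]%SET
      (fun p w => ReIm (G w p.1 p.2));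
  GUE_diagonal : forall i,
    real_standard_gaussian P (fun w => complex.Re (G w i i));
  GUE_off_diagonal : forall i j : 'I_N, (i < j)%N ->
    complex_standard_gaussian P (fun w => G w i j) }.

(* The roots of the characteristic polynomial, with multiplicity. *)
Definition spectrum_seq {R : realType} {N : nat} (A : 'M[R[i]]_N) : seq R[i] :=
  sval (closed_field_poly_normal (char_poly A)).

(* ordered_eigenvalue A k is the k-th smallest eigenvalue (1 <= k <= N) of a
   Hermitian matrix A; its eigenvalues being real, taking the real part only
   changes the type. *)
Definition ordered_eigenvalue {R : realType} {N : nat} (A : 'M[R[i]]_N)
    (k : nat) : R :=
  nth 0 (sort <=%R (map (@complex.Re R) (spectrum_seq A))) k.-1.

Definition perturbed {R : realType} {N : nat} (G : 'M[R[i]]_N)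
    (b : 'cV[R]_N) : 'M[R[i]]_N :=
  G + ('i%C * N%:R) *: map_mx (real_complex R) (b *m b^T).

(* Main.v *)
Require Import Defs.
From HB Require Import structures.
From mathcomp Require Import all_boot all_order all_algebra.
From mathcomp Require Import sesquilinear spectral.
From mathcomp Require Import complex.
From mathcomp Require Import all_classical all_reals all_analysis.
From mathcomp Require Import perm measurable_realfun ring lra.
From mathcomp Require polyrcf.

Set Implicit Arguments.
Unset Strict Implicit.
Unset Printing Implicit Defensive.

Import Order.TTheory GRing.Theory Num.Theory.
Import numFieldNormedType.Exports.

Local Open Scope classical_set_scope.
Local Open Scope complex_scope.
Local Open Scope ring_scope.

(* A point z off the spectrum is an eigenvalue of W as soon as
   1 + i N f(z) = 0, where f(z) = sum_l |<v_l, b>|^2 / (lambda_l - z) and the v_l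
   are the unit eigenvectors of G.  Between two consecutive eigenvalues f has a
   real zero mu; Poisson kernels of the roots of the numerator of 1 + i N f show
   that there is a root closer to mu than the spectrum, unless f'(mu) or one of
   the weights |<v_l, b>|^2 next to mu is too small.
   Conjugating by a reflection we may take for b the first basis vector.  At a
   zero mu of f the vector (mu - G)^-1 b vanishes in the first coordinate, so its
   tail is an eigenvector of the minor M of G, and 1 / f'(mu) is the squared
   projection of the first column of G on a unit eigenvector of M; as that column
   is independent of M, this is at most sqrt N with high probability.  The weights
   |<v_k, b>|^2 are bounded below by replacing b with an independent Gaussian
   direction.  Everything probabilistic is expressed through the N^2 variables
   Re G_ij + Im G_ij, which are independent standard normal. *)

(** * Roots of the secular equation *)

(** Linearising at [mu], one expects a root of [1 + i N f] near [mu + i / (N f'(mu))], so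
    [1 / (N f'(mu))] has to be compared with the distance [r] from [mu] to the spectrum. The gaps
    between eigenvalues are never estimated: if [w] is the weight of the eigenvalue nearest to [mu],
    then [w / r^2] is one term of [f'(mu)], whence [w <= r^2 f'(mu)]; together with
    [1 / f'(mu) <= K], a weight of at least [81 K / N^2] makes [r] large enough. As [mu] is random,
    the bound [K] is imposed on the projections of the column on all the eigenvectors of the minor
    at once, by a union bound. Typical weights have order [1 / N], while [K = N^(1/2)] only asks for
    order [N^(-3/2)]; this room allows crude polynomial tail bounds. Eigenvectors are not chosen as
    measurable functions of the matrix. The weights are instead rational expressions in the entries
    and the eigenvalues, meaningful when the spectrum is simple; that simplicity holds almost surely
    is proved by induction through the minors. *)

Lemma horner_deriv_prod_XsubC (F : fieldType) (I : Type) (r : seq I)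
    (A : pred I) (a : I -> F) (x : F) :
  (forall i, A i -> x != a i) ->
  (\prod_(i <- r | A i) ('X - (a i)%:P))^`().[x] =
  (\prod_(i <- r | A i) (x - a i)) * \sum_(i <- r | A i) (x - a i)^-1.
Proof.
move=> xa; pose K (p : {poly F}) u v := p.[x] = u /\ p^`().[x] = u * v.
suff [] : K (\prod_(i <- r | A i) ('X - (a i)%:P)) (\prod_(i <- r | A i) (x - a i))
  (\sum_(i <- r | A i) (x - a i)^-1) by [].
elim/big_rec3: _ => [|i p u v Ai [pu pv]]; first by rewrite /K !hornerE derivC horner0.
rewrite /K derivM derivXsubC !hornerE pu pv; split=> //.
have : x - a i != 0 by rewrite subr_eq0 xa.
by move=> h; field.
Qed.

Section complex_parts.
Context {R : realType}.
Implicit Types x y : R[i].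

Lemma Re_add x y : complex.Re (x + y) = complex.Re x + complex.Re y.
Proof. by case: x; case: y. Qed.

Lemma Im_add x y : complex.Im (x + y) = complex.Im x + complex.Im y.
Proof. by case: x; case: y. Qed.

Lemma Re_mul x y : complex.Re (x * y) =
  complex.Re x * complex.Re y - complex.Im x * complex.Im y.
Proof. by case: x; case: y. Qed.

Lemma Im_mul x y : complex.Im (x * y) =
  complex.Re x * complex.Im y + complex.Im x * complex.Re y.
Proof. by case: x; case: y. Qed.

Lemma Re_sum I (r : seq I) (P : pred I) (F : I -> R[i]) :
  complex.Re (\sum_(i <- r | P i) F i) = \sum_(i <- r | P i) complex.Re (F i).
Proof. exact: (big_morph (@complex.Re R) Re_add). Qed.

Lemma Im_sum I (r : seq I) (P : pred I) (F : I -> R[i]) :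
  complex.Im (\sum_(i <- r | P i) F i) = \sum_(i <- r | P i) complex.Im (F i).
Proof. exact: (big_morph (@complex.Im R) Im_add). Qed.

End complex_parts.

Section secular.
Context {R : realType} {N : nat}.
Variables (lam w : 'I_N -> R) (t : R).
Local Notation C := R[i].

(** [secular] is the function f of the overview for general poles and weights, and [secular2] is its
    derivative. [secular_poly] is the numerator of [1 + i t secular] over the product of the
    [X - lam l]; its minus sign comes from the denominators [lam l - x]. *)
Definition secular (x : C) : C := \sum_l (w l)%:C / ((lam l)%:C - x).
Definition secular2 (x : C) : C := \sum_l (w l)%:C / ((lam l)%:C - x) ^+ 2.
Definition secular_poly : {poly C} := \prod_l ('X - (lam l)%:C%:P) -
  ('i%C * t%:C) *: \sum_l (w l)%:C *: \prod_(m | m != l) ('X - (lam m)%:C%:P).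

Lemma prod_XsubC_except (x : C) (l : 'I_N) : (forall l, x != (lam l)%:C) ->
  \prod_(m | m != l) (x - (lam m)%:C) =
  \prod_m (x - (lam m)%:C) / (x - (lam l)%:C).
Proof.
move=> xl; rewrite [in RHS](bigD1 l)//= mulrAC divff ?mul1r//.
by rewrite subr_eq0.
Qed.

Lemma horner_secular_poly x : (forall l, x != (lam l)%:C) ->
  secular_poly.[x] =
  \prod_l (x - (lam l)%:C) * (1 + 'i%C * t%:C * secular x).
Proof.
move=> xl; rewrite /secular_poly !hornerE horner_prod horner_sum.
under eq_bigr do rewrite !hornerE.
under [X in _ - _ * X]eq_bigr => l _.
  rewrite !hornerE horner_prod; under eq_bigr do rewrite !hornerE.
  rewrite prod_XsubC_except// mulrCA; over.
rewrite -mulr_sumr /secular mulrDr mulr1; congr (_ + _).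
rewrite mulrCA -mulrN; congr (_ * _); rewrite -mulrN; congr (_ * _).
rewrite -sumrN; apply: eq_bigr => l _.
by rewrite -mulrN -invrN opprB.
Qed.

Lemma horner_deriv_secular_poly x : (forall l, x != (lam l)%:C) ->
  secular_poly^`().[x] = \prod_l (x - (lam l)%:C) *
   ((\sum_l (x - (lam l)%:C)^-1) * (1 + 'i%C * t%:C * secular x)
     + 'i%C * t%:C * secular2 x).
Proof.
move=> xl; rewrite /secular_poly derivB derivZ !hornerE.
rewrite horner_deriv_prod_XsubC// linear_sum horner_sum.
set S : C := \sum_l (x - (lam l)%:C)^-1; set p := \prod_l (_ - _).
under [X in _ - _ * X]eq_bigr => l _.
  rewrite /= derivZ hornerE horner_deriv_prod_XsubC// prod_XsubC_except//.
  have -> : \sum_(i | i != l) (x - (lam i)%:C)^-1 = S - (x - (lam l)%:C)^-1.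
    by apply/esym/eqP; rewrite subr_eq /S [X in X == _](bigD1 l)//= addrC.
  over.
rewrite /= /secular /secular2.
have -> : \sum_(i < N) (w i)%:C * (p / (x - (lam i)%:C) * (S - (x - (lam i)%:C)^-1)) =
 p * (S * - (\sum_i (w i)%:C / ((lam i)%:C - x)) - \sum_i (w i)%:C / ((lam i)%:C - x) ^+ 2).
  rewrite -sumrN mulr_sumr -sumrB mulr_sumr; apply: eq_bigr => l _.
  have h : x - (lam l)%:C != 0 by rewrite subr_eq0.
  have h' : (lam l)%:C - x != 0 by rewrite subr_eq0 eq_sym.
  by rewrite -(opprB x) in h' *; field.
by ring.
Qed.

Definition rsecular (x : R) : R := \sum_l w l / (lam l - x).
Definition rsecular2 (x : R) : R := \sum_l w l / (lam l - x) ^+ 2.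

Lemma secular_real x : secular x%:C = (rsecular x)%:C.
Proof.
by rewrite /rsecular rmorph_sum; apply: eq_bigr => l _; rewrite fmorph_div rmorphB.
Qed.

Lemma secular2_real x : secular2 x%:C = (rsecular2 x)%:C.
Proof.
rewrite /rsecular2 rmorph_sum; apply: eq_bigr => l _.
by rewrite fmorph_div rmorphXn rmorphB.
Qed.

(** Up to a factor pi, the right-hand side is the Poisson kernel of the upper half-plane for the
    point [z] and the boundary point [x]. *)
Lemma Im_inv_real_sub (x : R) (z : C) :
  complex.Im (x%:C - z)^-1 =
  complex.Im z / ((x - complex.Re z) ^+ 2 + complex.Im z ^+ 2).
Proof. by case: z => a c /=; rewrite sub0r sqrrN mulNr opprK. Qed.

(* The two sides are the imaginary part of the logarithmic derivative of
   [secular_poly] at [x]. *)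
Lemma poisson_sum_roots (rs : seq C) (x : R) :
  secular_poly = lead_coef secular_poly *: \prod_(z <- rs) ('X - z%:P) ->
  (forall l, lam l != x) ->
  \sum_(z <- rs) complex.Im z / ((x - complex.Re z) ^+ 2 + complex.Im z ^+ 2) =
  t * rsecular2 x / (1 + t ^+ 2 * rsecular x ^+ 2).
Proof.
move=> hE xl; have xl' l : x%:C != (lam l)%:C.
  by rewrite (inj_eq (@complexI R)) eq_sym.
set f := rsecular x; set D := rsecular2 x.
have den : 1 + t ^+ 2 * f ^+ 2 != 0.
  by rewrite gt_eqF// ltr_wpDr// -exprMn sqr_ge0.
have u0 : 1 + 'i%C * t%:C * f%:C != 0.
  apply/eqP => /(congr1 (@complex.Re R)) /= H.
  have : (1 : R) = 0 by rewrite -H; ring.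
  by move/eqP; rewrite oner_eq0.
have P0 : \prod_l (x%:C - (lam l)%:C) != 0.
  by apply/prodf_neq0 => l _; rewrite subr_eq0.
have hx : secular_poly.[x%:C] != 0.
  by rewrite horner_secular_poly// mulf_neq0// secular_real.
have zx z : z \in rs -> x%:C != z.
  move=> zrs; apply: contra_neq hx => ->; rewrite hE hornerZ.
  by move: zrs; rewrite -root_prod_XsubC => /rootP ->; rewrite mulr0.
have E : \sum_(z <- rs) (x%:C - z)^-1 = \sum_l (x%:C - (lam l)%:C)^-1 +
    'i%C * t%:C * D%:C / (1 + 'i%C * t%:C * f%:C).
  apply: (mulfI hx); rewrite [in RHS]horner_secular_poly// secular_real -/f.
  rewrite [LHS](_ : _ = (secular_poly^`()).[x%:C]).
    rewrite horner_deriv_secular_poly// secular_real secular2_real -/f -/D.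
    by field.
  rewrite hE derivZ !hornerZ -mulrA; congr (_ * _).
  rewrite horner_prod big_seq [in X in _ = X]big_seq horner_deriv_prod_XsubC//.
  rewrite -!big_seq; congr (_ * _).
  by apply: eq_bigr => z _; rewrite !hornerE.
have -> : \sum_(z <- rs) complex.Im z / ((x - complex.Re z) ^+ 2 + complex.Im z ^+ 2)
    = complex.Im (\sum_(z <- rs) (x%:C - z)^-1).
  by rewrite Im_sum; apply: eq_bigr => z _; rewrite Im_inv_real_sub.
(* The poles [lam l] are real, so their share of the logarithmic derivative has no imaginary
   part. *)
rewrite E Im_add Im_sum big1 ?add0r => [|l _]; last first.
  by rewrite Im_inv_real_sub/= mul0r.
have -> : 'i%C * t%:C * D%:C / (1 + 'i%C * t%:C * f%:C) =
  (t ^+ 2 * f * D / (1 + t ^+ 2 * f ^+ 2)) +i* (t * D / (1 + t ^+ 2 * f ^+ 2)).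
  apply: (canLR (mulfK u0)); apply/eqP; rewrite eq_complex /=.
  clear -den; clearbody f D.
  by apply/andP; split; apply/eqP; field; rewrite exprMn.
by [].
Qed.

(** At a root off the poles the real part of the equation says [t * Im (secular z) = 1], while every
    term of [Im (secular z)] has the sign of [Im z]. This makes the Poisson kernels of the roots
    nonnegative, as Harnack's inequality requires. *)
Lemma Im_root_secular_poly_ge0 (z : C) : 0 < t -> (forall l, 0 <= w l) ->
  root secular_poly z -> 0 <= complex.Im z.
Proof.
move=> t0 w0 /rootP rz; have [[l /eqP zl]|zl] := pselect (exists l, z == (lam l)%:C).
  by rewrite zl.
have zl' l : z != (lam l)%:C by apply/negP => ?; apply: zl; exists l.
move: rz; rewrite horner_secular_poly// => /eqP.
rewrite mulf_eq0 prodf_seq_eq0 => /orP[/hasP[l _] /=|/eqP H].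
  by rewrite subr_eq0 (negbTE (zl' l)).
have : t * complex.Im (secular z) = 1.
  have := congr1 (@complex.Re R) H; rewrite Re_add Re_mul Im_mul Re_mul /= => H'.
  by lra.
rewrite /secular Im_sum => E; rewrite leNgt; apply/negP => zI.
have : t * \sum_l complex.Im ((w l)%:C / ((lam l)%:C - z)) <= 0.
  rewrite pmulr_rle0// sumr_le0// => l _.
  rewrite Im_mul Im_inv_real_sub/= mul0r addr0 mulr_ge0_le0//.
  by rewrite mulr_le0_ge0 ?invr_ge0 ?addr_ge0 ?sqr_ge0// ltW.
by rewrite E ler10.
Qed.

(* If all roots were at distance at least [r] from [mu], then by Harnack's
   inequality the sum of Poisson kernels of [poisson_sum_roots] would drop by a
   factor at most 9/4 from [mu] to [mu + r / 2], whereas the growth of [rsecular]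
   away from its zero makes it drop by a larger factor. *)
Lemma secular_root_near (mu r : R) : 0 < t -> (forall l, 0 <= w l) ->
  0 < r -> (forall l, r <= `|lam l - mu|) -> rsecular mu = 0 ->
  9 <= t * r * rsecular2 mu ->
  exists2 z : C, root secular_poly z &
    (mu - complex.Re z) ^+ 2 + complex.Im z ^+ 2 < r ^+ 2.
Proof.
move=> t0 w0 r0 rl fmu trD.
have [rs hE] := closed_field_poly_normal secular_poly.
apply: contrapT => nz; pose x := mu + r / 2.
have rz z : z \in rs -> 0 <= complex.Im z /\
    r ^+ 2 <= (mu - complex.Re z) ^+ 2 + complex.Im z ^+ 2.
  move=> zrs; have hz : root secular_poly z.
    by rewrite hE; apply/rootP; rewrite hornerZ; move: zrs;
      rewrite -root_prod_XsubC => /rootP ->; rewrite mulr0.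
  split; first exact: Im_root_secular_poly_ge0.
  by rewrite leNgt; apply/negP => ?; apply: nz; exists z.
have el l : r <= lam l - mu \/ lam l - mu <= - r.
  by have := rl l; rewrite ler_normr => /orP[|]; [left|right; rewrite lerNr].
have lmu l : lam l != mu.
  by apply/eqP => E; case: (el l); rewrite E subrr => ?; lra.
have lx l : lam l != x.
  by apply/eqP => E; case: (el l); rewrite E /x => ?; lra.
have Umu := poisson_sum_roots hE lmu; have Ux := poisson_sum_roots hE lx.
rewrite fmu expr0n mulr0 addr0 divr1 in Umu.
set D := rsecular2 mu in trD Umu *; set fx := rsecular x in Ux *.
have D0 : 0 < D.
  by rewrite -(pmulr_rgt0 _ (mulr_gt0 t0 r0)); apply: lt_le_trans trD.
(* If [z] is at distance at least [r] from [mu], moving by [r / 2] multiplies its distance by at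
   most 3/2, and the square of it by at most 9/4. *)
have le1 : t * D <= 9 / 4 * (t * rsecular2 x / (1 + t ^+ 2 * fx ^+ 2)).
  rewrite -Umu -Ux mulr_sumr big_seq [leRHS]big_seq; apply: ler_sum => z /rz[I0 A].
  set a := mu - complex.Re z in A *; set b := complex.Im z in I0 A *.
  have -> : x - complex.Re z = a + r / 2 by rewrite /x /a; ring.
  have A0 : 0 < a ^+ 2 + b ^+ 2 by apply: lt_le_trans A; rewrite exprn_gt0.
  have : (a + r / 2) ^+ 2 + b ^+ 2 <= 9 / 4 * (a ^+ 2 + b ^+ 2) by nra.
  set B := _ + b ^+ 2 => BA.
  have [B0|B0] := ltP 0 B; last first.
    have b0 : b = 0.
      apply/eqP; rewrite -sqrf_eq0; apply/eqP.
      by move: B0 (sqr_ge0 (a + r / 2)) (sqr_ge0 b); rewrite /B => *; lra.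
    by rewrite b0 !mul0r mulr0.
  rewrite mulrCA ler_wpM2l//.
  by rewrite ler_pdivlMr// mulrC ler_pdivrMr.
(* Each pole is at distance at least [r] from [mu], so the move by [r / 2] keeps at least half of
   that distance. *)
have le2 : rsecular2 x <= 4 * D.
  rewrite /D mulr_sumr; apply: ler_sum => l _.
  have e0 : lam l - mu != 0 by rewrite subr_eq0.
  have ex0 : lam l - x != 0 by rewrite subr_eq0.
  rewrite mulrCA ler_wpM2l//.
  rewrite ler_pdivlMr ?exprn_even_gt0// mulrC ler_pdivrMr ?exprn_even_gt0//.
  by rewrite /x; case: (el l) => ?; nra.
(* Since [mu] is a zero, [fx] is the increment of [rsecular] from [mu] to [x], and it can be bounded
   below term by term. *)
have le3 : r / 3 * D <= fx.
  rewrite -[fx]subr0 -fmu /fx /rsecular -sumrB mulr_sumr; apply: ler_sum => l _.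
  have e0 : lam l - mu != 0 by rewrite subr_eq0.
  have ex0 : lam l - x != 0 by rewrite subr_eq0.
  rewrite -mulrBr mulrCA ler_wpM2l//.
  have pos : 0 < (lam l - x) * (lam l - mu).
    by rewrite /x; case: (el l) => ?; nra.
  have -> : (lam l - x)^-1 - (lam l - mu)^-1 =
      (r / 2) / ((lam l - x) * (lam l - mu)).
    have -> : r / 2 = (lam l - mu) - (lam l - x) by rewrite /x; ring.
    move: (lam l - mu) (lam l - x) e0 ex0 => u v u0 v0.
    by field; rewrite u0 v0.
  rewrite ler_pdivlMr// mulrAC ler_pdivrMr ?exprn_even_gt0//.
  have : (lam l - x) * (lam l - mu) <= 3 / 2 * (lam l - mu) ^+ 2.
    by rewrite /x; case: (el l) => ?; nra.
  by rewrite -(ler_pM2l r0) => ?; lra.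
have den : 0 < 1 + t ^+ 2 * fx ^+ 2.
  by rewrite ltr_wpDr// -exprMn sqr_ge0.
move: le1; rewrite mulrA ler_pdivlMr// => le1.
have tf3 : 3 <= t * fx.
  by have : t * (r / 3 * D) <= t * fx; [rewrite ler_wpM2l// ltW|lra].
have tf9 : 9 <= t ^+ 2 * fx ^+ 2 by rewrite -exprMn; nra.
(* The contradiction: the factors 9/4 and 4 multiply to 9, but the denominator at [x] is at least 1
   + 9. *)
have : t * D * (1 + t ^+ 2 * fx ^+ 2) <= 9 * (t * D).
  by apply: le_trans le1 _; nra.
by rewrite mulrC ler_pM2r ?mulr_gt0//; lra.
Qed.

End secular.

Section secular_roots.
Context {R : realType} {N : nat}.
Variables (lam w : 'I_N -> R) (t : R) (k k' : 'I_N).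
Hypothesis kk' : k' = k.+1 :> nat.
Hypothesis lam_incr : forall i j : 'I_N, (i < j)%N -> lam i < lam j.
Hypothesis w_ge0 : forall l, 0 <= w l.

(** The intermediate value theorem is applied to the numerator [q] of [rsecular]. At a pole only one
    of its terms survives; in the product of the values at two consecutive poles, the poles outside
    contribute positive factors and the pair itself a negative one. *)
Lemma rsecular_zero : 0 < w k -> 0 < w k' ->
  exists mu, [/\ lam k < mu, mu < lam k', forall l, lam l != mu &
    rsecular lam w mu = 0].
Proof.
move=> wk wk'.
pose q := \sum_l w l *: \prod_(m | m != l) ('X - (lam m)%:P).
have qE i : q.[lam i] = w i * \prod_(m | m != i) (lam i - lam m).
  rewrite /q horner_sum (bigD1 i)//= [X in _ + X]big1 ?addr0 => [|l li].
    by rewrite !hornerE horner_prod; under eq_bigr do rewrite !hornerE.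
  rewrite !hornerE horner_prod (bigD1 i) 1?eq_sym//= !hornerE subrr.
  by rewrite /= mulr0 mul0r.
have kk : lam k < lam k' by apply: lam_incr; rewrite kk'.
have nkk : k' != k by rewrite -val_eqE /= kk' gtn_eqF.
have neg : q.[lam k] * q.[lam k'] < 0.
  rewrite !qE mulrACA pmulr_rlt0 ?mulr_gt0//.
  rewrite (bigD1 k')//= [X in _ * X](bigD1 k) 1?eq_sym//= mulrACA.
  rewrite nmulr_rlt0; last by nra.
  rewrite (eq_bigl (fun m => (m != k) && (m != k'))) => [|m]; last by [].
  rewrite [X in _ * X](eq_bigl (fun m => (m != k) && (m != k'))) => [|m]; last first.
    by rewrite andbC.
  rewrite -big_split prodr_gt0//= => m /andP[mk mk'].
  have [ltm|gtm] := ltnP m k.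
    have := lam_incr ltm; have : lam m < lam k' by apply: lt_trans kk; exact: lam_incr.
    by nra.
  have mgk' : (k' < m)%N.
    by rewrite ltn_neqAle eq_sym mk' /= kk' ltn_neqAle eq_sym mk.
  have := lam_incr mgk'; have : lam k < lam m by apply: lt_trans kk _; exact: lam_incr.
  by nra.
have [mu /andP[/=]] := polyrcf.poly_ivtoo (ltW kk) neg.
rewrite !bnd_simp => kmu muk' /rootP qmu.
have ne l : lam l != mu.
  have [lk|lk] := leqP l k.
    rewrite lt_eqF//; apply: le_lt_trans kmu.
    by move: lk; rewrite leq_eqVlt => /orP[/eqP/val_inj->//|/lam_incr/ltW].
  rewrite gt_eqF//; apply: lt_le_trans muk' _.
  by move: lk; rewrite -kk' leq_eqVlt => /orP[/eqP/val_inj->//|/lam_incr/ltW].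
exists mu; split => //.
have P0 : \prod_l (mu - lam l) != 0.
  by apply/prodf_neq0 => l _; rewrite subr_eq0 eq_sym.
have : q.[mu] = - (\prod_l (mu - lam l) * rsecular lam w mu).
  rewrite /q horner_sum mulr_sumr -sumrN; apply: eq_bigr => l _.
  rewrite !hornerE horner_prod; under eq_bigr do rewrite !hornerE.
  have h : lam l - mu != 0 by rewrite subr_eq0.
  rewrite [in RHS](bigD1 l)//=; move: (\prod_(_ | _) _) => p.
  by field.
by rewrite qmu => /esym/eqP; rewrite oppr_eq0 mulf_eq0 (negbTE P0) => /eqP.
Qed.

(** Let [r] be the distance from the real zero [mu] to the nearest pole, which is one of its two
    neighbours, say of weight [w]; then [w <= r^2 D] with [D = rsecular2 mu]. If [t r D < 9], then
    [1 <= K D] gives [t r < 9 K], so [t^2 w <= (t r) (t r D) < 81 K], against the hypothesis. Hence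
    [secular_root_near] applies, and a root closer to [mu] than every pole has its real part between
    the two neighbours. *)
Lemma secular_root_between (K : R) : 0 < t -> 0 < K ->
  81 * K <= t ^+ 2 * w k -> 81 * K <= t ^+ 2 * w k' ->
  (forall mu, (forall l, lam l != mu) -> rsecular lam w mu = 0 ->
    1 <= K * rsecular2 lam w mu) ->
  exists z : R[i], [/\ forall l, z != (lam l)%:C,
    1 + 'i%C * t%:C * secular lam w z = 0,
    lam k < complex.Re z & complex.Re z < lam k'].
Proof.
move=> t0 K0 wk wk' DK.
have w0 x : 81 * K <= t ^+ 2 * x -> 0 < x.
  move=> h; rewrite -(pmulr_rgt0 _ (exprn_gt0 2 t0)).
  by apply: lt_le_trans h; lra.
have [mu [kmu muk' ne fmu]] := rsecular_zero (w0 _ wk) (w0 _ wk').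
have KD := DK _ ne fmu; set D := rsecular2 lam w mu in KD.
have [i ik [ri rl]] : exists2 i, 81 * K <= t ^+ 2 * w i &
    0 < `|lam i - mu| /\ forall l, `|lam i - mu| <= `|lam l - mu|.
  have lk (l : 'I_N) : (l <= k)%N -> mu - lam k <= `|lam l - mu|.
    rewrite distrC => lk; apply: le_trans (ler_norm _); rewrite lerB//.
    by move: lk; rewrite leq_eqVlt => /orP[/eqP/val_inj->//|/lam_incr/ltW].
  have lk' (l : 'I_N) : (k < l)%N -> lam k' - mu <= `|lam l - mu|.
    move=> kl; apply: le_trans (ler_norm _); rewrite lerB//.
    by move: kl; rewrite -kk' leq_eqVlt => /orP[/eqP/val_inj->//|/lam_incr/ltW].
  have [le|le] := leP (mu - lam k) (lam k' - mu).
    exists k => //; rewrite distrC gtr0_norm ?subr_gt0//; split=> // l.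
    by have [/lk//|/lk'] := leqP l k; apply: le_trans.
  exists k' => //; rewrite gtr0_norm ?subr_gt0//; split=> // l.
  by have [/lk|/lk'//] := leqP l k; apply: le_trans; exact: ltW.
set r := `|lam i - mu| in ri rl.
have Dr : w i <= r ^+ 2 * D.
  rewrite -ler_pdivrMl ?exprn_gt0// mulrC /D /rsecular2 (bigD1 i)//=.
  rewrite /r real_normK ?num_real// lerDl sumr_ge0// => l _.
  by rewrite mulr_ge0// invr_ge0 sqr_ge0.
have trD : 9 <= t * r * D.
  rewrite leNgt; apply/negP => trD.
  have D0 : 0 < D by rewrite -(pmulr_rgt0 _ K0); lra.
  have tr0 : 0 < t * r by rewrite mulr_gt0.
  have h1 : t * r < 9 * K by nra.
  have h2 : t ^+ 2 * w i <= (t * r) * (t * r * D).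
    have -> : (t * r) * (t * r * D) = t ^+ 2 * (r ^+ 2 * D) by ring.
    by rewrite ler_wpM2l ?sqr_ge0.
  have h3 : (t * r) * (t * r * D) < 81 * K by nra.
  by lra.
have [z rz zr] := secular_root_near t0 w_ge0 ri rl fmu trD.
have Rez : `|mu - complex.Re z| < r.
  rewrite -(ltr_pXn2r (n := 2)) ?nnegrE ?normr_ge0 ?(ltW ri)//.
  rewrite real_normK ?num_real//; apply: le_lt_trans zr.
  by rewrite lerDl sqr_ge0.
have zl l : z != (lam l)%:C.
  apply/eqP => zE; have := rl l; rewrite leNgt distrC.
  by move: Rez; rewrite zE => ->.
exists z; split => //.
- move: rz => /rootP; rewrite horner_secular_poly// => /eqP.
  rewrite mulf_eq0 prodf_seq_eq0 => /orP[/hasP[l _] /=|/eqP//].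
  by rewrite subr_eq0 (negbTE (zl l)).
- have := rl k; rewrite distrC gtr0_norm ?subr_gt0// => rk.
  by move: Rez; rewrite ltr_norml => /andP[_]; lra.
- have := rl k'; rewrite gtr0_norm ?subr_gt0// => rk.
  by move: Rez; rewrite ltr_norml => /andP[]; lra.
Qed.

End secular_roots.

(** * Hermitian matrices and their weights *)

(* Indices start at 0 here and at 1 in [ordered_eigenvalue]. *)
HB.lock Definition eigval (R : realType) (n : nat) (A : 'M[R[i]]_n) (k : nat) : R :=
  ordered_eigenvalue A k.+1.
Arguments eigval {R n} A k.

Section spectral.
Context {R : realType}.
Local Notation C := R[i].
Local Open Scope sesquilinear_scope.

Lemma eigvalE n (A : 'M[C]_n) k : eigval A k = ordered_eigenvalue A k.+1.
Proof. by rewrite unlock. Qed.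

Definition eigval_mx n (A : 'M[C]_n) : 'M[C]_n :=
  diag_mx (\row_k (eigval A k)%:C).

(** The rows of [P] are unit left eigenvectors of [A], in increasing order of their eigenvalues. *)
Definition diagonalizes n (P A : 'M[C]_n) :=
  P \is unitarymx /\ A = P ^t* *m eigval_mx A *m P.

Lemma char_poly_spectral_diag n (A : 'M[C]_n) : A \is hermsymmx ->
  char_poly A = \prod_i ('X - (spectral_diag A 0 i)%:P).
Proof.
move=> /hermitian_normalmx/orthomx_spectralP AE.
have Su := spectral_unit A.
set S := spectralmx A in AE Su; set D := diag_mx _ in AE.
transitivity (char_poly D); last first.
  rewrite char_poly_trig ?diag_mx_is_trig//.
  by apply: eq_bigr => i _; rewrite mxE eqxx mulr1n.
have SV : map_mx (@polyC C) (invmx S) *m map_mx (@polyC C) S = 1%:M.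
  by rewrite -map_mxM mulVmx// map_mx1.
rewrite /char_poly /char_poly_mx {1}AE !map_mxM.
have -> : 'X%:M - map_mx polyC (invmx S) *m map_mx polyC D *m map_mx polyC S =
   map_mx polyC (invmx S) *m ('X%:M - map_mx polyC D) *m map_mx polyC S.
  by rewrite mulmxBr mulmxBl mul_mx_scalar -scalemxAl SV scalemx1.
by rewrite !det_mulmx mulrAC -det_mulmx SV det1 mul1r.
Qed.

Lemma eigval_spectral_diag n (A : 'M[C]_n) : A \is hermsymmx ->
  exists s : 'S_n, forall k : 'I_n, (eigval A k)%:C = spectral_diag A 0 (s k).
Proof.
move=> hA; set d := spectral_diag A.
have dr i : d 0 i = (complex.Re (d 0 i))%:C.
  have /mxOverP/(_ 0 i) := hermitian_spectral_diag_real hA.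
  by move=> /RRe_real ->.
pose e := [tuple complex.Re (d 0 i) | i < n].
have pe : perm_eq (spectrum_seq A) [seq d 0 i | i <- enum 'I_n].
  apply: prod_XsubC_eq; rewrite big_map big_enum -char_poly_spectral_diag//.
  rewrite /spectrum_seq; case: closed_field_poly_normal => /= r rE.
  by rewrite [RHS]rE (monicP (char_poly_monic A)) scale1r.
have : perm_eq (sort <=%R (map (@complex.Re R) (spectrum_seq A))) e.
  rewrite perm_sort; apply: perm_trans (perm_map _ pe) _.
  by rewrite -map_comp.
move=> /tuple_permP[s sE]; exists s => k.
rewrite eigvalE /ordered_eigenvalue /= sE dr.
by rewrite (nth_map k) ?size_enum_ord// nth_ord_enum tnth_map tnth_ord_tuple.
Qed.

Lemma diagonalizable n (A : 'M[C]_n) : A \is hermsymmx ->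
  exists P, diagonalizes P A.
Proof.
move=> hA; have [s sE] := eigval_spectral_diag hA.
have /orthomx_spectralP := hermitian_normalmx hA.
set S := spectralmx A; set d := spectral_diag A => AE.
have Su : S \is unitarymx by exact: spectral_unitarymx.
exists (row_perm s S); split.
  apply/unitarymxP/matrixP => i j; rewrite !mxE.
  have /unitarymxP/matrixP/(_ (s i) (s j)) := Su; rewrite !mxE (inj_eq perm_inj) => <-.
  by apply: eq_bigr => k _; rewrite !mxE.
rewrite {1}AE invmx_unitary//; apply/matrixP => i j.
rewrite !mxE (reindex_inj (@perm_inj _ s)); apply: eq_bigr => k _.
by rewrite !mul_mx_diag !mxE sE.
Qed.

Lemma eigval_le n (A : 'M[C]_n) i j : A \is hermsymmx -> (i <= j < n)%N ->
  eigval A i <= eigval A j.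
Proof.
move=> hA /andP[ij jn]; have [s sE] := eigval_spectral_diag hA.
have sz : size (spectrum_seq A) = n.
  rewrite /spectrum_seq; case: closed_field_poly_normal => /= r rE.
  have := size_char_poly A; rewrite rE (monicP (char_poly_monic A)) scale1r.
  by rewrite size_prod_XsubC => -[].
rewrite !eigvalE; apply: (sorted_leq_nth le_trans lexx) => //.
- exact: sort_le_sorted.
- by rewrite inE size_sort size_map sz (leq_ltn_trans ij).
- by rewrite inE size_sort size_map sz.
Qed.

Definition simple_spectrum n (A : 'M[C]_n) :=
  forall i j : 'I_n, (i < j)%N -> eigval A i < eigval A j.

Lemma simple_spectrum_inj n (A : 'M[C]_n) (i j : 'I_n) : simple_spectrum A ->
  i != j -> eigval A i != eigval A j.
Proof.
move=> sA; rewrite -val_eqE neq_ltn => /orP[] /sA.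
  by move=> /lt_eqF ->.
by move=> /gt_eqF ->.
Qed.

Lemma diagonalizesE n (P A : 'M[C]_n) : diagonalizes P A ->
  P *m A = eigval_mx A *m P.
Proof.
move=> [/unitarymxP PP AE].
by rewrite {1}AE !mulmxA PP mul1mx.
Qed.

Lemma unitarymxC n (P : 'M[C]_n) : P \is unitarymx -> P ^t* *m P = 1%:M.
Proof. by move=> /unitarymxP/mulmx1C. Qed.

Lemma det_sub_hermitian n (A : 'M[C]_n) (x : C) : A \is hermsymmx ->
  \det (x%:M - A) = \prod_(k < n) (x - (eigval A k)%:C).
Proof.
move=> /diagonalizable[P PA]; have [Pu AE] := PA.
have -> : x%:M - A = P ^t* *m (x%:M - eigval_mx A) *m P.
  by rewrite mulmxBr mulmxBl -AE mul_mx_scalar -scalemxAl unitarymxC// scalemx1.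
rewrite !det_mulmx mulrAC -det_mulmx unitarymxC// det1 mul1r.
rewrite -diag_const_mx -raddfB det_diag; apply: eq_bigr => k _.
by rewrite !mxE.
Qed.

Definition sqmod (z : C) : R := complex.Re z ^+ 2 + complex.Im z ^+ 2.

Lemma sqmodE z : (sqmod z)%:C = z^* * z.
Proof.
by case: z => a c; apply/eqP; rewrite eq_complex /sqmod /=; apply/andP; split;
  apply/eqP; ring.
Qed.

Lemma sqmodM y z : sqmod (y * z) = sqmod y * sqmod z.
Proof. by rewrite /sqmod Re_mul Im_mul; ring. Qed.

Lemma sqmod_ge0 z : 0 <= sqmod z.
Proof. by rewrite addr_ge0 ?sqr_ge0. Qed.

Lemma sqmod_eq0 z : (sqmod z == 0) = (z == 0).
Proof.
by case: z => a c; rewrite /sqmod paddr_eq0 ?sqr_ge0// !sqrf_eq0 eq_complex.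
Qed.

(* The squared modulus of the inner product of c with the l-th unit
   eigenvector, written without reference to an eigenbasis: the product of the
   [A - eigval A m], [m != l], is a multiple of the l-th eigenprojector. *)
Definition weight n (A : 'M[C]_n) (l : 'I_n) (c : 'cV[C]_n) : R :=
  complex.Re ((c ^t* *m \big[mulmx/1%:M]_(m | m != l)
    (A - ((eigval A m)%:C)%:M) *m c) 0 0) /
  \prod_(m < n | m != l) (eigval A l - eigval A m).

(** In an eigenbasis the product of the [A - eigval A m] is diagonal, and its only nonzero entry,
    the one at [l], is the denominator of [weight]. *)
Lemma weightE n (P A : 'M[C]_n) l c : diagonalizes P A -> simple_spectrum A ->
  weight A l c = sqmod ((P *m c) l 0).
Proof.
move=> PA sA; have [Pu AE] := PA.
have bigE r : \big[mulmx/1%:M]_(m <- r | m != l) (A - ((eigval A m)%:C)%:M) =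
    P ^t* *m diag_mx (\row_j \prod_(m <- r | m != l)
      ((eigval A j)%:C - (eigval A m)%:C)) *m P.
  elim: r => [|m r IH].
    rewrite big_nil -[LHS](unitarymxC Pu); congr (_ *m _).
    rewrite -[LHS]mulmx1; congr (_ *m _).
    by apply/matrixP => i j; rewrite !mxE big_nil.
  set D := \row_j \prod_(m <- r | m != l) _ in IH.
  set D' := \row_j _.
  rewrite big_cons; case: ifPn => ml; last first.
    rewrite IH; suff D'E : D' = D by rewrite D'E.
    by apply/rowP => j; rewrite !mxE big_cons (negbTE ml).
  have -> : A - ((eigval A m)%:C)%:M =
      P ^t* *m (eigval_mx A - ((eigval A m)%:C)%:M) *m P.
    by rewrite mulmxBr mulmxBl -AE mul_mx_scalar -scalemxAl unitarymxC// scalemx1.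
  rewrite IH !mulmxA (mulmxtVK _ Pu) -[X in X *m P = _]mulmxA.
  suff DE : (eigval_mx A - ((eigval A m)%:C)%:M) *m diag_mx D = diag_mx D'.
    by rewrite DE.
  rewrite -diag_const_mx -raddfB mulmx_diag; congr diag_mx.
  by apply/rowP => j; rewrite !mxE big_cons ml.
rewrite /weight bigE; set D := \row_j _; set w := P *m c.
have -> : (c ^t* *m (P ^t* *m diag_mx D *m P) *m c) 0 0 =
   (sqmod (w l 0) * \prod_(m < n | m != l) (eigval A l - eigval A m))%:C.
  rewrite !mulmxA -map_mxM -trmx_mul -mulmxA -/w mul_mx_diag mxE (bigD1 l)//= big1.
    rewrite addr0 !mxE rmorphM /= sqmodE rmorph_prod /= mulrAC; congr (_ * _).
    by apply: eq_bigr => m _; rewrite rmorphB.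
  move=> j jl; have Dj : D 0 j = 0 by rewrite mxE (bigD1 j)//= subrr mul0r.
  by rewrite mxE Dj mulr0 mul0r.
rewrite /= mulfK//; apply/prodf_neq0 => m ml.
by rewrite subr_eq0 simple_spectrum_inj// eq_sym.
Qed.

Lemma weight_ge0 n (A : 'M[C]_n) l c : A \is hermsymmx -> simple_spectrum A ->
  0 <= weight A l c.
Proof.
by move=> /diagonalizable[P PA] sA; rewrite (weightE _ _ PA)// sqmod_ge0.
Qed.

(** With a simple spectrum [u] is a multiple of one row of any diagonalizing matrix, and the sum of
    the [sqmod (u 0 j)] is the squared modulus of the factor. *)
Lemma eigvec_weight n (A : 'M[C]_n) (mu : R) (u : 'rV[C]_n) (c : 'cV[C]_n) :
  A \is hermsymmx -> simple_spectrum A -> u != 0 -> u *m A = mu%:C *: u ->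
  exists2 l : 'I_n, eigval A l = mu &
    sqmod ((u *m c) 0 0) = weight A l c * \sum_j sqmod (u 0 j).
Proof.
move=> /diagonalizable[P PA] sA u0 uA; have [Pu AE] := PA.
set y := u *m P ^t*.
have uE : u = y *m P by rewrite /y -mulmxA unitarymxC// mulmx1.
have yy : y *m y ^t* = u *m u ^t*.
  have -> : u ^t* = P ^t* *m y ^t* by rewrite {1}uE trmx_mul map_mxM.
  by rewrite mulmxA.
have yE j : y 0 j * (eigval A j)%:C = mu%:C * y 0 j.
  have : y *m eigval_mx A = mu%:C *: y.
    by rewrite /y scalemxAl -uA [in RHS]AE !mulmxA (mulmxtVK _ Pu).
  by move=> /matrixP/(_ 0 j); rewrite mul_mx_diag !mxE.
clearbody y; have /rV0Pn[l yl] : y != 0 by apply: contra_neq u0 => y0; rewrite uE y0 mul0mx.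
have mul : eigval A l = mu.
  have := yE l; rewrite mulrC => /(mulIf yl).
  by move=> /complexI.
have yj j : j != l -> y 0 j = 0.
  move=> jl; apply/eqP; have := yE j.
  rewrite mulrC => /eqP; rewrite -subr_eq0 -mulrBl mulf_eq0 => /orP[|//].
  rewrite subr_eq0 (inj_eq (@complexI R)) -mul.
  by rewrite (negbTE (simple_spectrum_inj sA jl)).
have uc d (B : 'M[C]_(n, d)) k : (u *m B) 0 k = y 0 l * (P *m B) l k.
  rewrite uE -mulmxA mxE (bigD1 l)//= big1 ?addr0// => j jl.
  by rewrite yj// mul0r.
exists l => //; rewrite uc sqmodM (weightE _ _ PA)// mulrC; congr (_ * _).
apply: complexI; rewrite sqmodE.
transitivity ((y *m y ^t*) 0 0).
  rewrite !mxE (bigD1 l)//= big1 ?addr0 => [|j jl]; last by rewrite yj// mul0r.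
  by rewrite !mxE mulrC.
rewrite yy mxE rmorph_sum; apply: eq_bigr => j _.
by rewrite !mxE /= sqmodE mulrC.
Qed.

Definition cplx m n (A : 'M[R]_(m, n)) : 'M[C]_(m, n) := map_mx (real_complex R) A.

Lemma cplx_trC m n (A : 'M[R]_(m, n)) : (cplx A) ^t* = cplx A^T.
Proof. by apply/matrixP => i j; rewrite !mxE; apply: conjc_real. Qed.

Lemma cplxM m n p (A : 'M[R]_(m, n)) (B : 'M[R]_(n, p)) :
  cplx (A *m B) = cplx A *m cplx B.
Proof. exact: map_mxM. Qed.

Definition orthogonal n (O : 'M[R]_n) := O *m O^T = 1%:M.

Lemma orthogonal_unitary n (O : 'M[R]_n) : orthogonal O -> cplx O \is unitarymx.
Proof.
by move=> OO; apply/unitarymxP; rewrite cplx_trC -cplxM OO /cplx map_mx1.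
Qed.

Lemma orthogonal_trmx n (O : 'M[R]_n) : orthogonal O -> O^T *m O = 1%:M.
Proof. exact: mulmx1C. Qed.

(** Real orthogonal conjugations move the real vector [b] to any real unit vector, and they act by
    real orthogonal maps on the coordinates of a Hermitian matrix. *)
Definition conj_mx n (O : 'M[R]_n) (A : 'M[C]_n) : 'M[C]_n :=
  cplx O *m A *m cplx O^T.

Lemma char_poly_conj_mx n (O : 'M[R]_n) (A : 'M[C]_n) : orthogonal O ->
  char_poly (conj_mx O A) = char_poly A.
Proof.
move=> OO; rewrite /char_poly /char_poly_mx /conj_mx !map_mxM.
set P := map_mx polyC (cplx O); set Q := map_mx polyC (cplx O^T).
have PQ : P *m Q = 1%:M.
  by rewrite -map_mxM -cplxM OO /cplx !map_mx1.
have -> : 'X%:M - P *m map_mx polyC A *m Q = P *m ('X%:M - map_mx polyC A) *m Q.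
  by rewrite mulmxBr mulmxBl mul_mx_scalar -scalemxAl PQ scalemx1.
by rewrite !det_mulmx mulrAC -det_mulmx PQ det1 mul1r.
Qed.

Lemma eigval_conj_mx n (O : 'M[R]_n) (A : 'M[C]_n) k : orthogonal O ->
  eigval (conj_mx O A) k = eigval A k.
Proof.
by move=> OO; rewrite !eigvalE /ordered_eigenvalue /spectrum_seq char_poly_conj_mx.
Qed.

Lemma simple_conj_mx n (O : 'M[R]_n) (A : 'M[C]_n) : orthogonal O ->
  simple_spectrum (conj_mx O A) <-> simple_spectrum A.
Proof.
by move=> OO; split=> sA i j ij; have := sA i j ij; rewrite !eigval_conj_mx.
Qed.

Lemma weight_conj_mx n (O : 'M[R]_n) (A : 'M[C]_n) l c : orthogonal O ->
  A \is hermsymmx -> simple_spectrum A ->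
  weight (conj_mx O A) l (cplx O *m c) = weight A l c.
Proof.
move=> OO /diagonalizable[P PA] sA; have [Pu AE] := PA.
have Ot : (cplx O) ^t* \is unitarymx by rewrite trmxC_unitary orthogonal_unitary.
rewrite cplx_trC in Ot.
have PA' : diagonalizes (P *m cplx O^T) (conj_mx O A).
  split; first exact: (mul_unitarymx Pu Ot).
  have -> : eigval_mx (conj_mx O A) = eigval_mx A.
    by congr diag_mx; apply/rowP => j; rewrite !mxE eigval_conj_mx.
  by rewrite {1}/conj_mx {1}AE trmx_mul map_mxM /= cplx_trC trmxK !mulmxA.
rewrite (weightE _ _ PA')// ?(weightE _ _ PA)//; last exact/simple_conj_mx.
by rewrite -mulmxA [cplx O^T *m _]mulmxA -cplxM orthogonal_trmx// /cplx map_mx1 mul1mx.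
Qed.

Lemma weightZ n (A : 'M[C]_n) l c (a : R) : A \is hermsymmx -> simple_spectrum A ->
  weight A l (a%:C *: c) = a ^+ 2 * weight A l c.
Proof.
move=> /diagonalizable[P PA] sA; rewrite !(weightE _ _ PA)//.
by rewrite -scalemxAr mxE sqmodM /sqmod /= expr0n addr0.
Qed.

Lemma eigenvalue_perturbed_conj n (O : 'M[R]_n) (A : 'M[C]_n) b z :
  orthogonal O -> eigenvalue (perturbed (conj_mx O A) (O *m b)) z ->
  eigenvalue (perturbed A b) z.
Proof.
move=> OO /eigenvalueP[v vW v0]; have Ou := orthogonal_unitary OO.
have OTO : cplx O^T *m cplx O = 1%:M by rewrite -cplxM orthogonal_trmx// /cplx map_mx1.
have OOT : cplx O *m cplx O^T = 1%:M by rewrite -cplxM OO /cplx map_mx1.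
have WE : perturbed (conj_mx O A) (O *m b) = cplx O *m perturbed A b *m cplx O^T.
  rewrite /perturbed mulmxDr mulmxDl -scalemxAr -scalemxAl; congr (_ + _ *: _).
  rewrite -/(cplx (O *m b *m (O *m b)^T)) -/(cplx (b *m b^T)) trmx_mul.
  by rewrite !cplxM !mulmxA.
apply/eigenvalueP; exists (v *m cplx O).
  by rewrite scalemxAl -vW WE !mulmxA -[RHS]mulmxA OTO mulmx1.
apply: contra_neq v0 => vO.
by rewrite -[v]mulmx1 -OOT mulmxA vO mul0mx.
Qed.

End spectral.

(** * Rank one perturbation and minors *)

Section rank_one.
Context {R : realType}.
Local Notation C := R[i].
Local Open Scope sesquilinear_scope.

Lemma sqmod0 : sqmod (0 : C) = 0.
Proof. by apply/eqP; rewrite sqmod_eq0. Qed.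

Definition axis n : 'cV[R]_n.+1 := delta_mx 0 0.

Definition minor0 n (G : 'M[C]_n.+1) : 'M[C]_n := row' 0 (col' 0 G).
Definition border0 n (G : 'M[C]_n.+1) : 'cV[C]_n := row' 0 (col 0 G).

Lemma minor0_hermsym n (G : 'M[C]_n.+1) :
  G \is hermsymmx -> minor0 G \is hermsymmx.
Proof.
move=> /is_hermitianmxP; rewrite expr0 scale1r => GE.
apply/is_hermitianmxP; rewrite expr0 scale1r.
by apply/matrixP => i j; rewrite !mxE {1}GE !mxE.
Qed.

(* The vector [b^T (z - G)^-1], with [b] the first basis vector. *)
Definition resolvent_row n (P G : 'M[C]_n.+1) (z : C) : 'rV[C]_n.+1 :=
  \sum_l ((P l 0)^* / (z - (eigval G l)%:C)) *: row l P.

Section resolvent.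
Variables (n : nat) (P G : 'M[C]_n.+1) (z : C).
Hypotheses (PG : diagonalizes P G) (sG : simple_spectrum G).
Hypothesis zG : forall l : 'I_n.+1, z != (eigval G l)%:C.
Let w l := weight G l (cplx (axis n)).
Let x := resolvent_row P G z.

Let wE l : (w l)%:C = (P l 0)^* * P l 0.
Proof.
rewrite /w (weightE _ _ PG)// sqmodE; congr (_^* * _);
  rewrite mxE (bigD1 0)//= big1 ?addr0 => [|j j0];
  rewrite !mxE ?eqxx ?mulr1//= (negbTE j0) mulr0//.
Qed.

Lemma resolvent_row_sub : z *: x - x *m G = cplx (axis n)^T.
Proof.
have [Pu GE] := PG.
have rowG l : row l P *m G = (eigval G l)%:C *: row l P.
  rewrite -row_mul (diagonalizesE PG) mul_diag_mx.
  by apply/rowP => j; rewrite !mxE.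
rewrite /x /resolvent_row scaler_sumr mulmx_suml -sumrB.
transitivity (\sum_l (P l 0)^* *: row l P).
  apply: eq_bigr => l _; rewrite -scalemxAl rowG !scalerA -scalerBl.
  congr (_ *: _); have h : z - (eigval G l)%:C != 0 by rewrite subr_eq0.
  by field.
apply/rowP => j; have /matrixP/(_ 0 j) := unitarymxC Pu.
rewrite !mxE summxE => E.
have -> : ((j == 0) && ((0 : 'I_1) == 0))%:R%:C = ((0 : 'I_n.+1) == j)%:R :> C.
  by rewrite eq_sym andbT; case: eqP.
by rewrite -E; apply: eq_bigr => l _; rewrite !mxE.
Qed.

Lemma resolvent_row_axis :
  (x *m cplx (axis n)) 0 0 = - secular (fun l => eigval G l) w z.
Proof.
rewrite mxE (bigD1 0)//= big1 ?addr0 => [|j j0]; last first.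
  by rewrite !mxE (negbTE j0) mulr0.
rewrite !mxE eqxx mulr1 summxE /secular -sumrN; apply: eq_bigr => l _.
by rewrite !mxE wE mulrAC -[RHS]mulrN -invrN opprB.
Qed.

(** The resolvent row is itself a left eigenvector: writing [b] for the first basis vector,
    [x W = z x - (1 + i N secular z) b^T]. *)
Lemma eigenvalue_perturbed :
  1 + 'i%C * (n.+1%:R)%:C * secular (fun l => eigval G l) w z = 0 ->
  eigenvalue (perturbed G (axis n)) z.
Proof.
move=> sec; apply/eigenvalueP; exists x.
  have xG : x *m G = z *: x - cplx (axis n)^T.
    by rewrite -resolvent_row_sub opprB addrC subrK.
  rewrite /perturbed mulmxDr xG -scalemxAr -/(cplx _) cplxM mulmxA.
  have -> : x *m cplx (axis n) = (- secular (fun l => eigval G l) w z)%:M.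
    by apply/matrixP => i j; rewrite !ord1 resolvent_row_axis mxE mulr1n.
  rewrite mul_scalar_mx scalerA -addrA -[RHS]addr0; congr (_ + _).
  rewrite -scaleN1r -scalerDl; rewrite rmorph_nat in sec.
  rewrite (_ : -1 + _ = - (1 + 'i%C * n.+1%:R * secular (fun l => eigval G l) w z)).
    by rewrite sec oppr0 scale0r.
  by ring.
(* The row is nonzero because [z x - x G] is the first basis vector. *)
apply/eqP => x0; have := resolvent_row_sub; rewrite x0 scaler0 mul0mx subr0.
by move=> /matrixP/(_ 0 0); rewrite !mxE /= => -[] /esym/eqP; rewrite oner_eq0.
Qed.

End resolvent.

Lemma resolvent_row_sqmod n (P G : 'M[C]_n.+1) (mu : R) :
  diagonalizes P G -> simple_spectrum G ->
  \sum_j sqmod (resolvent_row P G mu%:C 0 j) =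
  rsecular2 (fun l => eigval G l) (fun l => weight G l (cplx (axis n))) mu.
Proof.
move=> PG sG; have [/unitarymxP Pu _] := PG.
pose y := \row_l ((P l 0)^* / (mu%:C - (eigval G l)%:C)).
have xE : resolvent_row P G mu%:C = y *m P.
  by apply/rowP => j; rewrite summxE !mxE; apply: eq_bigr => l _; rewrite !mxE.
have sq (v : 'rV[C]_n.+1) : (\sum_j sqmod (v 0 j))%:C = (v *m v ^t*) 0 0.
  rewrite mxE rmorph_sum; apply: eq_bigr => j _.
  by rewrite !mxE /= sqmodE mulrC.
apply: complexI; rewrite sq xE trmx_mul map_mxM mulmxA -[y *m P *m _]mulmxA Pu.
rewrite mulmx1 -sq; congr (_%:C); apply: eq_bigr => l _.
rewrite !mxE sqmodM (weightE _ _ PG)//; congr (_ * _).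
  rewrite mxE (bigD1 0)//= big1 ?addr0 => [|j j0].
    by rewrite !mxE /= mulr1 /sqmod; case: (P l 0) => a c /=; rewrite sqrrN.
  by rewrite !mxE (negbTE j0) mulr0.
rewrite -rmorphB -fmorphV /sqmod /= expr0n addr0 exprVn.
by rewrite -sqrrN opprB.
Qed.

Lemma mulmx_minor0 n (u : 'rV[C]_n.+1) (G : 'M[C]_n.+1) : u 0 0 = 0 ->
  col' 0 u *m minor0 G = col' 0 (u *m G) /\
  (col' 0 u *m border0 G) 0 0 = (u *m G) 0 0.
Proof.
move=> u0; split; first apply/rowP => j.
  by rewrite !mxE big_ord_recl u0 mul0r add0r; apply: eq_bigr => i _; rewrite !mxE.
by rewrite !mxE big_ord_recl u0 mul0r add0r; apply: eq_bigr => i _; rewrite !mxE.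
Qed.

(** The first coordinate of [x G = mu x - b^T] says that the tail of [x] pairs with the border to
    -1. As this tail is an eigenvector of the minor, [eigvec_weight] gives [1 = weight * |x|^2] for
    one of the border weights, and [|x|^2] is [rsecular2] at [mu]. *)
Lemma rsecular2_ge_border n (G : 'M[C]_n.+1) (K mu : R) :
  G \is hermsymmx -> simple_spectrum G -> simple_spectrum (minor0 G) ->
  (forall l, weight (minor0 G) l (border0 G) <= K) ->
  (forall l : 'I_n.+1, eigval G l != mu) ->
  rsecular (fun l => eigval G l) (fun l => weight G l (cplx (axis n))) mu = 0 ->
  1 <= K * rsecular2 (fun l => eigval G l)
             (fun l => weight G l (cplx (axis n))) mu.
Proof.
move=> hG sG sM wK Gmu fmu; have [P PG] := diagonalizable hG.
have muG (l : 'I_n.+1) : mu%:C != (eigval G l)%:C.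
  by rewrite (inj_eq (@complexI R)) eq_sym.
set x := resolvent_row P G mu%:C.
have x0 : x 0 0 = 0.
  have := resolvent_row_axis mu%:C PG sG; rewrite secular_real fmu oppr0 => <-.
  rewrite mxE (bigD1 0)//= big1 ?addr0 => [|j j0]; last first.
    by rewrite !mxE (negbTE j0) mulr0.
  by rewrite !mxE mulr1.
have xG : x *m G = mu%:C *: x - cplx (axis n)^T.
  by rewrite -(resolvent_row_sub PG muG) opprB addrC subrK.
have [xM xg] := mulmx_minor0 G x0.
have g1 : (col' 0 x *m border0 G) 0 0 = -1.
  by rewrite xg xG !mxE x0 mulr0 add0r.
have x'0 : col' 0 x != 0.
  apply/eqP => x'0; move: g1; rewrite x'0 mul0mx mxE => /eqP.
  by rewrite eq_sym oppr_eq0 oner_eq0.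
have x'M : col' 0 x *m minor0 G = mu%:C *: col' 0 x.
  by rewrite xM xG; apply/rowP => j; rewrite !mxE /= subr0.
have [l _] := eigvec_weight (border0 G) (minor0_hermsym hG) sM x'0 x'M.
rewrite g1 => wE.
have <- : \sum_j sqmod (x 0 j) = rsecular2 (fun l => eigval G l)
             (fun l => weight G l (cplx (axis n))) mu.
  exact: resolvent_row_sqmod.
rewrite big_ord_recl x0 sqmod0 add0r.
have s1 : sqmod (-1 : C) = 1 by rewrite /sqmod /=; ring.
rewrite -[X in X <= _]s1 wE (eq_bigr (fun j => sqmod (x 0 (lift 0 j)))) => [|j _]; last by rewrite mxE.
by rewrite ler_wpM2r ?wK// sumr_ge0// => j _; exact: sqmod_ge0.
Qed.

(** A multiple eigenvalue has an eigenspace of dimension at least 2, which contains a nonzero vector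
    with first coordinate 0. Its tail is an eigenvector of the minor, and the remaining coordinate
    of the eigenvector equation makes it pair to 0 with the border. *)
Lemma not_simple_minor0 n (G : 'M[C]_n.+1) : G \is hermsymmx ->
  ~ simple_spectrum G -> simple_spectrum (minor0 G) ->
  exists l, weight (minor0 G) l (border0 G) = 0.
Proof.
move=> hG nG sM; have [P PG] := diagonalizable hG; have [Pu _] := PG.
have [i [j [ij eij]]] : exists i j : 'I_n.+1, i != j /\ eigval G i = eigval G j.
  apply: contrapT => H; apply: nG => i j ij.
  rewrite lt_neqAle eigval_le ?(ltnW ij) ?ltn_ord// andbT.
  apply/eqP => E; apply: H; exists i, j; split => //.
  by rewrite -val_eqE /= ltn_eqF.
have rowG l : row l P *m G = (eigval G l)%:C *: row l P.
  rewrite -row_mul (diagonalizesE PG) mul_diag_mx.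
  by apply/rowP => m; rewrite !mxE.
have rowP1 l m : (row l P *m P ^t*) 0 m = (l == m)%:R.
  by have /unitarymxP/matrixP/(_ l m) := Pu; rewrite -row_mul [RHS]mxE [X in _ -> X = _]mxE.
have [u [u0 uG un]] : exists u : 'rV[C]_n.+1,
    [/\ u 0 0 = 0, u *m G = (eigval G i)%:C *: u & u != 0].
  have [Pi0|Pi0] := eqVneq (P i 0) 0.
    exists (row i P); split; rewrite ?mxE ?Pi0//.
    apply/eqP => r0; have := rowP1 i i; rewrite r0 mul0mx mxE eqxx => /eqP.
    by rewrite eq_sym oner_eq0.
  exists (P j 0 *: row i P - P i 0 *: row j P); split.
  - by rewrite !mxE mulrC subrr.
  - by rewrite mulmxBl -!scalemxAl !rowG -eij scalerBr !scalerA
      [_ * P j 0]mulrC [_ * P i 0]mulrC.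
  - apply/eqP => /(congr1 (fun u => (u *m P ^t*) 0 j)).
    have ent (a c : C) (A B : 'rV[C]_n.+1) :
      (a *: A - c *: B) 0 j = a * A 0 j - c * B 0 j by rewrite !mxE.
    rewrite mul0mx mulmxBl -!scalemxAl ent !rowP1.
    rewrite (negbTE ij) eqxx mulr0 mulr1 sub0r mxE => /eqP.
    by rewrite oppr_eq0 (negbTE Pi0).
have [uM ug] := mulmx_minor0 G u0.
have u'0 : col' 0 u != 0.
  apply: contra_neq un => u'0; apply/rowP => m; rewrite mxE.
  have [->//|m0] := eqVneq m 0; have [m' ->] : exists m', m = lift 0 m'.
    by case: (unliftP 0 m) m0 => [m' ->|->]; [exists m'|rewrite eqxx].
  by have /rowP/(_ m') := u'0; rewrite !mxE.
have u'M : col' 0 u *m minor0 G = (eigval G i)%:C *: col' 0 u.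
  by rewrite uM uG; apply/rowP => m; rewrite !mxE.
have [l _] := eigvec_weight (border0 G) (minor0_hermsym hG) sM u'0 u'M.
rewrite ug uG mxE u0 mulr0 sqmod0 => /esym/eqP.
rewrite mulf_eq0 => /orP[/eqP wl|]; first by exists l.
rewrite psumr_eq0 => [/allP H|m _]; last exact: sqmod_ge0.
case/negP: u'0; apply/eqP/rowP => m; apply/eqP.
by rewrite [X in _ == X]mxE -sqmod_eq0; apply: H; rewrite mem_index_enum.
Qed.

Lemma perturbed_eigenvalue_between n (G : 'M[C]_n.+1) (K : R) (k k' : 'I_n.+1) :
  G \is hermsymmx -> simple_spectrum G -> simple_spectrum (minor0 G) ->
  k' = k.+1 :> nat -> 0 < K ->
  (forall l, weight (minor0 G) l (border0 G) <= K) ->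
  81 * K <= n.+1%:R ^+ 2 * weight G k (cplx (axis n)) ->
  81 * K <= n.+1%:R ^+ 2 * weight G k' (cplx (axis n)) ->
  exists z : C, [/\ eigenvalue (perturbed G (axis n)) z,
    eigval G k < complex.Re z & complex.Re z < eigval G k'].
Proof.
move=> hG sG sM kk' K0 wK wk wk'; have [P PG] := diagonalizable hG.
have [] := secular_root_between kk' sG
  (fun l => weight_ge0 l (cplx (axis n)) hG sG) (ltr0Sn _ n) K0 wk wk'.
  by move=> mu Gmu fmu; exact: rsecular2_ge_border.
move=> z [zG sec kz zk']; exists z; split => //.
exact: eigenvalue_perturbed PG _ zG _.
Qed.

End rank_one.

(** * The normal law *)

Section lebesgue_affine.
Context {R : realType}.
Local Open Scope ereal_scope.
Local Notation mu := (@lebesgue_measure R).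

Let shift (a : R) : measurableTypeR R -> measurableTypeR R := fun x => (x + a)%R.

Lemma measurable_shift a : measurable_fun setT (shift a).
Proof. exact: measurable_funD. Qed.

HB.instance Definition _ a := @isMeasurableFun.Build _ _ _ _ (shift a) (measurable_shift a).

Lemma lebesgue_measure_shift (a : R) (A : set R) : measurable A ->
  pushforward mu (shift a) A = mu A.
Proof.
move=> mA; apply/esym/lebesgue_measure_unique => //= _ [[c e]] _ <-.
rewrite /pushforward.
rewrite (_ : _ @^-1` _ = `](c - a)%R, (e - a)%R]%classic).
  rewrite !lebesgue_measure_itv/= !lte_fin ltrD2r; case: ifP => // _.
  by rewrite -!EFinD; congr EFin; ring.
by apply/seteqP; split => x /=; rewrite !in_itv/= /shift ltrBlDr lerBrDr.
Qed.

Lemma ge0_integral_shift (a : R) (f : R -> \bar R) :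
  measurable_fun setT f -> (forall x, 0 <= f x) ->
  \int[mu]_x f (x + a)%R = \int[mu]_x f x.
Proof.
move=> mf f0; rewrite [RHS](_ : _ = \int[pushforward mu (shift a)]_x f x).
  by rewrite ge0_integral_pushforward.
by apply: eq_measure_integral => A mA _; exact/esym/lebesgue_measure_shift.
Qed.

Let dil (a : R) : measurableTypeR R -> measurableTypeR R := fun x => (a * x)%R.

Lemma measurable_dil a : measurable_fun setT (dil a).
Proof. exact: measurable_funM. Qed.

HB.instance Definition _ a := @isMeasurableFun.Build _ _ _ _ (dil a) (measurable_dil a).

Lemma ge0_integral_dilate (a : R) (f : R -> \bar R) : (0 < a)%R ->
  measurable_fun setT f -> (forall x, 0 <= f x) ->
  a%:E * \int[mu]_x f (a * x)%R = \int[mu]_x f x.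
Proof.
move=> a0 mf f0.
have a0' : (0 <= a)%R by exact: ltW.
pose m' : {measure set _ -> \bar R} := mscale (NngNum a0') (pushforward mu (dil a)).
pose m := m' (measurable_dil a).
rewrite [RHS](_ : _ = \int[m]_x f x).
  rewrite ge0_integral_mscale//= ge0_integral_pushforward//.
apply: eq_measure_integral => A mA _; apply: lebesgue_measure_unique => //= _ [[c e]] _ <-.
rewrite /m /m' /= /mscale/= /pushforward.
rewrite (_ : _ @^-1` _ = `](c / a)%R, (e / a)%R]%classic).
  rewrite !lebesgue_measure_itv/= !lte_fin ltr_pM2r ?invr_gt0//; case: ifP => // _.
    by rewrite -!EFinB -EFinM mulrBr !(mulrC a) !divfK ?gt_eqF.
  by rewrite mule0.
by apply/seteqP; split => x /=; rewrite !in_itv/= /dil ltr_pdivrMr// ler_pdivlMr// mulrC.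
Qed.

Lemma ge0_integral_opp (f : R -> \bar R) :
  measurable_fun setT f -> (forall x, 0 <= f x) ->
  \int[mu]_x f (- x)%R = \int[mu]_x f x.
Proof.
move=> mf f0; rewrite [RHS](_ : _ = \int[pushforward mu (-%R : _ -> measurableTypeR R)]_x f x).
  by rewrite ge0_integral_pushforward.
by apply: eq_measure_integral => A mA _; exact/esym/lebesgue_measureN.
Qed.

End lebesgue_affine.

(** * Rotation invariance of the normal law of the plane *)

Section gaussian_plane.
Context {R : realType}.
Local Open Scope ereal_scope.
Local Notation mu := (@lebesgue_measure R).
Local Notation phi := (@normal_pdf R 0 1).
Local Notation gauss := (@normal_prob R 0 1).

Let plane := (measurableTypeR R * measurableTypeR R)%type.

Let psi (z : plane) : R := (phi z.1 * phi z.2)%R.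

Let psi_ge0 z : (0 <= psi z)%R.
Proof. by rewrite mulr_ge0 ?normal_pdf_ge0. Qed.

Let measurable_psi : measurable_fun setT psi.
Proof.
by apply: measurable_funM; apply: measurableT_comp => //; exact: measurable_normal_pdf.
Qed.

Let psiE z : psi z = (normal_peak (1 : R) ^+ 2 * expR (- (z.1 ^+ 2 + z.2 ^+ 2) / 2))%R.
Proof.
rewrite /psi normal_pdfE ?oner_eq0// /normal_fun !subr0 expr1n mulrACA -expr2.
by rewrite -expRD -mulrDl opprD.
Qed.

(** The product of two standard normal laws written as one measure with density; in this form
    invariance becomes a change of variables, the density depending only on the radius. *)
Let gauss2 (S : set plane) : \bar R := \int[mu \x mu]_(z in S) (psi z)%:E.

Let gauss2_set0 : gauss2 set0 = 0.
Proof. exact: integral_set0. Qed.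

Let gauss2_ge0 S : 0 <= gauss2 S.
Proof. by apply: integral_ge0 => z _; rewrite lee_fin. Qed.

Let gauss2_sigma_additive : semi_sigma_additive gauss2.
Proof.
move=> F mF tF mUF; rewrite /gauss2 ge0_integral_bigcup//.
- apply: is_cvg_ereal_nneg_natsum_cond => n _ _.
  by apply: integral_ge0 => z _; rewrite lee_fin.
- by apply/measurable_funTS/measurable_EFinP.
- by move=> z _; rewrite lee_fin.
Qed.

HB.instance Definition _ := isMeasure.Build _ _ _ gauss2
  gauss2_set0 gauss2_ge0 gauss2_sigma_additive.

Let gaussE (A : set (measurableTypeR R)) : measurable A -> gauss A = \int[mu]_x ((phi x)%:E * (\1_A x)%:E).
Proof.
move=> mA; rewrite /normal_prob integral_mkcond; apply: eq_integral => x _.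
by rewrite epatch_indic.
Qed.

Let gauss2E (S : set plane) : measurable S ->
  gauss2 S = \int[mu \x mu]_z ((psi z)%:E * (\1_S z)%:E).
Proof.
move=> mA; rewrite /gauss2 integral_mkcond; apply: eq_integral => x _.
by rewrite epatch_indic.
Qed.

Let measurable_psi_indic (S : set plane) : measurable S ->
  measurable_fun setT (fun z => (psi z)%:E * (\1_S z)%:E).
Proof.
by move=> mS; apply/measurable_EFinP/measurable_funM.
Qed.

Let gauss_product (S : set plane) : measurable S -> (gauss \x gauss) S = gauss2 S.
Proof.
move=> mS; apply: product_measure_unique => // A B mA mB.
rewrite /= gauss2E; last exact: measurableX.
rewrite fubini_tonelli1/=; last 2 first.
- by apply: measurable_psi_indic; exact: measurableX.
- by move=> z; rewrite mule_ge0 ?lee_fin.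
have mphi (D : set (measurableTypeR R)) : measurable D ->
    measurable_fun setT (fun x : measurableTypeR R => (phi x)%:E * (\1_D x)%:E).
  move=> mD; apply/measurable_EFinP/measurable_funM => //.
  exact: measurable_normal_pdf.
have phi0 (D : set (measurableTypeR R)) x : 0 <= (phi x)%:E * (\1_D x)%:E.
  by rewrite mule_ge0 ?lee_fin ?normal_pdf_ge0.
transitivity (\int[mu]_x ((phi x)%:E * (\1_A x)%:E * gauss B)).
  apply: eq_integral => x _; rewrite /fubini_F gaussE// -ge0_integralZl//.
    apply: eq_integral => y _ /=; rewrite -!EFinM; congr EFin.
    rewrite /psi /= !indicE in_setX /= -mulnb natrM; ring.
  by exact: mphi.
by rewrite ge0_integralZr// -?gaussE//; exact: mphi.
Qed.

Let swapE (f : plane -> \bar R) : measurable_fun setT f -> (forall z, 0 <= f z) ->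
  \int[mu \x mu]_z f z = \int[mu]_y \int[mu]_x f (x, y).
Proof. by move=> mf f0; rewrite fubini_tonelli1// fubini_tonelli. Qed.

Let integral_shear1 (a : R) (f : plane -> \bar R) :
  measurable_fun setT f -> (forall z, 0 <= f z) ->
  \int[mu \x mu]_z f ((z.1 + a * z.2)%R, z.2) = \int[mu \x mu]_z f z.
Proof.
move=> mf f0; have mg : measurable_fun setT (fun z : plane => ((z.1 + a * z.2)%R, z.2) : plane).
  apply/measurable_fun_pair => //; apply: measurable_funD => //.
  exact: measurable_funM.
rewrite !swapE//; last first.
  exact: measurableT_comp.
apply: eq_integral => y _ /=.
rewrite (@ge0_integral_shift _ (a * y) (fun x => f (x, y)))//.
apply: measurableT_comp => //; exact: measurable_fun_pair.
Qed.

Let integral_shear2 (a : R) (f : plane -> \bar R) :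
  measurable_fun setT f -> (forall z, 0 <= f z) ->
  \int[mu \x mu]_z f (z.1, (z.2 + a * z.1)%R) = \int[mu \x mu]_z f z.
Proof.
move=> mf f0; have mg : measurable_fun setT (fun z : plane => (z.1, (z.2 + a * z.1)%R) : plane).
  apply/measurable_fun_pair => //; apply: measurable_funD => //.
  exact: measurable_funM.
rewrite !fubini_tonelli1//; last first.
  exact: measurableT_comp.
apply: eq_integral => y _ /=.
rewrite /fubini_F/= (@ge0_integral_shift _ (a * y) (fun x => f (y, x)))//.
apply: measurableT_comp => //; exact: measurable_fun_pair.
Qed.

(* A rotation is a product of three shears, each of which preserves the
   Lebesgue measure of the plane. *)
Lemma gauss_rotation (c s : R) (S : set plane) : s != 0%R -> (c ^+ 2 + s ^+ 2 = 1)%R ->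
  measurable S ->
  (gauss \x gauss) [set z : plane | S ((c * z.1 - s * z.2)%R, (s * z.1 + c * z.2)%R)] =
  (gauss \x gauss) S.
Proof.
(* [t] is the tangent of half the angle: the rotation is the shear by [-t] along the first axis,
   then by [s] along the second, then by [-t] along the first again. *)
move=> s0 cs mS; set S' := [set z | _]; pose t := ((1 - c) / s)%R.
pose rot (z : plane) : plane := ((c * z.1 - s * z.2)%R, (s * z.1 + c * z.2)%R).
have mrot : measurable_fun setT rot.
  apply/measurable_fun_pair; [apply: measurable_funB|apply: measurable_funD];
    exact: measurable_funM.
have mS' : measurable S' by rewrite -[S']setTI; exact: mrot.
rewrite !gauss_product// !gauss2E//.
pose f z := (psi z)%:E * (\1_S z)%:E.
have mf : measurable_fun setT f by exact: measurable_psi_indic.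
have f0 z : 0 <= f z by rewrite mule_ge0 ?lee_fin.
transitivity (\int[mu \x mu]_z f (rot z)).
  apply: eq_integral => z _; rewrite /f; congr (_%:E * _).
  rewrite !psiE /rot /=; do 4 f_equal.
  have -> : ((c * z.1 - s * z.2) ^+ 2 + (s * z.1 + c * z.2) ^+ 2 =
     (c ^+ 2 + s ^+ 2) * (z.1 ^+ 2 + z.2 ^+ 2))%R by ring.
  by rewrite cs mul1r.
pose sh1 (z : plane) : plane := ((z.1 + (- t) * z.2)%R, z.2).
pose sh2 (z : plane) : plane := (z.1, (z.2 + s * z.1)%R).
have msh1 : measurable_fun setT sh1.
  apply/measurable_fun_pair => //; apply: measurable_funD => //.
  exact: measurable_funM.
have msh2 : measurable_fun setT sh2.
  apply/measurable_fun_pair => //; apply: measurable_funD => //.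
  exact: measurable_funM.
have rotE z : rot z = sh1 (sh2 (sh1 z)).
  have cE : (1 - t * s = c)%R by rewrite /t divfK// opprB addrC subrK.
  have ts : (t * (1 + c) = s)%R.
    apply: (mulIf s0); have -> : (t * (1 + c) * s = (1 + c) * (t * s))%R by ring.
    by rewrite (_ : t * s = 1 - c)%R ?/t ?divfK//; lra.
  rewrite /rot /sh1 /sh2 /=; congr pair.
    transitivity ((1 - t * s) * z.1 - t * (1 + (1 - t * s)) * z.2)%R; last by ring.
    by rewrite cE ts.
  by transitivity (s * z.1 + (1 - t * s) * z.2)%R; [rewrite cE|ring].
under eq_integral do rewrite rotE.
rewrite (@integral_shear1 (- t)%R (fun z => f (sh1 (sh2 z))))//; last first.
  by do 2 apply: measurableT_comp => //.
rewrite (@integral_shear2 s (fun z => f (sh1 z)))//; last exact: measurableT_comp.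
by rewrite (@integral_shear1 (- t)%R f).
Qed.

End gaussian_plane.

Section normal_law.
Context {R : realType}.
Local Open Scope ereal_scope.
Local Notation mu := (@lebesgue_measure R).
Local Notation gauss := (@normal_prob R 0 1).
Local Notation line := (measurableTypeR R).

Lemma normal_prob_indic (s : R) (A : set line) : measurable A ->
  normal_prob 0 s A = \int[mu]_x ((normal_pdf 0 s x)%:E * (\1_A x)%:E).
Proof.
move=> mA; rewrite /normal_prob integral_mkcond; apply: eq_integral => x _.
by rewrite epatch_indic.
Qed.

Lemma measurable_pdf_indic (s : R) (A : set line) : measurable A ->
  measurable_fun setT (fun x : line => (normal_pdf 0 s x)%:E * (\1_A x)%:E).
Proof.
move=> mA; apply/measurable_EFinP/measurable_funM => //.
exact: measurable_normal_pdf.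
Qed.

Lemma pdf_indic_ge0 (s : R) (A : set line) x :
  0 <= (normal_pdf 0 s x)%:E * (\1_A x)%:E.
Proof. by rewrite mule_ge0 ?lee_fin ?normal_pdf_ge0. Qed.

Lemma gauss_opp (A : set line) : measurable A -> gauss [set x | A (- x)%R] = gauss A.
Proof.
move=> mA; have mA' : measurable ([set x | A (- x)%R] : set line).
  rewrite -[X in measurable X]setTI.
  by apply: (_ : measurable_fun setT (fun x : line => - x : line)%R) => //; exact: measurable_funN.
rewrite !normal_prob_indic// -[RHS]ge0_integral_opp; last 2 first.
- exact: measurable_pdf_indic.
- exact: pdf_indic_ge0.
apply: eq_integral => x _; congr (_%:E * _).
by rewrite !normal_pdfE ?oner_eq0// /normal_fun !subr0 sqrrN.
Qed.

Lemma gauss_dilate (s : R) (A : set line) : (0 < s)%R -> measurable A ->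
  gauss [set x | A (s * x)%R] = normal_prob 0 s A.
Proof.
move=> s0 mA; have mA' : measurable ([set x | A (s * x)%R] : set line).
  rewrite -[X in measurable X]setTI.
  by apply: (_ : measurable_fun setT (fun x : line => s * x : line)%R) => //; exact: measurable_funM.
rewrite !normal_prob_indic// -[RHS](ge0_integral_dilate s0); last 2 first.
- exact: measurable_pdf_indic.
- exact: pdf_indic_ge0.
rewrite -ge0_integralZl//=; last 3 first.
- have ms : measurable_fun setT (fun x : line => s * x : line)%R by exact: measurable_funM.
  exact: (measurableT_comp (measurable_pdf_indic s mA) ms).
- by move=> x _; exact: pdf_indic_ge0.
- by rewrite lee_fin ltW.
apply: eq_integral => x _; rewrite muleA; congr (_ * _).
rewrite -EFinM; congr EFin.
rewrite !normal_pdfE ?oner_eq0 ?gt_eqF// /normal_fun !subr0 mulrA; congr (_ * expR _)%R.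
  rewrite /normal_peak expr1n mul1r -[in RHS]mulrnAr [in RHS]sqrtrM ?sqr_ge0//.
  by rewrite sqrtr_sqr gtr0_norm// invfM mulrA divff ?mul1r ?gt_eqF.
have : s != 0%R by rewrite gt_eqF.
by move=> s0'; field.
Qed.

(** The density is at most 1/2, since [2 pi >= 4], and the interval has length [2 d]. *)
Lemma gauss_small_ball (d : R) : (0 <= d)%R ->
  gauss [set x | (`|x| <= d)%R] <= d%:E.
Proof.
move=> d0; have -> : [set x : line | (`|x| <= d)%R] = `[(- d)%R, d]%classic.
  by apply/seteqP; split=> x /=; rewrite in_itv /= ler_norml.
rewrite /normal_prob.
apply: (@le_trans _ _ (\int[mu]_(x in `[(- d)%R, d]) (2^-1 : R)%:E)).
  apply: ge0_le_integral => //=.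
  - by move=> x _; rewrite lee_fin normal_pdf_ge0.
  - by apply/measurable_EFinP/measurable_funTS; exact: measurable_normal_pdf.
  - move=> x _; rewrite lee_fin; apply: (le_trans (normal_pdf_ub 0 x _)) => //.
    have pi2 := @pi_ge2 R; have pi0 : (0 < pi *+ 2 :> R)%R by rewrite mulr2n; lra.
    rewrite /normal_peak expr1n mul1r lef_pV2 ?posrE ?sqrtr_gt0//.
    have -> : (2 = Num.sqrt (2 ^+ 2) :> R)%R by rewrite sqrtr_sqr ger0_norm.
    by rewrite ler_sqrt; [rewrite -(mulr_natr pi 2); lra|exact: ltW].
rewrite integral_cst//= lebesgue_measure_itv/= lte_fin; case: ifP => [_|_].
  by rewrite -EFinB -EFinM lee_fin opprK; lra.
by rewrite mule0 lee_fin.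
Qed.

(** Cube [exp (- y / 3) <= 3 / y]. Cubic decay suffices for unions of about [N] events: the final
    thresholds on squares have orders [N^(2/5)] and [N^(1/2)]. *)
Lemma expRN_le (y : R) : (0 < y -> expR (- y) <= (3 / y) ^+ 3)%R.
Proof.
move=> y0; have -> : (- y = (- (y / 3)) *+ 3)%R by rewrite -mulr_natr; field.
rewrite -[X in expR X]mulr_natl expRM_natl lerXn2r ?nnegrE ?expR_ge0 ?divr_ge0 ?(ltW y0)//.
rewrite expRN -[leRHS]invrK invf_div lef_pV2 ?posrE ?expR_gt0 ?divr_gt0//.
by apply: le_trans (expR_ge1Dx _); rewrite lerDr.
Qed.

(** Compare with the normal law of variance 2: the ratio of the densities is at most
    [2 exp (- x^2 / 4)], which outside the interval is at most [2 exp (- t^2 / 4)]. *)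
Lemma gauss_tail (t : R) : (0 < t)%R ->
  gauss [set x | (t <= `|x|)%R] <= (2 * (12 / t ^+ 2) ^+ 3)%:E.
Proof.
move=> t0; have mA : measurable ([set x | t <= `|x|]%R : set line).
  have -> : [set x | t <= `|x|]%R = (`[t, +oo[ `|` `]-oo, (- t)%R])%classic.
    apply/seteqP; split=> x /=; rewrite !in_itv/= andbT.
      by rewrite ler_normr => /orP[|]; [left|right; rewrite lerNr].
    by rewrite ler_normr => -[->//|]; rewrite lerNr => ->; rewrite orbT.
  by apply: measurableU; exact: measurable_itv.
have t2 : (0 < t ^+ 2)%R by rewrite exprn_gt0.
have [c cE c0] : exists2 c, c = (2 * (12 / t ^+ 2) ^+ 3)%R & (0 <= c)%R.
  by eexists; [reflexivity|rewrite mulr_ge0// exprn_ge0// divr_ge0// ltW].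
have [s s0 s2] : exists2 s : R, (0 < s)%R & (s ^+ 2 = 2)%R.
  by exists (Num.sqrt 2); rewrite ?sqrtr_gt0 ?sqr_sqrtr.
have sN0 : s != 0%R by rewrite gt_eqF.
rewrite -cE; apply: (@le_trans _ _ (\int[mu]_x (c%:E * (normal_pdf 0 s x)%:E))); last first.
  rewrite ge0_integralZl//=.
  - by rewrite integral_normal_pdf mule1.
  - by apply/measurable_EFinP; exact: measurable_normal_pdf.
  - by move=> x _; rewrite lee_fin normal_pdf_ge0.
rewrite normal_prob_indic//; apply: ge0_le_integral => //.
- by move=> x _; exact: pdf_indic_ge0.
- exact: measurable_pdf_indic.
- by apply/measurable_EFinP/measurable_funM => //; exact: measurable_normal_pdf.
move=> x _; rewrite -!EFinM lee_fin indicE.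
have [/set_mem /= tx|_] := boolP (x \in _); last first.
  by rewrite mulr0 mulr_ge0 ?normal_pdf_ge0.
rewrite mulr1 !normal_pdfE// ?oner_eq0// /normal_fun !subr0 expr1n.
have -> : expR (- x ^+ 2 / (1 *+ 2)) =
    (expR (- x ^+ 2 / (s ^+ 2 *+ 2)) * expR (- (x ^+ 2 / 4)))%R.
  by rewrite s2 -expRD; congr expR; field.
rewrite mulrCA [leRHS]mulrA [leRHS]mulrC ler_wpM2l ?expR_ge0//.
have peak : (normal_peak (1 : R) <= 2 * normal_peak s)%R.
  have pi0 : (0 < pi *+ 2 :> R)%R by rewrite mulrn_wgt0// pi_gt0.
  rewrite /normal_peak expr1n mul1r -mulrnAr sqrtrM ?sqr_ge0// sqrtr_sqr gtr0_norm//.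
  rewrite invfM mulrA ler_peMl ?invr_ge0 ?sqrtr_ge0//.
  by rewrite -s2 expr2 mulfK// -(ler_pXn2r (n := 2)) ?nnegrE ?(ltW s0)// s2 expr1n ler1n.
have ex : (expR (- (x ^+ 2 / 4)) <= (12 / t ^+ 2) ^+ 3)%R.
  apply: (@le_trans _ _ (expR (- (t ^+ 2 / 4)))).
    rewrite ler_expR lerN2 ler_pM2r ?invr_gt0// -[leRHS]real_normK ?num_real//.
    by rewrite ler_pXn2r ?nnegrE// ltW.
  apply: (le_trans (expRN_le _)); first by rewrite divr_gt0.
  have -> : (3 / (t ^+ 2 / 4) = 12 / t ^+ 2)%R by field; rewrite gt_eqF.
  by [].
rewrite cE mulrC; apply: (le_trans (ler_pM _ _ ex peak)).
- exact: expR_ge0.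
- exact: normal_peak_ge0.
- by rewrite mulrCA mulrA lexx.
Qed.

(** After dilation by [h = sqrt (1/2)], the sum and the difference are, up to a sign, the
    coordinates of a standard normal vector rotated by an eighth of a turn. This turns the real and
    imaginary parts of an off-diagonal entry into two standard coordinates. *)
Lemma normal_half_sum_diff (A B : set line) : measurable A -> measurable B ->
  (normal_prob 0 (Num.sqrt (2^-1 : R)) \x normal_prob 0 (Num.sqrt (2^-1 : R)))
    [set z : line * line | A (z.1 + z.2)%R /\ B (z.1 - z.2)%R] =
  gauss A * gauss B.
Proof.
move=> mA mB; pose h := Num.sqrt (2^-1 : R).
have h0 : (0 < h)%R by rewrite sqrtr_gt0 invr_gt0.
have h2 : (h ^+ 2 = 2^-1)%R by rewrite sqr_sqrtr// invr_ge0.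
pose S := [set z : line * line | A (z.1 + z.2)%R /\ B (z.1 - z.2)%R].
have mS : measurable S.
  apply: measurableI.
    rewrite -[X in measurable X]setTI.
    by apply: (_ : measurable_fun setT (fun z : line * line => (z.1 + z.2)%R : line)) => //; exact: measurable_funD.
  rewrite -[X in measurable X]setTI.
  by apply: (_ : measurable_fun setT (fun z : line * line => (z.1 - z.2)%R : line)) => //; exact: measurable_funB.
pose dil (z : line * line) : line * line := ((h * z.1)%R, (h * z.2)%R).
have mdil : measurable_fun setT dil.
  by apply/measurable_fun_pair; exact: measurable_funM.
pose m' : {measure set (line * line) -> \bar R} := pushforward (gauss \x gauss) dil.
pose m := m' mdil.
rewrite -/S -/h (@product_measure_unique _ _ _ _ R _ _ m)//; last first.
  move=> A' B' mA' mB'; suff : m (A' `*` B') = normal_prob 0 h A' * normal_prob 0 h B' by [].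
  rewrite -(gauss_dilate h0 mA') -(gauss_dilate h0 mB').
  rewrite /m /m' /= /pushforward -product_measure1E//.
  - rewrite -[X in measurable X]setTI.
    by apply: (_ : measurable_fun setT (fun x : line => h * x : line)%R) => //; exact: measurable_funM.
  - rewrite -[X in measurable X]setTI.
    by apply: (_ : measurable_fun setT (fun x : line => h * x : line)%R) => //; exact: measurable_funM.
rewrite /m /m' /= /pushforward.
(* The rotation with [c = h] and [s = -h] yields the opposite of the difference, hence the reflected
   set. *)
have mB' : measurable ([set x | B (- x)%R] : set line).
  rewrite -[X in measurable X]setTI.
  by apply: (_ : measurable_fun setT (fun x : line => - x : line)%R) => //; exact: measurable_funN.
pose B' : set line := [set x | B (- x)%R].
have PE : (gauss \x gauss) (A `*` B') = gauss A * gauss B'.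
  exact: product_measure1E.
have hh : (h ^+ 2 + (- h) ^+ 2 = 1)%R by rewrite sqrrN h2; lra.
have hN0 : (- h)%R != 0%R by rewrite oppr_eq0 gt_eqF.
have RE := gauss_rotation hN0 hh (measurableX mA mB').
rewrite -(gauss_opp mB) -/B' -PE -RE; congr ((gauss \x gauss) _).
by apply/seteqP; split=> -[x y]; rewrite /S /= /B' /= opprD !mulNr !opprK.
Qed.

End normal_law.

(** * Families of independent normal variables *)

Section rectangles.
Context {R : realType} {d1 d2 : measure_display}
  {T1 : measurableType d1} {T2 : measurableType d2}.

Lemma eq_measure_rectangles (m1 m2 : {measure set (T1 * T2) -> \bar R}) :
  (m1 setT < +oo)%E ->
  (forall A B, measurable A -> measurable B -> m1 (A `*` B) = m2 (A `*` B)) ->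
  forall S, measurable S -> m1 S = m2 S.
Proof.
move=> m1T m12 S mS.
pose C : set (set (T1 * T2)) :=
  [set C | exists A, measurable A /\ exists B, measurable B /\ C = A `*` B].
apply: (measure_unique C (fun=> setT)) => //.
- rewrite measurable_prod_measurableType //; congr (<<s _ >>).
  rewrite predeqE; split => [[A mA [B mB <-]]|[A [mA [B [mB ->]]]]].
    by exists A; split => //; exists B.
  by exists A => //; exists B.
- move=> /= _ _ [X1 [mX1 [X2 [mX2 ->]]]] [Y1 [mY1 [Y2 [mY2 ->]]]].
  rewrite -setXI; exists (X1 `&` Y1); split; first exact: measurableI.
  by exists (X2 `&` Y2); split => //; exact: measurableI.
- move=> n; exists setT; split => //; exists setT; split => //.
  by rewrite setXTT.
- by rewrite bigcup_const.
- by move=> A [A1 [mA1 [A2 [mA2 ->]]]]; rewrite m12.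
Qed.

End rectangles.

Section iid.
Context {R : realType} {I : finType}.
Local Notation gauss := (@normal_prob R 0 1).
Local Notation line := (measurableTypeR R).
Implicit Types a b : I -> R.

Section law.
Context {d : measure_display} {T : measurableType d}.
Variable P : {measure set T -> \bar R}.

(** Letting some of the [A i] be the whole line recovers the marginals and the independence of
    subfamilies. *)
Definition iid_normal (X : T -> I -> R) : Prop :=
  (forall i, measurable_fun setT (fun w => X w i : line)) /\
  forall A : I -> set line, (forall i, measurable (A i)) ->
    P [set w | forall i, A i (X w i)] = (\prod_i gauss (A i))%E.

Lemma measurable_rect (X : T -> I -> R) (A : I -> set line) :
  (forall i, measurable_fun setT (fun w => X w i : line)) ->
  (forall i, measurable (A i)) -> measurable [set w | forall i, A i (X w i)].
Proof.
move=> mX mA; have -> : [set w | forall i, A i (X w i)] =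
    \bigcap_(i in [set: I]) ((X ^~ i) @^-1` A i).
  by apply/seteqP; split=> [w /= h i _|w /= h i]; exact: h.
apply: fin_bigcap_measurable => [|i _]; first exact: finite_finset.
by rewrite -[_ @^-1` _]setTI; exact: mX.
Qed.

(** The product rule is extended from rectangles to all measurable sets [S] in the plane of two
    coordinates, because a rotation of that plane does not preserve rectangles. The event on the
    other coordinates enters as a restriction of [P]. *)
Lemma iid_normal_pair X (p q : I) (S : set (line * line)) (A : I -> set line) :
  iid_normal X -> p != q -> measurable S -> (forall i, measurable (A i)) ->
  P [set w | S (X w p, X w q) /\
     forall i, i != p -> i != q -> A i (X w i)] =
  ((gauss \x gauss) S * \prod_(i | (i != p) && (i != q)) gauss (A i))%E.
Proof.
move=> [mX XA] pq mS mA.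
pose E := [set w | forall i, i != p -> i != q -> A i (X w i)].
pose B i : set line := if (i != p) && (i != q) then A i else setT.
have mB i : measurable (B i) by rewrite /B; case: ifP.
have mE : measurable E.
  rewrite (_ : E = [set w | forall i, B i (X w i)]); first exact: measurable_rect.
  apply/seteqP; split=> w h i; have := h i; rewrite /B.
    by case: (i != p) (i != q) => -[]// h'; exact: h'.
  by case: (i != p) (i != q) => -[].
pose f (w : T) : line * line := (X w p, X w q).
have mf : measurable_fun setT f by apply/measurable_fun_pair; exact: mX.
have [c c0 cE] : exists2 c : R, 0 <= c &
    (\prod_(i | (i != p) && (i != q)) gauss (A i) = c%:E)%E.
  elim/big_ind: _ => [|x y [a a0 ->] [b b0 ->]|i _]; first by exists 1.
    by exists (a * b); rewrite ?mulr_ge0// EFinM.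
  exists (fine (gauss (A i))); first by rewrite fine_ge0.
  by rewrite fineK// fin_num_measure.
pose m1' : {measure set (line * line) -> \bar R} := pushforward (mrestr P mE) f.
pose m1 := m1' mf.
pose m2 : {measure set (line * line) -> \bar R} := mscale (NngNum c0) (gauss \x gauss)%E.
have rect (C D : set line) : measurable C -> measurable D ->
    m1 (C `*` D) = (gauss C * gauss D * c%:E)%E.
  move=> mC mD; pose B' i := if i == p then C else if i == q then D else A i.
  have mB' i : measurable (B' i) by rewrite /B'; case: ifP => // _; case: ifP.
  have -> : m1 (C `*` D) = P [set w | forall i, B' i (X w i)].
    congr (P _); apply/seteqP; split=> w.
      move=> [[/= wC wD] wE] i; rewrite /B'; case: eqP => [->//|/eqP ip].
      by case: eqP => [->//|/eqP iq]; exact: wE.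
    move=> h; split; first split.
    - by have := h p; rewrite /B' eqxx.
    - by have := h q; rewrite /B' eqxx eq_sym (negbTE pq).
    - by move=> i ip iq; have := h i; rewrite /B' (negbTE ip) (negbTE iq).
  rewrite XA// (bigD1 p)//= (bigD1 q) 1?eq_sym//= muleA -cE; congr (_ * _ * _)%E.
  - by rewrite /B' eqxx.
  - by rewrite /B' eqxx eq_sym (negbTE pq).
  - by apply: eq_bigr => i /andP[ip iq]; rewrite /B' (negbTE ip) (negbTE iq).
rewrite cE; transitivity (m1 S); first by [].
rewrite (@eq_measure_rectangles _ _ _ _ _ m1 m2)//.
- by rewrite /m2 /= /mscale/= muleC.
- have := rect _ _ measurableT measurableT; rewrite setXTT => ->.
  by rewrite !probability_setT !mul1e ltry.
- move=> C D mC mD; rewrite rect// /m2 /= /mscale/= muleC; congr (_ * _)%E.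
  exact/esym/product_measure1E.
Qed.

Definition rotate (p q : I) (c s : R) (x : I -> R) : I -> R := fun i =>
  if i == p then c * x p - s * x q
  else if i == q then s * x p + c * x q else x i.

Definition flip (p : I) (x : I -> R) : I -> R := fun i =>
  if i == p then - x p else x i.

Lemma iid_normal_rotate X p q (c s : R) : p != q -> s != 0 -> c ^+ 2 + s ^+ 2 = 1 ->
  iid_normal X -> iid_normal (fun w => rotate p q c s (X w)).
Proof.
move=> pq s0 cs iX; have [mX XA] := iX; split=> [i|A mA].
  rewrite /rotate; case: (i == p); first by apply: measurable_funB;
    apply: measurable_funM => //; exact: mX.
  case: (i == q); last exact: mX.
  by apply: measurable_funD; apply: measurable_funM => //; exact: mX.
pose S : set (line * line) := A p `*` A q.
have mS : measurable S by exact: measurableX.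
pose S' : set (line * line) := [set z | S (c * z.1 - s * z.2, s * z.1 + c * z.2)].
have mS' : measurable S'.
  rewrite -[S']setTI; have mr : measurable_fun setT (fun z : line * line =>
      (c * z.1 - s * z.2, s * z.1 + c * z.2) : line * line).
    by apply/measurable_fun_pair; [apply: measurable_funB|apply: measurable_funD];
      exact: measurable_funM.
  exact: mr.
transitivity (P [set w | S' (X w p, X w q) /\
     forall i, i != p -> i != q -> A i (X w i)]).
  congr (P _); apply/seteqP; split=> w.
    move=> h; split=> [|i ip iq].
      split; [have := h p|have := h q]; rewrite /rotate eqxx//.
      by rewrite eq_sym (negbTE pq).
    by have := h i; rewrite /rotate (negbTE ip) (negbTE iq).
  move=> [[/= hp hq] h] i; rewrite /rotate; case: eqP => [->//|/eqP ip].
  by case: eqP => [->//|/eqP iq]; exact: h.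
rewrite (iid_normal_pair iX)// gauss_rotation// product_measure1E// -muleA.
by rewrite [RHS](bigD1 p)//= [in RHS](bigD1 q) 1?eq_sym.
Qed.

Lemma iid_normal_flip X p : iid_normal X -> iid_normal (fun w => flip p (X w)).
Proof.
move=> [mX XA]; split=> [i|A mA].
  by rewrite /flip; case: (i == p); [apply: measurable_funN|]; exact: mX.
have mN (B : set line) : measurable B -> measurable ([set x | B (- x)] : set line).
  move=> mB; rewrite -[X in measurable X]setTI.
  by apply: (_ : measurable_fun setT (fun x : line => - x : line)%R) => //; exact: measurable_funN.
pose B i : set line := if i == p then [set x | A p (- x)] else A i.
transitivity (P [set w | forall i, B i (X w i)]).
  by congr (P _); apply/seteqP; split=> w h i; have := h i; rewrite /flip /B;
    case: eqP => [->|].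
rewrite XA => [|i]; last by rewrite /B; case: ifP => // _; exact: mN.
apply: eq_bigr => i _; rewrite /B; case: eqP => [->|//].
exact: gauss_opp.
Qed.

Definition dot a b : R := \sum_i a i * b i.

Lemma dot_rotate p q (c s : R) a b : p != q -> c ^+ 2 + s ^+ 2 = 1 ->
  dot (rotate p q c s a) (rotate p q c s b) = dot a b.
Proof.
move=> pq cs; have D2 (F : I -> R) :
    \sum_i F i = F p + F q + \sum_(i | (i != p) && (i != q)) F i.
  by rewrite (bigD1 p)//= (bigD1 q) 1?eq_sym//= addrA.
rewrite /dot !D2 /rotate !eqxx [q == p]eq_sym (negbTE pq); congr (_ + _).
  have -> : (c * a p - s * a q) * (c * b p - s * b q) +
      (s * a p + c * a q) * (s * b p + c * b q) =
      (c ^+ 2 + s ^+ 2) * (a p * b p + a q * b q) by ring.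
  by rewrite cs mul1r.
by apply: eq_bigr => i /andP[/negbTE-> /negbTE->].
Qed.

Lemma dot_flip p a b : dot (flip p a) (flip p b) = dot a b.
Proof.
by apply: eq_bigr => i _; rewrite /flip; case: eqP => [->|//]; rewrite mulrNN.
Qed.

(** Each Givens rotation in the plane of [i0] and some [k] kills the coordinate [k] of [a]; the
    induction is on the number of nonzero coordinates other than [i0]. Since [a] vanishes on [F], no
    rotation touches the coordinates in [F], which makes the lemma usable for one vector after
    another. *)
Lemma rotate_to (F : {set I}) (i0 : I) a : i0 \notin F ->
  (forall k, k \in F -> a k = 0) -> dot a a = 1 ->
  exists rho : (I -> R) -> I -> R, [/\
    forall x y, dot (rho x) (rho y) = dot x y,
    forall X, iid_normal X -> iid_normal (fun w => rho (X w)),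
    forall x k, k \in F -> rho x k = x k &
    forall k, rho a k = (k == i0)%:R].
Proof.
move=> iF; pose D a : {set I} := [set k | (k != i0) && (a k != 0)]%SET.
move En : #|D a| => n; elim: n a En => [|n IH] a En aF aa.
  have a0 k : k != i0 -> a k = 0.
    move=> ki; apply/eqP; have : k \notin D a by rewrite (cards0_eq En) inE.
    by rewrite inE ki negbK.
  have : a i0 ^+ 2 = 1.
    rewrite -aa /dot (bigD1 i0)//= big1 ?addr0// => k /a0 ->.
    by rewrite mulr0.
  move/eqP; rewrite sqrf_eq1 => /orP[] /eqP ai0.
    exists id; split => // k; case: eqP => [->//|/eqP ki].
    exact: a0.
  (* No rotation is left to do, but the surviving coordinate is -1. *)
  exists (flip i0); split => [x y|X|x k kF|k].
  - exact: dot_flip.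
  - exact: iid_normal_flip.
  - by rewrite /flip; case: eqP kF => [->|//]; rewrite (negbTE iF).
  - by rewrite /flip; case: eqP => [_|/eqP/a0//]; rewrite ai0 opprK.
have /card_gt0P[k] : (0 < #|D a|)%N by rewrite En.
rewrite inE => /andP[ki ak0].
have kF : k \notin F by apply: contraNN ak0 => /aF ->.
have h0 : 0 < a i0 ^+ 2 + a k ^+ 2 by rewrite ltr_wpDl ?sqr_ge0// exprn_even_gt0.
pose h := Num.sqrt (a i0 ^+ 2 + a k ^+ 2).
have hgt0 : 0 < h by rewrite sqrtr_gt0.
have h2 : h ^+ 2 = a i0 ^+ 2 + a k ^+ 2 by rewrite sqr_sqrtr// ltW.
have hN0 : h != 0 by rewrite gt_eqF.
(* This rotation sends [(a i0, a k)] to [(h, 0)]. *)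
pose c := a i0 / h; pose s := - a k / h.
have s0 : s != 0 by rewrite mulf_neq0 ?oppr_eq0 ?invr_eq0.
have cs : c ^+ 2 + s ^+ 2 = 1.
  rewrite /c /s !exprMn sqrrN -mulrDl -h2 exprVn mulfV//.
  by rewrite expf_neq0.
have ik : i0 != k by rewrite eq_sym.
pose b := rotate i0 k c s a.
have bk : b k = 0.
  rewrite /b /rotate (negbTE ki) eqxx /c /s; field; exact: hN0.
have Db : #|D b| = n.
  have -> : D b = D a :\ k.
    apply/setP => j; rewrite !inE; case: (eqVneq j k) => [->|jk] /=.
      by rewrite bk eqxx andbF.
    by case: (eqVneq j i0) => //= ji; rewrite /b /rotate (negbTE ji) (negbTE jk).
  by have := cardsD1 k (D a); rewrite En inE ki ak0 /= add1n => -[].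
have bF j : j \in F -> b j = 0.
  move=> jF; rewrite /b /rotate; case: eqP jF => [->|_ jF]; first by rewrite (negbTE iF).
  by case: eqP jF => [->|_ /aF//]; rewrite (negbTE kF).
have bb : dot b b = 1 by rewrite /b dot_rotate.
have [rho [r1 r2 r3 r4]] := IH b Db bF bb.
exists (rho \o rotate i0 k c s); split => [x y|X iX|x j jF|j] /=.
- by rewrite r1 dot_rotate.
- by apply: (r2 (fun w => rotate i0 k c s (X w))); exact: iid_normal_rotate.
- rewrite r3// /rotate; case: eqP jF => [->|_]; first by rewrite (negbTE iF).
  by case: eqP => [->|//]; rewrite (negbTE kF).
- exact: r4.
Qed.

Lemma iid_normal_marginal X i (A : set line) : iid_normal X -> measurable A ->
  P [set w | A (X w i)] = gauss A.
Proof.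
move=> [mX XA] mA; pose B j : set line := if j == i then A else setT.
rewrite (_ : [set w | A (X w i)] = [set w | forall j, B j (X w j)]).
  rewrite XA => [|j]; last by rewrite /B; case: ifP.
  rewrite (bigD1 i)//= big1 ?mule1 ?/B ?eqxx// => j ji.
  by rewrite (negbTE ji) probability_setT.
apply/seteqP; split=> w; last by move=> /(_ i); rewrite /B eqxx.
by move=> Aw j; rewrite /B; case: eqP => [->|].
Qed.

Lemma iid_normal_dot X a (A : set line) : iid_normal X -> dot a a = 1 ->
  measurable A -> P [set w | A (dot a (X w))] = gauss A.
Proof.
move=> iX aa mA; have [i0 _] : exists i0 : I, true.
  apply: contrapT => nI; have := aa; rewrite /dot big1 => [/eqP|i _].
    by rewrite eq_sym oner_eq0.
  by exfalso; apply: nI; exists i.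
have i00 : i0 \notin finset.set0 by rewrite inE.
have a0 k : k \in finset.set0 -> a k = 0 by rewrite inE.
have [rho [r1 r2 _ r4]] := rotate_to i00 a0 aa.
rewrite -(iid_normal_marginal i0 (r2 X iX) mA); congr (P _).
apply/seteqP; split=> w /=; rewrite -r1 /dot (bigD1 i0)//= big1 ?addr0;
  by rewrite ?r4 ?eqxx ?mul1r// => i ii0; rewrite r4 (negbTE ii0) mul0r.
Qed.

(** [F] collects the indices [i] for which [a i] is already the basis vector of [i]. Any other
    [a i0] is orthogonal to these, so it vanishes on [F] and [rotate_to] moves it to its basis
    vector while keeping the previous ones. When [F] is everything the family is [X] itself. *)
Lemma iid_normal_orthonormal X (a : I -> I -> R) :
  (forall i j, dot (a i) (a j) = (i == j)%:R) ->
  iid_normal X -> iid_normal (fun w i => dot (a i) (X w)).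
Proof.
suff H n (F : {set I}) : #|~: F| = n -> forall X (a : I -> I -> R),
    (forall i, i \in F -> forall j, a i j = (j == i)%:R) ->
    (forall i j, dot (a i) (a j) = (i == j)%:R) ->
    iid_normal X -> iid_normal (fun w i => dot (a i) (X w)).
  by apply: (H _ finset.set0 erefl) => i; rewrite inE.
elim: n F => [|n IH] F Fn {X a}X a aF aa iX.
  have FT i : i \in F.
    by apply/negPn; rewrite -finset.in_setC (cards0_eq Fn) inE.
  rewrite (_ : (fun w i => dot (a i) (X w)) = X)//.
  apply/funext => w; apply/funext => i.
  rewrite /dot (bigD1 i)//= big1 ?addr0 ?aF ?eqxx ?mul1r// => j ji.
  by rewrite aF// (negbTE ji) mul0r.
have /card_gt0P[i0] : (0 < #|~: F|)%N by rewrite Fn.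
rewrite finset.in_setC => i0F.
have a0F k : k \in F -> a i0 k = 0.
  move=> kF; have := aa i0 k; rewrite (_ : (i0 == k) = false).
    rewrite /dot (bigD1 k)//= big1 ?addr0 ?(aF k kF) ?eqxx ?mulr1// => j jk.
    by rewrite (aF k kF) (negbTE jk) mulr0.
  by apply: contraNF i0F => /eqP ->.
have aa0 : dot (a i0) (a i0) = 1 by rewrite aa eqxx.
have [rho [r1 r2 r3 r4]] := rotate_to i0F a0F aa0.
have -> : (fun w i => dot (a i) (X w)) = (fun w i => dot (rho (a i)) (rho (X w))).
  by apply/funext => w; apply/funext => i; rewrite r1.
apply: (IH (i0 |: F) _ (fun w => rho (X w)) (fun i => rho (a i))) => [|i|i j|].
- have := cardsD1 i0 (~: F); rewrite Fn finset.in_setC i0F /= add1n => -[->].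
  by congr #|pred_of_set _|; apply/setP => j; rewrite !inE negb_or.
- move=> iF j; have [->|ii0] := eqVneq i i0; first exact: r4.
  have {}iF : i \in F by move: iF; rewrite !inE (negbTE ii0).
  (* The coordinate [i] of [rho (a i)] is still 1, and the unit norm forces the other coordinates to
     vanish. *)
  have : dot (rho (a i)) (rho (a i)) = 1 by rewrite r1 aa eqxx.
  rewrite /dot (bigD1 i)//= r3// aF// eqxx mulr1 => /eqP.
  rewrite eq_sym -subr_eq0 opprD addrA subrr add0r oppr_eq0.
  rewrite psumr_eq0 => [/allP h|k _]; last by rewrite -expr2 sqr_ge0.
  have [->|ji] := eqVneq j i; first by rewrite r3// aF// eqxx.
  have := h j (mem_index_enum _); rewrite ji /= -expr2 sqrf_eq0.
  by move=> /eqP.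
- by rewrite r1.
- exact: r2.
Qed.

End law.

Definition cylinders : set (set (I -> R)) := [set B |
  exists A : I -> set line, (forall i, measurable (A i)) /\
    B = [set x | forall i, A i (x i)]].

Definition vect := g_sigma_algebraType cylinders.

Lemma measurable_cylinder (A : I -> set line) : (forall i, measurable (A i)) ->
  measurable ([set x | forall i, A i (x i)] : set vect).
Proof. by move=> mA; apply: sub_sigma_algebra; exists A. Qed.

Lemma measurable_coord i : measurable_fun setT (fun x : vect => x i : line).
Proof.
move=> _ A mA; rewrite setTI.
pose B j : set line := if j == i then A else setT.
rewrite (_ : _ @^-1` _ = [set x | forall j, B j (x j)]).
  by apply: (@measurable_cylinder B) => j; rewrite /B; case: ifP.
rewrite /B; apply/seteqP; split=> x; last by move=> /(_ i); rewrite eqxx.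
by move=> Ax j; case: eqP => [->|].
Qed.

Lemma measurable_fun_vect d (T : measurableType d) (X : T -> vect) :
  (forall i, measurable_fun setT (fun w => X w i : line)) -> measurable_fun setT X.
Proof.
move=> mX; apply: (@measurability _ _ _ _ setT X cylinders) => //.
move=> _ [_ [A [mA ->]] <-]; rewrite setTI.
exact: measurable_rect.
Qed.

(** The cylinders are stable under intersection and generate the sigma-algebra of [vect]. Two
    probability spaces are allowed so that a family on [T] can be compared with one on [T * T]. *)
Lemma iid_normal_unique d (T : measurableType d) (P : {measure set T -> \bar R})
  d' (T' : measurableType d') (P' : {measure set T' -> \bar R}) X X' (B : set vect) :
  iid_normal P X -> iid_normal P' X' -> measurable B ->
  P [set w | B (X w)] = P' [set w | B (X' w)].
Proof.
move=> [mX XA] [mX' XA'] mB.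
have mf : measurable_fun setT (X : T -> vect) by exact: measurable_fun_vect.
have mf' : measurable_fun setT (X' : T' -> vect) by exact: measurable_fun_vect.
pose m' : {measure set vect -> \bar R} := pushforward P (X : T -> vect).
pose m := m' mf.
pose n' : {measure set vect -> \bar R} := pushforward P' (X' : T' -> vect).
pose n := n' mf'.
have E (A : I -> set line) : (forall i, measurable (A i)) ->
    m [set x | forall i, A i (x i)] = n [set x | forall i, A i (x i)].
  by move=> mA; rewrite [LHS]XA// [RHS]XA'.
have cT : setT = [set x : I -> R | forall i, (setT : set line) (x i)].
  by apply/seteqP; split.
suff : m B = n B by [].
apply: (@measure_unique _ R vect cylinders (fun=> setT) erefl _ _ _ m n) => //.
- move=> _ _ [A [mA ->]] [A' [mA' ->]]; exists (fun i => A i `&` A' i).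
  split=> [i|]; first exact: measurableI.
  by apply/seteqP; split=> x; [move=> [h h'] i; split|move=> h; split=> i; have [] := h i].
- by move=> _; exists (fun=> setT); split.
- by rewrite bigcup_const.
- by move=> _ [A [mA ->]]; exact: E.
- move=> _; rewrite [X in m X]cT.
  have -> : m [set x | forall i, (setT : set line) (x i)] =
      (\prod_(i : I) gauss (setT : set line))%E by exact: (XA (fun=> setT)).
  by rewrite big1 ?ltry// => i _; exact: probability_setT.
Qed.

Lemma iid_normal_merge (J : {set I}) d (T : measurableType d) (P : probability T R)
  d' (T' : measurableType d') (P' : probability T' R) X X' :
  iid_normal P X -> iid_normal P' X' ->
  iid_normal (P \x P')%E
    (fun (z : T * T') i => if i \in J then X' z.2 i else X z.1 i).
Proof.
move=> [mX XA] [mX' XA']; split=> [i|A mA].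
  case: (i \in J).
    by apply: (@measurableT_comp _ _ _ _ _ _ (fun w => X' w i)) => //; exact: mX'.
  by apply: (@measurableT_comp _ _ _ _ _ _ (fun w => X w i)) => //; exact: mX.
pose A1 i : set line := if i \in J then setT else A i.
pose A2 i : set line := if i \in J then A i else setT.
have mA1 i : measurable (A1 i) by rewrite /A1; case: ifP.
have mA2 i : measurable (A2 i) by rewrite /A2; case: ifP.
rewrite (_ : [set _ | _] = [set w | forall i, A1 i (X w i)] `*`
   [set w | forall i, A2 i (X' w i)]); last first.
  apply/seteqP; split=> -[w w'] /=.
    by move=> h; split=> i /=; have := h i; rewrite /A1 /A2; case: ifP.
  by move=> [h h'] i; have := h i; have := h' i; rewrite /= /A1 /A2; case: ifP.
transitivity (P [set w | forall i, A1 i (X w i)] *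
    P' [set w | forall i, A2 i (X' w i)])%E.
  by apply: product_measure1E; exact: measurable_rect.
rewrite XA// XA'// -big_split; apply: eq_bigr => i _ /=.
by rewrite /A1 /A2; case: ifP; rewrite probability_setT ?mule1 ?mul1e.
Qed.

(** A form of conditioning on the coordinates outside [J]: taking those in [J] from an independent
    copy on [T * T] does not change the law, and Tonelli's theorem then bounds the probability by
    the bound on the sections. *)
Lemma iid_normal_fubini (J : {set I}) d (T : measurableType d) (P : probability T R)
  X (B : set vect) (e : R) : iid_normal P X -> measurable B ->
  (forall w, P [set w' | B (fun i => if i \in J then X w' i else X w i)] <= e%:E)%E ->
  (P [set w | B (X w)] <= e%:E)%E.
Proof.
move=> iX mB Be; have iZ := iid_normal_merge J iX iX.
rewrite (iid_normal_unique iX iZ mB).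
have [mZ _] := iZ; have mf := measurable_fun_vect mZ.
rewrite /product_measure1.
apply: (@le_trans _ _ (\int[P]_w e%:E)%E); last first.
  have P1 : P [set: T] = 1%E by exact: probability_setT.
  have -> : (\int[P]_w e%:E)%E = (e%:E * P [set: T])%E by exact: integral_cst.
  by rewrite P1 mule1.
apply: ge0_le_integral => //.
- apply: measurable_fun_xsection; rewrite -[X in measurable X]setTI.
  exact: mf.
move=> w _; apply: le_trans (Be w); rewrite le_eqVlt; apply/orP; left.
apply/eqP; congr (P _); apply/seteqP; split=> w'; by rewrite /xsection /= inE.
Qed.

End iid.

(** * Measurability of spectral data *)

Section simple_spectrum_signs.
Context {R : realType}.
Local Notation C := R[i].

Lemma homo_ord_id n (f : 'I_n -> 'I_n) :
  (forall i j : 'I_n, (i < j)%N -> (f i < f j)%N) -> forall i, f i = i.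
Proof.
move=> ff; have le1 m : forall i : 'I_n, i = m :> nat -> (i <= f i)%N.
  elim: m => [|m IH] i im; first by rewrite im.
  have mn : (m < n)%N by rewrite (ltn_trans _ (ltn_ord i))// im.
  have := IH (Ordinal mn) erefl; rewrite im => h.
  by apply: leq_ltn_trans h (ff _ _ _); rewrite im.
have le2 m : forall i : 'I_n, (n.-1 - i = m)%N -> (f i <= i)%N.
  elim: m => [|m IH] i im.
    have := ltn_ord (f i); have := ltn_ord i; move: im.
    case: n i f ff {le1} => [[]//|n] i f ff /eqP.
    by rewrite subn_eq0 /= ltnS => ni _; rewrite ltnS => /leq_trans; apply.
  have i1n : (i.+1 < n)%N.
    by rewrite -ltn_predRL -subn_gt0 im.
  have := IH (Ordinal i1n); rewrite /= subnS im /= => /(_ erefl) h.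
  by rewrite -ltnS; apply: leq_trans h; exact: ff.
by move=> i; apply/val_inj/eqP; rewrite eqn_leq (le1 _ _ erefl) (le2 _ _ erefl).
Qed.

Definition char_real n (A : 'M[C]_n) (x : R) : R := complex.Re (\det ((x%:C)%:M - A)).

Lemma char_realE n (A : 'M[C]_n) x : A \is hermsymmx ->
  char_real A x = \prod_(k < n) (x - eigval A k).
Proof.
move=> hA; rewrite /char_real det_sub_hermitian//.
by rewrite (_ : \prod_(k < n) _ = (\prod_(k < n) (x - eigval A k))%:C)// rmorph_prod;
  apply: eq_bigr => k _; rewrite rmorphB.
Qed.

(* A rational certificate that the spectrum is simple and separated by [q];
   there are only countably many such [q]. *)
Definition alternates n (A : 'M[C]_n) (q : {ffun 'I_n.+1 -> rat}) : Prop :=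
  forall j : 'I_n, ratr (q (widen_ord (leqnSn n) j)) < ratr (q (lift ord0 j)) :> R /\
    char_real A (ratr (q (widen_ord (leqnSn n) j))) * char_real A (ratr (q (lift ord0 j))) < 0.

Lemma alternates_le n (A : 'M[C]_n) q (i k : 'I_n) : alternates A q -> (i < k)%N ->
  ratr (q (lift ord0 i)) <= ratr (q (widen_ord (leqnSn n) k)) :> R.
Proof.
move=> qA; pose x (j : 'I_n) : R := ratr (q (widen_ord (leqnSn n) j)).
pose y (j : 'I_n) : R := ratr (q (lift ord0 j)).
have H m : forall i k : 'I_n, (k = i + m.+1 :> nat)%N -> y i <= x k.
  elim: m => [|m IH] i' k' E.
    rewrite /x /y le_eqVlt; apply/orP; left; apply/eqP; congr (ratr (q _)).
    by apply/val_inj; rewrite /= E addn1.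
  have ln : (i' + m.+1 < n)%N by apply: ltn_trans (ltn_ord k'); rewrite E ltn_add2l.
  apply: le_trans (IH i' (Ordinal ln) erefl) _.
  have [xy _] := qA (Ordinal ln); apply: ltW; apply: lt_le_trans xy _.
  rewrite le_eqVlt; apply/orP; left; apply/eqP; congr (ratr (q _)).
  by apply/val_inj; rewrite /= E !addnS.
by move=> ik; apply: (H (k - i.+1)%N); rewrite addnS -addSn subnKC.
Qed.

(** The sign change puts at least one eigenvalue in each interval. The intervals are ordered and
    there are as many of them as eigenvalues, so the choice is a strictly increasing self-map of the
    indices, hence the identity. *)
Lemma alternates_eigval n (A : 'M[C]_n) q (j : 'I_n) : A \is hermsymmx ->
  alternates A q ->
  ratr (q (widen_ord (leqnSn n) j)) < eigval A j < ratr (q (lift ord0 j)).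
Proof.
move=> hA qA; pose x (j : 'I_n) : R := ratr (q (widen_ord (leqnSn n) j)).
pose y (j : 'I_n) : R := ratr (q (lift ord0 j)).
have ex : forall j : 'I_n, exists k : 'I_n, x j < eigval A k < y j.
  move=> {}j.
  apply: contrapT => H; have [xy] := qA j.
  rewrite !char_realE// -big_split /=; apply/negP; rewrite -leNgt.
  apply: prodr_ge0 => k _; rewrite -/(x j) -/(y j) in xy *.
  have [kx|kx] := leP (eigval A k) (x j).
    by rewrite mulr_ge0// subr_ge0// ltW// (le_lt_trans kx).
  have [ky|ky] := leP (y j) (eigval A k).
    by rewrite mulr_le0// subr_le0// ltW.
  by exfalso; apply: H; exists k; rewrite kx ky.
have [f fP] := choice ex.
have fid : forall i, f i = i.
  apply: homo_ord_id => i k /(alternates_le qA) yxik; rewrite ltnNge; apply/negP => fki.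
  have /andP[_ h1] := fP i; have /andP[h2 _] := fP k.
  have := eigval_le (i := f k) (j := f i) hA; rewrite fki ltn_ord => /(_ isT).
  by rewrite leNgt (lt_trans (lt_le_trans h1 yxik) h2).
by have := fP j; rewrite fid.
Qed.

Lemma alternates_simple n (A : 'M[C]_n) q : A \is hermsymmx ->
  alternates A q -> simple_spectrum A.
Proof.
move=> hA qA i j ij; have /andP[_ h1] := alternates_eigval i hA qA.
have /andP[h2 _] := alternates_eigval j hA qA.
exact: lt_le_trans h1 (le_trans (alternates_le qA ij) (ltW h2)).
Qed.

Lemma simple_alternates n (A : 'M[C]_n) (k : 'I_n) (c : R) : A \is hermsymmx ->
  simple_spectrum A -> eigval A k < c ->
  exists2 q, alternates A q & ratr (q (lift ord0 k)) <= c.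
Proof.
move=> hA sA kc.
(* The rational [q j] is taken between the eigenvalues [j - 1] and [j], with artificial bounds at
   distance 1 beyond the two ends; the one just above the eigenvalue [k] is also kept below [c]. *)
pose lo (j : 'I_n.+1) := if j == 0%N :> nat then eigval A 0 - 1 else eigval A j.-1.
pose hi0 (j : 'I_n.+1) := if (j < n)%N then eigval A j else eigval A n.-1 + 1.
pose hi (j : 'I_n.+1) := if j == lift ord0 k then Num.min (hi0 j) c else hi0 j.
have lohi0 j : lo j < hi0 j.
  rewrite /lo /hi0; case: eqP => [->|/eqP j0]; case: ifP => jn.
  - by rewrite ltrBlDr ltrDl.
  - by have := leq_ltn_trans (leq0n k) (ltn_ord k); rewrite jn.
  - have jn' : (j.-1 < n)%N by rewrite (leq_ltn_trans (leq_pred _)).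
    by apply: (sA (Ordinal jn') (Ordinal jn)); rewrite /= prednK ?lt0n.
  - have -> : j = n :> nat by apply/eqP; rewrite eqn_leq -ltnS ltn_ord leqNgt jn.
    by rewrite ltrDl.
have lohi j : lo j < hi j.
  rewrite /hi; case: eqP => [->|_]; last exact: lohi0.
  by rewrite lt_min lohi0.
have ex j : exists r : rat, lo j < ratr r < hi j.
  by have [r] := rat_in_itvoo (lohi j); exists r.
have [q qP] := choice ex.
have hihi0 j : hi j <= hi0 j.
  by rewrite /hi; case: ifP => // _; rewrite ge_min lexx.
exists [ffun j => q j]; last first.
  rewrite ffunE; have /andP[_ /ltW] := qP (lift ord0 k).
  by rewrite /hi eqxx le_min => /andP[].
move=> j; rewrite !ffunE; set x := ratr _; set y := ratr _.
have xj : x < eigval A j.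
  have /andP[_ h] := qP (widen_ord (leqnSn n) j).
  by apply: lt_le_trans h _; apply: le_trans (hihi0 _) _; rewrite /hi0 /= ltn_ord.
have jy : eigval A j < y.
  by have /andP[h _] := qP (lift ord0 j).
have yj (l : 'I_n) : (j < l)%N -> y < eigval A l.
  move=> jl; have /andP[_ h] := qP (lift ord0 j).
  apply: lt_le_trans h _; apply: le_trans (hihi0 _) _; rewrite /hi0 /= /bump leq0n add1n.
  by rewrite (leq_ltn_trans jl)// eigval_le// jl ltn_ord.
have lx (l : 'I_n) : (l < j)%N -> eigval A l < x.
  move=> lj; have /andP[h _] := qP (widen_ord (leqnSn n) j).
  apply: le_lt_trans _ h; rewrite /lo /=; case: eqP lj => [->//|/eqP j0] lj.
  by rewrite eigval_le// -ltnS prednK ?lt0n// lj ltnW// ltn_ord.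
split; first exact: lt_trans jy.
rewrite !char_realE// -big_split/= (bigD1 j)//= pmulr_llt0.
  by rewrite nmulr_rlt0 ?subr_lt0// subr_gt0.
apply: prodr_gt0 => l lj; have [ltl|gtl] := ltnP l j.
  by rewrite mulr_gt0// subr_gt0 ?lx// (lt_trans (lx _ ltl))// (lt_trans xj).
have {}gtl : (j < l)%N by rewrite ltn_neqAle eq_sym lj.
by rewrite nmulr_lgt0 subr_lt0 ?yj// (lt_trans xj)// sA.
Qed.

End simple_spectrum_signs.

(** * Measurability of eigenvalues and weights on the set of simple spectra *)

Section measurable_spectrum.
Context {R : realType} {d : measure_display} {D : measurableType d}.
Local Notation C := R[i].
Local Notation line := (measurableTypeR R).
Local Open Scope sesquilinear_scope.
Implicit Types (S : set D).

Definition cmeasurable S (F : D -> C) :=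
  measurable_fun S (fun z => complex.Re (F z) : line) /\
  measurable_fun S (fun z => complex.Im (F z) : line).

Lemma cmeasurable_cst S c : cmeasurable S (fun=> c).
Proof. by split; exact: measurable_cst. Qed.

Lemma cmeasurableD S F G : cmeasurable S F -> cmeasurable S G ->
  cmeasurable S (fun z => F z + G z).
Proof.
move=> [F1 F2] [G1 G2]; split.
  by under eq_fun do rewrite Re_add; exact: measurable_funD.
by under eq_fun do rewrite Im_add; exact: measurable_funD.
Qed.

Lemma cmeasurableM S F G : cmeasurable S F -> cmeasurable S G ->
  cmeasurable S (fun z => F z * G z).
Proof.
move=> [F1 F2] [G1 G2]; split.
  under eq_fun do rewrite Re_mul.
  by apply: measurable_funB; exact: measurable_funM.
under eq_fun do rewrite Im_mul.
by apply: measurable_funD; exact: measurable_funM.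
Qed.

Lemma cmeasurableN S F : cmeasurable S F -> cmeasurable S (fun z => - F z).
Proof.
move=> mF; under eq_fun do rewrite -mulN1r.
exact/cmeasurableM/mF/cmeasurable_cst.
Qed.

Lemma cmeasurable_conj S F : cmeasurable S F -> cmeasurable S (fun z => (F z)^*).
Proof.
move=> [F1 F2]; split.
  by rewrite (_ : (fun _ => _) = fun z => complex.Re (F z))//; apply/funext => z; case: (F z).
rewrite (_ : (fun _ => _) = fun z => - complex.Im (F z)); first exact: measurable_funN.
by apply/funext => z; case: (F z).
Qed.

Lemma cmeasurable_real S (f : D -> R) : measurable_fun S (f : D -> line) ->
  cmeasurable S (fun z => (f z)%:C).
Proof. by move=> mf; split => //; exact: measurable_cst. Qed.

Lemma cmeasurable_sum S (I : Type) (r : seq I) (P : pred I) (F : I -> D -> C) :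
  (forall i, cmeasurable S (F i)) ->
  cmeasurable S (fun z => \sum_(i <- r | P i) F i z).
Proof.
move=> mF; elim: r => [|i r IH].
  by under eq_fun do rewrite big_nil; exact: cmeasurable_cst.
under eq_fun do rewrite big_cons; case: (P i) => //.
exact: cmeasurableD.
Qed.

Lemma cmeasurable_prod S (I : Type) (r : seq I) (P : pred I) (F : I -> D -> C) :
  (forall i, cmeasurable S (F i)) ->
  cmeasurable S (fun z => \prod_(i <- r | P i) F i z).
Proof.
move=> mF; elim: r => [|i r IH].
  by under eq_fun do rewrite big_nil; exact: cmeasurable_cst.
under eq_fun do rewrite big_cons; case: (P i) => //.
exact: cmeasurableM.
Qed.

Definition mxmeasurable S m n (A : D -> 'M[C]_(m, n)) :=
  forall i j, cmeasurable S (fun z => A z i j).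

Lemma mxmeasurable_mul S m n p (A : D -> 'M[C]_(m, n)) (B : D -> 'M[C]_(n, p)) :
  mxmeasurable S A -> mxmeasurable S B -> mxmeasurable S (fun z => A z *m B z).
Proof.
move=> mA mB i j; under eq_fun do rewrite mxE.
by apply: cmeasurable_sum => k; exact: cmeasurableM.
Qed.

Lemma mxmeasurable_sub S m n (A B : D -> 'M[C]_(m, n)) :
  mxmeasurable S A -> mxmeasurable S B -> mxmeasurable S (fun z => A z - B z).
Proof.
move=> mA mB i j; under eq_fun do rewrite !mxE.
by apply: cmeasurableD => //; exact: cmeasurableN.
Qed.

Lemma mxmeasurable_scalar S n (f : D -> C) :
  cmeasurable S f -> mxmeasurable S (fun z => (f z)%:M : 'M[C]_n).
Proof.
move=> mf i j; under eq_fun do rewrite mxE.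
by case: (i == j); [under eq_fun do rewrite mulr1n|
  under eq_fun do rewrite mulr0n; exact: cmeasurable_cst].
Qed.

Lemma mxmeasurable_trC S m n (A : D -> 'M[C]_(m, n)) :
  mxmeasurable S A -> mxmeasurable S (fun z => (A z) ^t*).
Proof.
move=> mA i j; under eq_fun do rewrite !mxE.
exact: cmeasurable_conj.
Qed.

Lemma mxmeasurable_bigmul S n (I : Type) (r : seq I) (P : pred I)
    (A : I -> D -> 'M[C]_n) : (forall i, mxmeasurable S (A i)) ->
  mxmeasurable S (fun z => \big[mulmx/1%:M]_(i <- r | P i) A i z).
Proof.
move=> mA; elim: r => [|i r IH].
  under eq_fun do rewrite big_nil; apply: mxmeasurable_scalar.
  exact: cmeasurable_cst.
under eq_fun do rewrite big_cons; case: (P i) => //.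
exact: mxmeasurable_mul.
Qed.

Lemma cmeasurable_det S n (A : D -> 'M[C]_n) : mxmeasurable S A ->
  cmeasurable S (fun z => \det (A z)).
Proof.
move=> mA; apply: cmeasurable_sum => s; apply: cmeasurableM.
  exact: cmeasurable_cst.
by apply: cmeasurable_prod => i; exact: mA.
Qed.

Section hermitian_family.
Variables (n : nat) (A : D -> 'M[C]_n).
Hypotheses (hA : forall z, A z \is hermsymmx) (mA : mxmeasurable setT A).

Let S := [set z | simple_spectrum (A z)].

Let measurable_char_real x : measurable_fun setT (fun z => char_real (A z) x : line).
Proof.
suff [] : cmeasurable setT (fun z => \det ((x%:C)%:M - A z)) by [].
by apply: cmeasurable_det; apply: mxmeasurable_sub.
Qed.

Let measurable_alternates q : measurable [set z | alternates (A z) q].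
Proof.
have -> : [set z | alternates (A z) q] = \bigcap_(j in [set: 'I_n])
  [set z | ratr (q (widen_ord (leqnSn n) j)) < ratr (q (lift ord0 j)) :> R /\
    char_real (A z) (ratr (q (widen_ord (leqnSn n) j))) *
    char_real (A z) (ratr (q (lift ord0 j))) < 0].
  by apply/seteqP; split=> [z h j _|z h j]; exact: h.
apply: fin_bigcap_measurable => [|j _]; first exact: finite_finset.
apply: measurableI.
  have [h|h] := boolP (ratr (q (widen_ord (leqnSn n) j)) < ratr (q (lift ord0 j)) :> R).
    by rewrite [X in measurable X](_ : _ = setT)//; apply/seteqP; split.
  by rewrite [X in measurable X](_ : _ = classical_sets.set0)//; apply/seteqP; split=> // z.
rewrite [X in measurable X](_ : _ = [set: D] `&` ((fun z =>
    char_real (A z) (ratr (q (widen_ord (leqnSn n) j))) *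
    char_real (A z) (ratr (q (lift ord0 j))) : line) @^-1` `]-oo, 0[%classic)).
  have mf : measurable_fun setT (fun z =>
      char_real (A z) (ratr (q (widen_ord (leqnSn n) j))) *
      char_real (A z) (ratr (q (lift ord0 j))) : line).
    by apply: measurable_funM; exact: measurable_char_real.
  exact: (mf measurableT _ (measurable_itv _)).
by apply/seteqP; split=> z; rewrite /= in_itv/=; [|case].
Qed.

(** The event is a countable union, over the certificates [q] whose point just above the eigenvalue
    [k] is at most [c], of conditions on the signs of the characteristic polynomial. *)
Let measurable_eigval_lt (k : 'I_n) (c : R) :
  measurable [set z | simple_spectrum (A z) /\ eigval (A z) k < c].
Proof.
have -> : [set z | simple_spectrum (A z) /\ eigval (A z) k < c] =
    \bigcup_(q : {ffun 'I_n.+1 -> rat})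
      (if ratr (q (lift ord0 k)) <= c then [set z | alternates (A z) q]
       else classical_sets.set0).
  apply/seteqP; split=> z /=.
    move=> [sA kc]; have [q qA qc] := simple_alternates (hA z) sA kc.
    by exists q => //; rewrite qc.
  move=> [q _]; case: ifP => // qc qA; split; first exact: alternates_simple qA.
  by have /andP[_ h] := alternates_eigval k (hA z) qA; exact: lt_le_trans qc.
apply: countable_bigcupT_measurable => [|q]; first exact: countableP.
by case: ifP.
Qed.

Lemma measurable_simple : measurable S.
Proof.
have [n0|n0] := posnP n.
  rewrite (_ : S = setT)//; apply/seteqP; split=> // z _ i.
  by have := ltn_ord i; rewrite {2}n0.
pose k := Ordinal n0.
rewrite (_ : S = \bigcup_(m : nat) [set z | simple_spectrum (A z) /\ eigval (A z) k < m%:R]).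
  by apply: bigcup_measurable => m _; exact: measurable_eigval_lt.
apply/seteqP; split=> z /=; last by move=> [m _ []].
move=> sA; have [m hm] : exists m : nat, eigval (A z) k < m%:R.
  by exists (Num.truncn (eigval (A z) k)).+1; exact: truncnS_gt.
by exists m.
Qed.

Lemma measurable_eigval (k : 'I_n) :
  measurable_fun S (fun z => eigval (A z) k : line).
Proof.
move=> mS; apply: (measurability _ (RGenInftyO.measurableE R)) => //.
move=> _ [_ [c ->] <-].
rewrite (_ : _ `&` _ = [set z | simple_spectrum (A z) /\ eigval (A z) k < c]).
  exact: measurable_eigval_lt.
by apply/seteqP; split=> z; rewrite /= in_itv/=.
Qed.

(** The weight is a quotient [q / p] with [p] nonzero on simple spectra; multiplying by [p^2], which
    is positive there, turns the inequality into a sign condition on a polynomial expression. *)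
Lemma measurable_weight_le (c : D -> 'cV[C]_n) (l : 'I_n) (s : D -> R) :
  mxmeasurable setT c -> measurable_fun setT (s : D -> line) ->
  measurable [set z | simple_spectrum (A z) /\ weight (A z) l (c z) <= s z].
Proof.
move=> mc ms.
pose q z := complex.Re (((c z) ^t* *m \big[mulmx/1%:M]_(m | m != l)
    (A z - ((eigval (A z) m)%:C)%:M) *m c z) 0 0).
pose p z := complex.Re (\prod_(m < n | m != l) ((eigval (A z) l)%:C - (eigval (A z) m)%:C)).
have pE z : p z = \prod_(m < n | m != l) (eigval (A z) l - eigval (A z) m).
  rewrite /p (_ : \prod_(m < n | m != l) _ = (\prod_(m < n | m != l)
    (eigval (A z) l - eigval (A z) m))%:C)// rmorph_prod.
  by apply: eq_bigr => m _; rewrite rmorphB.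
have mlam (m : 'I_n) : cmeasurable S (fun z => (eigval (A z) m)%:C).
  exact/cmeasurable_real/measurable_eigval.
have sub (F : D -> C) : cmeasurable setT F -> cmeasurable S F.
  by move=> [F1 F2]; split; exact: measurable_funS F1 || exact: measurable_funS F2.
have mq : measurable_fun S (q : D -> line).
  suff : mxmeasurable S (fun z => (c z) ^t* *m \big[mulmx/1%:M]_(m | m != l)
    (A z - ((eigval (A z) m)%:C)%:M) *m c z) by move=> /(_ 0 0)[].
  have mc' : mxmeasurable S c by move=> i j; exact: sub.
  apply: mxmeasurable_mul => //; apply: mxmeasurable_mul.
    exact: mxmeasurable_trC.
  apply: mxmeasurable_bigmul => m; apply: mxmeasurable_sub.
    by move=> i j; exact: sub.
  exact: mxmeasurable_scalar.
have mp : measurable_fun S (p : D -> line).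
  suff [] : cmeasurable S (fun z => \prod_(m < n | m != l)
    ((eigval (A z) l)%:C - (eigval (A z) m)%:C)) by [].
  apply: cmeasurable_prod => m; apply: cmeasurableD => //.
  exact: cmeasurableN.
have mh : measurable_fun S (fun z => q z * p z - s z * p z ^+ 2 : line).
  apply: measurable_funB; first exact: measurable_funM.
  apply: measurable_funM; first exact: measurable_funS ms.
  exact: measurable_funM.
rewrite (_ : [set z | _] = S `&` ((fun z => q z * p z - s z * p z ^+ 2 : line)
    @^-1` `]-oo, 0]%classic)).
  exact: (mh measurable_simple _ (measurable_itv _)).
have H z : simple_spectrum (A z) ->
    (weight (A z) l (c z) <= s z) = (q z * p z - s z * p z ^+ 2 <= 0).
  move=> sA; have p0 : p z != 0.
    rewrite pE; apply/prodf_neq0 => m ml.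
    by rewrite subr_eq0 simple_spectrum_inj// eq_sym.
  have -> : weight (A z) l (c z) = q z / p z by rewrite /weight pE.
  have pp : 0 < p z ^+ 2 by rewrite exprn_even_gt0.
  rewrite subr_le0 -(ler_pM2r pp); congr (_ <= _).
  by field.
by apply/seteqP; split=> z; rewrite /= in_itv/= => -[sA]; rewrite H.
Qed.

End hermitian_family.

End measurable_spectrum.

(** * Real coordinates of Hermitian matrices *)

Section hermitian_coordinates.
Context {R : realType}.
Local Notation C := R[i].
Local Notation line := (measurableTypeR R).
Local Open Scope sesquilinear_scope.

(** Inverse of [coords] below. For [i < j] the coordinates at [(i, j)] and [(j, i)] are
    [Re G_ij + Im G_ij] and [Re G_ij - Im G_ij]; this is an isometry from Hermitian matrices with
    the Hilbert-Schmidt norm to real arrays, and it treats diagonal and off-diagonal entries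
    alike. *)
Definition herm n (x : 'I_n * 'I_n -> R) : 'M[C]_n :=
  \matrix_(i, j) (((x (i, j) + x (j, i)) / 2) +i* ((x (i, j) - x (j, i)) / 2)).

Lemma herm_hermsym n (x : 'I_n * 'I_n -> R) : herm x \is hermsymmx.
Proof.
apply/is_hermitianmxP; rewrite expr0 scale1r; apply/matrixP => i j.
by rewrite !mxE; apply/eqP; rewrite eq_complex /=; apply/andP; split; apply/eqP; field.
Qed.

Definition coords n (G : 'M[C]_n) (p : 'I_n * 'I_n) : R :=
  complex.Re (G p.1 p.2) + complex.Im (G p.1 p.2).

Lemma hermK n (G : 'M[C]_n) : G \is hermsymmx -> herm (coords G) = G.
Proof.
move=> /is_hermitianmxP; rewrite expr0 scale1r => GE.
apply/matrixP => i j; rewrite !mxE /coords /=.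
have -> : G j i = (G i j)^* by rewrite {1}GE !mxE.
by case: (G i j) => a c /=; apply/eqP; rewrite eq_complex /=; apply/andP; split; apply/eqP; field.
Qed.

(** The rows of the Kronecker square of [O]. *)
Definition conj_vec n (O : 'M[R]_n) (p q : 'I_n * 'I_n) : R := O p.1 q.1 * O p.2 q.2.

Lemma conj_vec_orthonormal n (O : 'M[R]_n) p q : orthogonal O ->
  dot (conj_vec O p) (conj_vec O q) = (p == q)%:R.
Proof.
move=> OO; have E i j : \sum_k O i k * O j k = (i == j)%:R.
  by have /matrixP/(_ i j) := OO; rewrite !mxE => <-; apply: eq_bigr => k _; rewrite mxE.
case: p q => [p1 p2] [q1 q2]; rewrite /dot /conj_vec /= xpair_eqE -mulnb natrM.
rewrite -(E p1) -(E p2) big_distrlr /= pair_bigA /=.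
by apply: eq_bigr => -[k l] _ /=; rewrite mulrACA.
Qed.

(** [herm x] is a complex linear combination of the array [x] and its transpose, and [O _ O^T]
    commutes with transposition. *)
Lemma conj_mx_herm n (O : 'M[R]_n) (x : 'I_n * 'I_n -> R) :
  conj_mx O (herm x) = herm (fun p => dot (conj_vec O p) x).
Proof.
apply/matrixP => i j; rewrite mxE [RHS]mxE.
have E (F : 'I_n -> 'I_n -> R) : \sum_l \sum_k F k l = \sum_p F p.1 p.2.
  by rewrite exchange_big pair_bigA.
have sw : dot (conj_vec O (j, i)) x = \sum_p O i p.1 * O j p.2 * x (p.2, p.1).
  rewrite /dot /conj_vec /= (reindex (fun p : 'I_n * 'I_n => (p.2, p.1))) /=.
    by apply: eq_bigr => p _; rewrite mulrC [X in _ = X]mulrC [X in _ = _ * X]mulrC.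
  by exists (fun p => (p.2, p.1)) => -[].
rewrite sw /dot /conj_vec -big_split -sumrB /= !mulr_suml.
apply/eqP; rewrite eq_complex /=; apply/andP; split; apply/eqP.
  transitivity (\sum_l \sum_k (O i k * O j l * x (k, l) + O i k * O j l * x (l, k)) / 2).
    rewrite Re_sum; apply: eq_bigr => l _; rewrite mxE mulr_suml Re_sum.
    apply: eq_bigr => k _; rewrite !mxE /=; ring.
  by rewrite E; apply: eq_bigr => -[].
transitivity (\sum_l \sum_k (O i k * O j l * x (k, l) - O i k * O j l * x (l, k)) / 2).
  rewrite Im_sum; apply: eq_bigr => l _; rewrite mxE mulr_suml Im_sum.
  apply: eq_bigr => k _; rewrite !mxE /=; ring.
by rewrite E; apply: eq_bigr => -[].
Qed.

Lemma minor0_herm n (x : 'I_n.+1 * 'I_n.+1 -> R) :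
  minor0 (herm x) = herm (fun p => x (lift ord0 p.1, lift ord0 p.2)).
Proof. by apply/matrixP => i j; rewrite !mxE. Qed.

(** Coefficients of a linear form in the coordinates of the first column ([f]) and of the first row
    ([g]), the corner excluded. *)
Definition border_form n (f g : 'I_n -> R) (p : 'I_n.+1 * 'I_n.+1) : R :=
  match unlift ord0 p.1, unlift ord0 p.2 with
  | Some l, None => f l
  | None, Some l => g l
  | _, _ => 0
  end.

Lemma dot_border_form n (f g : 'I_n -> R) x :
  dot (border_form f g) x =
  \sum_l (f l * x (lift ord0 l, ord0) + g l * x (ord0, lift ord0 l)).
Proof.
transitivity (\sum_i \sum_j border_form f g (i, j) * x (i, j)).
  by rewrite pair_bigA; apply: eq_bigr => -[].
rewrite big_ord_recl addrC big_split /=; congr (_ + _).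
  apply: eq_bigr => l _; rewrite big_ord_recl /border_form /= liftK unlift_none.
  by rewrite big1 ?addr0// => k _; rewrite liftK mul0r.
rewrite big_ord_recl /border_form /= !unlift_none mul0r add0r.
by apply: eq_bigr => l _; rewrite liftK.
Qed.

Lemma border_form_sqr n (f g : 'I_n -> R) :
  dot (border_form f g) (border_form f g) = \sum_l (f l ^+ 2 + g l ^+ 2).
Proof.
rewrite dot_border_form; apply: eq_bigr => l _.
by rewrite /border_form /= liftK unlift_none !expr2.
Qed.

Lemma Re_row_border0 n (u : 'rV[C]_n) (x : 'I_n.+1 * 'I_n.+1 -> R) :
  complex.Re ((u *m border0 (herm x)) 0 0) =
  dot (border_form (fun l => (complex.Re (u 0 l) - complex.Im (u 0 l)) / 2)
        (fun l => (complex.Re (u 0 l) + complex.Im (u 0 l)) / 2)) x.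
Proof.
rewrite dot_border_form mxE Re_sum; apply: eq_bigr => l _.
by rewrite Re_mul !mxE /=; field.
Qed.

(** Reflection along [v = b - e], where [e] is the axis: [v^T v = 2 (1 - b_0)] explains the factor.
    The case [b = e] is separate because [v] vanishes there. *)
Lemma householder n (b : 'cV[R]_n.+1) : \sum_k b k 0 ^+ 2 = 1 ->
  exists2 O : 'M[R]_n.+1, orthogonal O & O *m b = axis n.
Proof.
move=> b1; have [->|ba] := eqVneq b (axis n).
  by exists 1%:M; rewrite /orthogonal ?trmx1 mul1mx.
pose e : 'cV[R]_n.+1 := axis n.
pose v := b - e.
have bb : b^T *m b = 1%:M.
  apply/matrixP => i j; rewrite !ord1 !mxE eqxx -b1.
  by apply: eq_bigr => k _; rewrite mxE expr2.
have ee : e^T *m e = 1%:M.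
  apply/matrixP => i j; rewrite !ord1 !mxE eqxx (bigD1 ord0)//= big1 => [|k k0].
    by rewrite !mxE eqxx mulr1 addr0.
  by rewrite !mxE (negbTE k0) mulr0.
have eb : e^T *m b = (b 0 0)%:M.
  apply/matrixP => i j; rewrite !ord1 !mxE eqxx mulr1n (bigD1 ord0)//= big1 => [|k k0].
    by rewrite !mxE eqxx mul1r addr0.
  by rewrite !mxE (negbTE k0) mul0r.
have be : b^T *m e = (b 0 0)%:M by rewrite -[LHS]trmxK trmx_mul trmxK eb tr_scalar_mx.
have vb : v^T *m b = (1 - b 0 0)%:M by rewrite /v linearB /= mulmxBl bb eb -raddfB.
have vv : v^T *m v = (2 * (1 - b 0 0))%:M.
  rewrite {2}/v mulmxBr vb /v linearB /= mulmxBl be ee -!raddfB; congr _%:M; ring.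
have s0 : 1 - b 0 0 != 0.
  apply: contraNneq ba => s0; rewrite -subr_eq0 -/e -/v.
  apply/eqP/matrixP => i j; rewrite ord1 [RHS]mxE.
  have : (v^T *m v) 0 0 = 0 by rewrite vv s0 mulr0 mxE eqxx mulr1n.
  rewrite mxE => /eqP; rewrite psumr_eq0 => [/allP/(_ i (mem_index_enum _))|k _].
    by rewrite !mxE mulf_eq0 orbb => /eqP.
  by rewrite !mxE -expr2 sqr_ge0.
exists (1%:M - (1 - b 0 0)^-1 *: (v *m v^T)); last first.
  rewrite mulmxBl mul1mx -scalemxAl -mulmxA vb mul_mx_scalar scalerA mulVf//.
  by rewrite scale1r /v opprB addrCA subrr addr0.
have vvT : (1%:M - (1 - b 0 0)^-1 *: (v *m v^T))^T = 1%:M - (1 - b 0 0)^-1 *: (v *m v^T).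
  by rewrite [LHS]linearB /= trmx1 [X in _ - X]linearZ /= trmx_mul trmxK.
rewrite /orthogonal vvT.
have QQ : (v *m v^T) *m (v *m v^T) = (2 * (1 - b 0 0)) *: (v *m v^T).
  by rewrite -mulmxA [v^T *m _]mulmxA vv mul_scalar_mx -scalemxAr.
move: (v *m v^T) QQ => Q QQ.
rewrite mulmxBr mulmx1 mulmxBl mul1mx -scalemxAl -scalemxAr QQ !scalerA.
rewrite (_ : (1 - b 0 0)^-1 * (1 - b 0 0)^-1 * _ = (1 - b 0 0)^-1 + (1 - b 0 0)^-1).
  by rewrite scalerDl opprB addrK subrK.
by field.
Qed.

End hermitian_coordinates.

(** * Law of the minor and of its border *)

Section gue_law.
Context {R : realType}.
Local Notation C := R[i].
Local Notation gauss := (@normal_prob R 0 1).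
Local Notation line := (measurableTypeR R).

Lemma GUE_coords_measurable d (T : measurableType d) (P : probability T R) n
  (G : T -> 'M[C]_n) p : GUE P G ->
  measurable_fun setT (fun w => coords (G w) p : line).
Proof.
move=> [_ mG _ _ _]; have mz := mG p.1 p.2.
apply: measurable_funD.
  exact: (measurableT_comp measurable_fst mz).
exact: (measurableT_comp measurable_snd mz).
Qed.

(** For [i < j] the conditions on the coordinates [(i, j)] and [(j, i)] form one condition [S] on
    the entry [G_ij], whose law is then given by [normal_half_sum_diff]. A diagonal entry is real
    and contributes its real part alone. *)
Lemma GUE_iid_normal d (T : measurableType d) (P : probability T R) n
  (G : T -> 'M[C]_n) : GUE P G -> iid_normal P (fun w => coords (G w)).
Proof.
move=> GG; split=> [p|A mA]; first exact: (GUE_coords_measurable p GG).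
have [hG mG indG diagG offG] := GG.
have GC w i j : G w j i = (G w i j)^*.
  have := is_hermitianmxP _ _ _ (hG w); rewrite expr0 scale1r => E.
  by rewrite {1}E !mxE.
have Im0 w i : complex.Im (G w i i) = 0.
  have := GC w i i; case: (G w i i) => a c /eqP; rewrite eq_complex /= => /andP[_ /eqP].
  lra.
pose S (p : 'I_n * 'I_n) : set (R * R) :=
  if (p.1 < p.2)%N then [set z | A p (z.1 + z.2) /\ A (p.2, p.1) (z.1 - z.2)]
  else if p.1 == p.2 then [set z | A p z.1] else setT.
have mS p : measurable (S p).
  rewrite /S; case: ifP => _.
    apply: measurableI; rewrite -[X in measurable X]setTI.
      by apply: (_ : measurable_fun setT (fun z : line * line => z.1 + z.2 : line)) => //;
        exact: measurable_funD.
    by apply: (_ : measurable_fun setT (fun z : line * line => z.1 - z.2 : line)) => //;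
      exact: measurable_funB.
  case: ifP => _; last exact: measurableT.
  rewrite -[X in measurable X]setTI.
  by apply: (measurable_fst : measurable_fun setT (fun z : line * line => z.1 : line)).
pose J := [set p : 'I_n * 'I_n | (p.1 <= p.2)%N]%SET.
have -> : [set w | forall p, A p (coords (G w) p)] =
    \bigcap_(p in [set` J]) ((fun w => ReIm (G w p.1 p.2)) @^-1` S p).
  apply/seteqP; split=> [w h [i j] _|w h [i j]] /=.
    rewrite /S /=; case: ifP => _; [split|case: ifP => // /eqP <-].
    - exact: (h (i, j)).
    - have := h (j, i); rewrite /coords /= GC; by case: (G w i j).
    - by have := h (i, i); rewrite /coords /= Im0 addr0.
  have [ij|ji|ij] := ltngtP i j.
  - have := h (i, j); rewrite /J /S /= inE /= ij ltnW// => /(_ isT)[].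
    by [].
  - have := h (j, i); rewrite /J /S /= inE /= ji ltnW// => /(_ isT)[_].
    by rewrite /coords /= (GC w j i); case: (G w j i).
  - have {}ij : i = j by exact: val_inj.
    have := h (i, j); rewrite /J /S /= inE /= ij ltnn leqnn eqxx => /(_ isT).
    by rewrite /coords /= Im0 addr0.
apply: (etrans (indG J S (subxx _) mS)).
pose F p := gauss (A p).
transitivity (\prod_(p in J) (F p * (if (p.1 < p.2)%N then F (p.2, p.1) else 1)))%E.
  apply: eq_bigr => -[i j]; rewrite inE /= => ij; rewrite /S /=.
  case: ifPn => [{}ij|]; last first.
    rewrite -leqNgt => ji; have {ij ji}-> : i = j.
      by apply/val_inj/eqP; rewrite eqn_leq ij ji.
    rewrite eqxx mule1; exact: (diagG j (A (j, j)) (mA _)).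
  rewrite -(normal_half_sum_diff (mA _) (mA _)).
  have := mS (i, j); rewrite /S /= ij => mS'; exact: (offG i j ij _ mS').
rewrite big_split /= -big_mkcondr /= [RHS](bigID (fun p => p \in J)) /=.
congr (_ * _)%E; rewrite [RHS](reindex (fun p : 'I_n * 'I_n => (p.2, p.1))) /=.
  by apply: eq_bigl => -[i j]; rewrite !inE /= -ltnNge; case: ltngtP.
by exists (fun p => (p.2, p.1)) => -[].
Qed.

Lemma iid_normal_restrict (I K : finType) (h : K -> I) d (T : measurableType d)
  (P : probability T R) (X : T -> I -> R) : injective h ->
  iid_normal P X -> iid_normal P (fun w k => X w (h k)).
Proof.
move=> hI [mX XA]; split=> [k|A mA]; first exact: mX.
pose B i : set line := if [pick k | h k == i] is Some k then A k else setT.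
have BE k : B (h k) = A k.
  by rewrite /B; case: pickP => [k' /eqP/hI->//|/(_ k)]; rewrite eqxx.
rewrite (_ : [set w | _] = [set w | forall i, B i (X w i)]).
  rewrite XA => [|i]; last by rewrite /B; case: pickP.
  rewrite (bigID (fun i => i \in codom h)) /= [X in (_ * X)%E]big1 ?mule1.
    rewrite (reindex_omap h (fun i => [pick k | h k == i])) /=; last first.
      move=> i /codomP[k ->]; case: pickP => [k' /eqP|/(_ k)]; first by move=> /= ->.
      by rewrite eqxx.
    apply: eq_big => k; last by rewrite BE.
    rewrite codom_f /=; case: pickP => [k' /eqP/hI->|/(_ k)]; by rewrite eqxx.
  move=> i ni; rewrite /B; case: pickP => [k /eqP hk|_]; last exact: probability_setT.
  by rewrite -hk codom_f in ni.
apply/seteqP; split=> w /= H => [i|k]; last by rewrite -BE.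
by rewrite /B; case: pickP => // k /eqP <-.
Qed.

Lemma mxmeasurable_herm d (D : measurableType d) n (X : D -> 'I_n * 'I_n -> R) :
  (forall p, measurable_fun setT (fun z => X z p : line)) ->
  mxmeasurable setT (fun z => herm (X z)).
Proof.
move=> mX i j; split.
  rewrite (_ : (fun _ => _) = fun z => (X z (i, j) + X z (j, i)) / 2 : line).
    apply: measurable_funM; [apply: measurable_funD; exact: mX|exact: measurable_cst].
  by apply/funext => z; rewrite mxE.
rewrite (_ : (fun _ => _) = fun z => (X z (i, j) - X z (j, i)) / 2 : line).
  apply: measurable_funM; [apply: measurable_funB; exact: mX|exact: measurable_cst].
by apply/funext => z; rewrite mxE.
Qed.

(** For a unit row [u] the coefficients found in [Re_row_border0] have squared norm 1/2, which the
    factor [sqrt 2] makes up for. *)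
Lemma Re_row_border0_law d (T : measurableType d) (P : probability T R) n
    (X : T -> 'I_n.+1 * 'I_n.+1 -> R) (u : 'rV[C]_n) (A : set line) :
  iid_normal P X -> \sum_l sqmod (u 0 l) = 1 -> measurable A ->
  P [set w | A (Num.sqrt 2 * complex.Re ((u *m border0 (herm (X w))) 0 0))] = gauss A.
Proof.
move=> iX u1 mA; pose r : R := Num.sqrt 2.
have r2 : r ^+ 2 = 2 by rewrite sqr_sqrtr// ler0n.
pose a := border_form (fun l => r * ((complex.Re (u 0 l) - complex.Im (u 0 l)) / 2))
        (fun l => r * ((complex.Re (u 0 l) + complex.Im (u 0 l)) / 2)).
have aa : dot a a = 1.
  rewrite border_form_sqr; apply: etrans u1; apply: eq_bigr => l _.
  by rewrite !exprMn r2 /sqmod; field.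
rewrite -(iid_normal_dot iX aa mA); congr (P _); apply/seteqP.
suff E w : r * complex.Re ((u *m border0 (herm (X w))) 0 0) = dot a (X w).
  by split=> w /=; rewrite E.
rewrite Re_row_border0 !dot_border_form mulr_sumr; apply: eq_bigr => l _.
by rewrite mulrDr !mulrA.
Qed.

Lemma unit_row n (Q : 'M[C]_n) (l : 'I_n) : Q \is unitarymx ->
  \sum_j sqmod (row l Q 0 j) = 1.
Proof.
move=> /unitarymxP/matrixP/(_ l l); rewrite !mxE eqxx => E.
apply: complexI; rewrite rmorph_sum -[RHS]E; apply: eq_bigr => j _.
by rewrite [LHS]sqmodE !mxE mulrC.
Qed.

Lemma measurable_tail (t : R) : measurable ([set x | (t <= `|x|)%R] : set line).
Proof.
rewrite [X in measurable X](_ : _ = `]-oo, (- t)] `|` `[t, +oo[).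
  exact: measurableU.
apply/seteqP; split=> x; rewrite /= !in_itv/= andbT lerNr ler_normr => H.
  by move: H => /orP[h|h]; [right|left].
by case: H => h; apply/orP; [right|left].
Qed.

Lemma measurable_sqmod d (D : measurableType d) (S : set D) (F : D -> C) :
  cmeasurable S F -> measurable_fun S (fun z => sqmod (F z) : line).
Proof. by move=> [F1 F2]; apply: measurable_funD; exact: measurable_funX. Qed.

Lemma mxmeasurable_border0 d (D : measurableType d) (S : set D) n (A : D -> 'M[C]_n.+1) :
  mxmeasurable S A -> mxmeasurable S (fun z => border0 (A z)).
Proof. by move=> mA i j; under eq_fun do rewrite 2!mxE; exact: mA. Qed.

Lemma mxmeasurable_minor0 d (D : measurableType d) (S : set D) n (A : D -> 'M[C]_n.+1) :
  mxmeasurable S A -> mxmeasurable S (fun z => minor0 (A z)).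
Proof. by move=> mA i j; under eq_fun do rewrite 2!mxE; exact: mA. Qed.

Lemma mxmeasurable_cst d (D : measurableType d) (S : set D) m n (A : 'M[C]_(m, n)) :
  mxmeasurable S (fun=> A).
Proof. by move=> i j; exact: cmeasurable_cst. Qed.

Lemma sqmod_row_border0_tail d (T : measurableType d) (P : probability T R) n
    (X : T -> 'I_n.+1 * 'I_n.+1 -> R) (u : 'rV[C]_n) (K : R) :
  iid_normal P X -> \sum_l sqmod (u 0 l) = 1 -> 0 < K ->
  (P [set w | (K < sqmod ((u *m border0 (herm (X w))) 0 0))%R] <=
    (4 * (12 / K) ^+ 3)%:E)%E.
Proof.
move=> iX u1 K0; have [mX _] := iX; pose r : R := Num.sqrt 2.
have r2 : r ^+ 2 = 2 by rewrite sqr_sqrtr// ler0n.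
pose A : set line := [set x | (Num.sqrt K <= `|x|)%R].
have mA : measurable A by exact: measurable_tail.
(* The imaginary part for [u] is the real part for [v], so each of the two parts has the same tail;
   this doubles the constant of [gauss_tail]. *)
pose v := - 'i%C *: u.
have v1 : \sum_l sqmod (v 0 l) = 1.
  apply: etrans u1; apply: eq_bigr => l _; rewrite mxE sqmodM.
  by rewrite /sqmod /= oppr0 expr0n sqrrN expr1n add0r mul1r.
have ImE w : complex.Im ((u *m border0 (herm (X w))) 0 0) =
    complex.Re ((v *m border0 (herm (X w))) 0 0).
  by rewrite /v -scalemxAl [X in _ = complex.Re X]mxE Re_mul /=; ring.
have mF (u' : 'rV[C]_n) :
    cmeasurable setT (fun w => (u' *m border0 (herm (X w))) 0 0).
  suff : mxmeasurable setT (fun w => u' *m border0 (herm (X w))) by exact.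
  apply: mxmeasurable_mul; first exact: mxmeasurable_cst.
  by apply: mxmeasurable_border0; exact: mxmeasurable_herm.
have mS (u' : 'rV[C]_n) :
    measurable [set w | A (r * complex.Re ((u' *m border0 (herm (X w))) 0 0))].
  rewrite -[X in measurable X]setTI.
  suff mf : measurable_fun setT (fun w =>
    r * complex.Re ((u' *m border0 (herm (X w))) 0 0) : line) by exact: mf.
  by apply: measurable_funM => //; have [] := mF u'.
apply: (@le_trans _ _ (P ([set w | A (r * complex.Re ((u *m border0 (herm (X w))) 0 0))] `|`
   [set w | A (r * complex.Re ((v *m border0 (herm (X w))) 0 0))]))).
  apply: le_measure; rewrite ?inE.
  - rewrite [X in measurable X](_ : _ = setT `&` (fun w => sqmod
      ((u *m border0 (herm (X w))) 0 0) : line) @^-1` `]K, +oo[%classic).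
      exact: (measurable_sqmod (mF u) measurableT (measurable_itv _)).
    by apply/seteqP; split=> w; rewrite /= in_itv/= andbT => // -[].
  - exact: measurableU.
  - move=> w /= h; apply: contrapT => /not_orP[]; rewrite /A /= -ImE.
    move=> /negP; rewrite -ltNge => h1 /negP; rewrite -ltNge => h2.
    have s0 : (0 <= Num.sqrt K)%R by exact: sqrtr_ge0.
    have {}h1 : (`|r * complex.Re ((u *m border0 (herm (X w))) 0 0)| ^+ 2 < K)%R.
      by rewrite -[ltRHS](sqr_sqrtr (ltW K0)) ltr_pXn2r// nnegrE.
    have {}h2 : (`|r * complex.Im ((u *m border0 (herm (X w))) 0 0)| ^+ 2 < K)%R.
      by rewrite -[ltRHS](sqr_sqrtr (ltW K0)) ltr_pXn2r// nnegrE.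
    move: h1 h2 h; rewrite !real_normK ?num_real// !exprMn r2 /sqmod; lra.
apply: le_trans (measureU2 _ _ _) _ => //.
have s0 : (0 < Num.sqrt K)%R by rewrite sqrtr_gt0.
have := gauss_tail s0; rewrite (sqr_sqrtr (ltW K0)) => t.
have tl (u' : 'rV[C]_n) : \sum_l sqmod (u' 0 l) = 1 ->
    (P [set w | A (r * complex.Re ((u' *m border0 (herm (X w))) 0 0))%R] <=
     (2 * (12 / K) ^+ 3)%:E)%E.
  move=> u1'; apply: le_trans t; rewrite le_eqVlt; apply/orP; left; apply/eqP.
  exact: (Re_row_border0_law iX u1' mA).
apply: le_trans (leeD (tl _ u1) (tl _ v1)) _.
by rewrite -EFinD lee_fin; lra.
Qed.

Lemma measurable_weight d (D : measurableType d) n (A : D -> 'M[C]_n) (c : D -> 'cV[C]_n)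
    (l : 'I_n) : (forall z, A z \is hermsymmx) -> mxmeasurable setT A ->
  mxmeasurable setT c ->
  measurable_fun [set z | simple_spectrum (A z)]
    (fun z => weight (A z) l (c z) : line).
Proof.
move=> hA mA mc mS; apply: (measurability _ (RGenOInfty.measurableE R)) => //.
move=> _ [_ [s ->] <-]; rewrite (_ : _ `&` _ = [set z | simple_spectrum (A z)] `\`
    [set z | simple_spectrum (A z) /\ weight (A z) l (c z) <= s]).
  apply: measurableD => //; apply: measurable_weight_le => //.
apply/seteqP; split=> z; rewrite /= in_itv/= andbT ltNge => -[sA].
  by move=> /negP h; split=> // -[].
by move=> h; split=> //; apply/negP => h'; apply: h.
Qed.

(** Resampling the first row and column leaves the minor [M] fixed. For fixed simple [M] the weight
    is the squared modulus of the border paired with a fixed unit row, so a bound uniform over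
    deterministic unit rows carries over. *)
Lemma border_weight_law d (T : measurableType d) (P : probability T R) n
    (X : T -> 'I_n.+1 * 'I_n.+1 -> R) (l : 'I_n) (B : set line) (e : R) :
  iid_normal P X -> measurable B -> 0 <= e ->
  (forall u : 'rV[C]_n, \sum_j sqmod (u 0 j) = 1 ->
    (P [set w | B (sqmod ((u *m border0 (herm (X w))) 0 0))%R] <= e%:E)%E) ->
  (P [set w | simple_spectrum (minor0 (herm (X w))) /\
      B (weight (minor0 (herm (X w))) l (border0 (herm (X w))))] <= e%:E)%E.
Proof.
move=> iX mB e0 Be.
pose J := [set p : 'I_n.+1 * 'I_n.+1 | (p.1 == ord0) || (p.2 == ord0)]%SET.
pose B' : set (@vect R ('I_n.+1 * 'I_n.+1)%type) :=
  [set x | simple_spectrum (minor0 (herm x)) /\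
    B (weight (minor0 (herm x)) l (border0 (herm x)))].
have mherm : mxmeasurable setT
    (fun x : @vect R ('I_n.+1 * 'I_n.+1)%type => herm x).
  by apply: mxmeasurable_herm => p; exact: measurable_coord.
have hminor (x : 'I_n.+1 * 'I_n.+1 -> R) : minor0 (herm x) \is hermsymmx.
  exact/minor0_hermsym/herm_hermsym.
have mB' : measurable B'.
  have mS := @measurable_weight _ (@vect R ('I_n.+1 * 'I_n.+1)%type) n
    (fun x => minor0 (herm x)) (fun x => border0 (herm x)) l hminor
    (mxmeasurable_minor0 mherm) (mxmeasurable_border0 mherm).
  apply: (mS _ _ mB).
  exact: (@measurable_simple R _ (@vect R ('I_n.+1 * 'I_n.+1)%type) n
    (fun x => minor0 (herm x)) hminor (mxmeasurable_minor0 mherm)).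
apply: (iid_normal_fubini (J := J) (B := B') iX mB') => w.
pose M := minor0 (herm (X w)).
pose mix w' p := if p \in J then X w' p else X w p.
have ME w' : minor0 (herm (mix w')) = M.
  rewrite /M !minor0_herm; congr herm; apply/funext => p.
  by rewrite /mix inE.
have bE w' : border0 (herm (mix w')) = border0 (herm (X w')).
  by apply/matrixP => i j; rewrite !mxE /mix !inE.
rewrite (_ : [set w' | _] = [set w' | simple_spectrum M /\
   B (weight M l (border0 (herm (X w'))))]); last first.
  by apply/seteqP; split=> w'; rewrite /B' /= -/(mix w') ME bE.
have [sM|nsM] := pselect (simple_spectrum M); last first.
  by rewrite [X in P X](_ : _ = classical_sets.set0) ?measure0// -subset0 => w' [].
have [Q QM] := diagonalizable (hminor (X w)); have [Qu _] := QM.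
apply: le_trans (Be _ (unit_row l Qu)); rewrite le_eqVlt; apply/orP; left.
apply/eqP; congr (P _).
have E w' : weight M l (border0 (herm (X w'))) =
    sqmod ((row l Q *m border0 (herm (X w'))) 0 0).
  by rewrite (weightE _ _ QM)// -row_mul [in RHS]mxE.
by apply/seteqP; split=> w'; rewrite /= E => // -[].
Qed.

Lemma measurable_ball0 (t : R) : measurable ([set x | (`|x| <= t)%R] : set line).
Proof.
rewrite [X in measurable X](_ : _ = `[(- t), t]%classic) //.
by apply/seteqP; split=> x; rewrite /= in_itv/= ler_norml.
Qed.

Lemma finite_union_bound d (T : measurableType d) (P : {measure set T -> \bar R})
    (I : finType) (A : I -> set T) (e : I -> R) : (forall i, measurable (A i)) ->
  (forall i, P (A i) <= (e i)%:E)%E ->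
  measurable [set w | exists i, A i w] /\
  (P [set w | exists i, A i w] <= (\sum_i e i)%:E)%E.
Proof.
move=> mA Ae; pose U (r : seq I) := [set w | exists2 i, i \in r & A i w].
suff H r : measurable (U r) /\ (P (U r) <= (\sum_(i <- r) e i)%:E)%E.
  rewrite (_ : [set w | _] = U (index_enum I)); first exact: H.
  by apply/seteqP; split=> w [j] => [Aj|_ Aj]; exists j; rewrite ?mem_index_enum.
elim: r => [|i r [mU Ue]].
  rewrite (_ : U [::] = classical_sets.set0) ?measure0 ?big_nil//.
  by rewrite -subset0 => w [].
rewrite (_ : U (i :: r) = A i `|` U r); last first.
  apply/seteqP; split=> w /=.
    by move=> [j]; rewrite inE => /predU1P[->|jr Aj]; [left|right; exists j].
  by move=> [Ai|[j jr Aj]]; [exists i|exists j] => //; rewrite inE ?eqxx ?jr ?orbT.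
split; first exact: measurableU.
rewrite big_cons EFinD; apply: le_trans (measureU2 _ _ _) _ => //.
by apply: leeD => //; exact: Ae.
Qed.

(** By induction the minor is almost surely simple; a multiple eigenvalue of the matrix then forces
    a border weight to vanish, by [not_simple_minor0], which has probability 0 by the small ball
    estimate with radius 0. *)
Lemma herm_simple d (T : measurableType d) (P : probability T R) n
    (X : T -> 'I_n * 'I_n -> R) : iid_normal P X ->
  P [set w | ~ simple_spectrum (herm (X w))] = 0.
Proof.
elim: n X => [|n IH] X iX.
  rewrite [X in P X](_ : _ = classical_sets.set0) ?measure0// -subset0 => w; apply.
  by case.
have [mX _] := iX; have mh := mxmeasurable_herm mX.
have hh w : herm (X w) \is hermsymmx by exact: herm_hermsym.
have hM w : minor0 (herm (X w)) \is hermsymmx by exact: minor0_hermsym.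
have mM := mxmeasurable_minor0 mh.
have sM : measurable [set w | simple_spectrum (minor0 (herm (X w)))].
  exact: measurable_simple.
pose Z l := [set w | simple_spectrum (minor0 (herm (X w))) /\
  weight (minor0 (herm (X w))) l (border0 (herm (X w))) <= 0].
have mZ l : measurable (Z l).
  by apply: measurable_weight_le => //; exact: mxmeasurable_border0.
have Z0 l : P (Z l) = 0.
  apply/eqP; rewrite eq_le measure_ge0 andbT.
  have := @border_weight_law _ _ P n X l `]-oo, 0] 0 iX.
  rewrite [X in P X](_ : _ = Z l); last first.
    by apply/seteqP; split=> w; rewrite /= in_itv.
  apply => // u u1.
  apply: (@le_trans _ _ (P [set w | [set x | (`|x| <= 0)%R]
    (Num.sqrt 2 * complex.Re ((u *m border0 (herm (X w))) 0 0))])).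
    have mF : cmeasurable setT (fun w => (u *m border0 (herm (X w))) 0 0).
      suff : mxmeasurable setT (fun w => u *m border0 (herm (X w))) by exact.
      by apply: mxmeasurable_mul; [exact: mxmeasurable_cst|exact: mxmeasurable_border0].
    apply: le_measure; rewrite ?inE.
    - rewrite -[X in measurable X]setTI.
      exact: (measurable_sqmod mF measurableT (measurable_itv _)).
    - rewrite -[X in measurable X]setTI.
      suff mf : measurable_fun setT (fun w =>
        Num.sqrt 2 * complex.Re ((u *m border0 (herm (X w))) 0 0) : line).
        exact: (mf measurableT _ (measurable_ball0 0)).
      by apply: measurable_funM => //; have [] := mF.
    - move=> w; rewrite /= in_itv/= => h.
      have : sqmod ((u *m border0 (herm (X w))) 0 0) == 0.
        by rewrite eq_le h sqmod_ge0.
      by rewrite sqmod_eq0 => /eqP ->; rewrite /= mulr0 normr0.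
  rewrite (Re_row_border0_law iX u1 (measurable_ball0 0)).
  exact: gauss_small_ball.
apply/eqP; rewrite eq_le measure_ge0 andbT.
have iX' : iid_normal P (fun w p => X w (lift ord0 p.1, lift ord0 p.2)).
  apply: (iid_normal_restrict (h := fun p : 'I_n * 'I_n =>
    (lift ord0 p.1, lift ord0 p.2)) _ iX).
  move=> [i j] [i' j'] /= /eqP; rewrite xpair_eqE !(inj_eq lift_inj).
  by move=> /andP[/eqP-> /eqP->].
have := IH _ iX'; rewrite [X in P X](_ : _ =
    ~` [set w | simple_spectrum (minor0 (herm (X w)))]); last first.
  by apply/seteqP; split=> w; rewrite /= minor0_herm.
move=> P0.
have [mU U0] := finite_union_bound (e := fun=> 0) mZ (fun l => eq_ind_r (fun x => x <= 0%:E)%E (lexx _) (Z0 l)).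
apply: (@le_trans _ _ (P (~` [set w | simple_spectrum (minor0 (herm (X w)))] `|`
   [set w | exists l, Z l w]))).
  apply: le_measure; rewrite ?inE//.
  - by apply: measurableC; exact: measurable_simple.
  - by apply: measurableU => //; exact: measurableC.
  move=> w /= ns; have [sm|] := pselect (simple_spectrum (minor0 (herm (X w)))); last by left.
  right; have [l hl] := not_simple_minor0 (hh w) ns sm.
  by exists l; split; rewrite ?hl.
apply: le_trans (measureU2 _ _ _) _ => //=; first exact: measurableC.
by rewrite P0 add0e; rewrite big1 in U0.
Qed.

Lemma border_weight_tail d (T : measurableType d) (P : probability T R) n
    (X : T -> 'I_n.+1 * 'I_n.+1 -> R) (l : 'I_n) (K : R) :
  iid_normal P X -> 0 < K ->
  (P [set w | simple_spectrum (minor0 (herm (X w))) /\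
      (K < weight (minor0 (herm (X w))) l (border0 (herm (X w))))%R] <=
    (4 * (12 / K) ^+ 3)%:E)%E.
Proof.
move=> iX K0.
have := @border_weight_law _ _ P n X l `]K, +oo[ (4 * (12 / K) ^+ 3) iX.
rewrite [X in P X](_ : _ = [set w | simple_spectrum (minor0 (herm (X w))) /\
      K < weight (minor0 (herm (X w))) l (border0 (herm (X w)))]); last first.
  by apply/seteqP; split=> w; rewrite /= in_itv/= andbT.
apply => // [|u u1]; first by rewrite mulr_ge0// exprn_ge0// divr_ge0// ltW.
apply: le_trans (sqmod_row_border0_tail iX u1 K0).
rewrite le_eqVlt; apply/orP; left; apply/eqP; congr (P _).
by apply/seteqP; split=> w; rewrite /= in_itv/= andbT.
Qed.

End gue_law.

(** * Lower bound on the weights *)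

Section axis_weight.
Context {R : realType}.
Local Notation C := R[i].
Local Notation gauss := (@normal_prob R 0 1).
Local Notation line := (measurableTypeR R).

(** Both bounds are compared with the product measure of [E], integrated in either order. *)
Lemma sections_exchange d1 d2 (T1 : measurableType d1) (T2 : measurableType d2)
    (P1 : probability T1 R) (P2 : probability T2 R) (E : set (T1 * T2)) (p q : \bar R) :
  measurable E -> (0 <= p)%E -> (forall x, p <= P2 (xsection E x))%E ->
  (forall y, P1 (ysection E y) <= q)%E -> (p <= q)%E.
Proof.
move=> mE p0 pE Eq; have [y0 _] : exists y : T2, True.
  apply: contrapT => nT; have : P2 setT = 1%E by exact: probability_setT.
  rewrite (_ : setT = classical_sets.set0) ?measure0; first by move=> /eqP; rewrite eq_sym onee_eq0.
  by apply/seteqP; split=> // y; exfalso; apply: nT; exists y.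
have q0 : (0 <= q)%E by apply: le_trans (Eq y0); exact: measure_ge0.
have P11 : P1 [set: T1] = 1%E by exact: probability_setT.
have P21 : P2 [set: T2] = 1%E by exact: probability_setT.
have pI : (\int[P1]_x p = p * P1 [set: T1])%E by exact: integral_cst.
have qI : (\int[P2]_y q = q * P2 [set: T2])%E by exact: integral_cst.
rewrite -[p]mule1 -[q]mule1 -{1}P11 -P21 -pI -qI.
apply: (@le_trans _ _ ((P1 \x P2) E)%E).
  apply: ge0_le_integral => //; first exact: (measurable_fun_xsection P2).
  by move=> x _; exact: pE.
rewrite (@product_measure_unique _ _ _ _ _ P1 P2 (P1 \x^ P2)%E)//; last first.
  by move=> A B mA mB; rewrite /= product_measure2E.
apply: ge0_le_integral => //; first exact: (measurable_fun_ysection P1).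
by move=> y _; exact: Eq.
Qed.

Lemma iid_normal_max_tail (I : finType) d (T : measurableType d)
    (P : probability T R) (Y : T -> I -> R) (t : R) : iid_normal P Y -> 0 < t ->
  measurable [set w | exists j, t <= `|Y w j|] /\
  (P [set w | exists j, (t <= `|Y w j|)%R] <= (#|I|%:R * (2 * (12 / t ^+ 2) ^+ 3))%:E)%E.
Proof.
move=> iY t0; have [mY _] := iY.
have mA j : measurable [set w | t <= `|Y w j|].
  rewrite -[X in measurable X]setTI.
  exact: (mY j measurableT _ (measurable_tail t)).
rewrite mulr_natl -sumr_const; apply: (finite_union_bound mA) => j.
by rewrite (iid_normal_marginal j iY (measurable_tail t)); exact: gauss_tail.
Qed.

Lemma measurable_dot (I : finType) d (D : measurableType d) (f Y : D -> I -> R) :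
  (forall i, measurable_fun setT (fun z => f z i : line)) ->
  (forall i, measurable_fun setT (fun z => Y z i : line)) ->
  measurable_fun setT (fun z => dot (f z) (Y z) : line).
Proof.
move=> mf mY; rewrite /dot; apply: measurable_sum => i.
exact: measurable_funM (mf i) (mY i).
Qed.

(** Off the event that some [|Y_j|] is at least [t / sqrt #|I|], one has [|Y|^2 <= t^2]. Since
    [|f|^2 >= 1/2], the condition of [E] then confines the standard normal variable [f . Y / |f|] to
    radius [sqrt (2 s) t]. *)
Lemma dot_small_ball (I : finType) d (T : measurableType d) (P : probability T R)
    (Y : T -> I -> R) (f : I -> R) (s t : R) (E : set T) :
  (0 < #|I|)%N -> iid_normal P Y -> 2^-1 <= dot f f -> 0 <= s -> 0 < t -> measurable E ->
  (forall w, E w -> dot f (Y w) ^+ 2 <= s * dot (Y w) (Y w)) ->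
  (P E <= (Num.sqrt (2 * s) * t + #|I|%:R * (2 * (12 * #|I|%:R / t ^+ 2) ^+ 3))%:E)%E.
Proof.
move=> I0 iY ff s0 t0 mE Ef; have [mY _] := iY.
set N : R := #|I|%:R; have N0 : 0 < N by rewrite ltr0n.
pose r := Num.sqrt (dot f f); have ff0 : 0 < dot f f by apply: lt_le_trans ff; lra.
have r0 : 0 < r by rewrite sqrtr_gt0.
have r2 : r ^+ 2 = dot f f by rewrite sqr_sqrtr// ltW.
pose g i := f i / r.
have dg y : dot g y = dot f y / r.
  by rewrite /dot mulr_suml; apply: eq_bigr => i _; rewrite /g mulrAC.
have gg : dot g g = 1.
  rewrite dg (_ : dot f g = dot f f / r).
    by rewrite -r2 expr2 mulfK ?gt_eqF// divff// gt_eqF.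
  by rewrite /dot mulr_suml; apply: eq_bigr => i _; rewrite /g mulrA.
pose a := t / Num.sqrt N.
have sN : 0 < Num.sqrt N by rewrite sqrtr_gt0.
have a0 : 0 < a by rewrite divr_gt0.
have a2 : a ^+ 2 = t ^+ 2 / N by rewrite expr_div_n sqr_sqrtr// ltW.
have [mU PU] := iid_normal_max_tail iY a0.
pose u := Num.sqrt (2 * s) * t.
have u0 : 0 <= u by rewrite mulr_ge0 ?sqrtr_ge0// ltW.
have mB : measurable [set w | `|dot g (Y w)| <= u].
  rewrite -[X in measurable X]setTI.
  suff mf : measurable_fun setT (fun w => dot g (Y w) : line).
    exact: (mf measurableT _ (measurable_ball0 u)).
  exact: measurable_dot.
apply: (@le_trans _ _ (P ([set w | `|dot g (Y w)| <= u] `|` [set w | exists j, a <= `|Y w j|]))).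
  apply: le_measure; rewrite ?inE//; first exact: measurableU.
  move=> w /Ef Efw /=; apply: contrapT => /not_orP[/negP h1 /forallNP h2].
  have YY : dot (Y w) (Y w) <= t ^+ 2.
    apply: (@le_trans _ _ (\sum_(i : I) t ^+ 2 / N)).
      apply: ler_sum => j _; have /negP := h2 j; rewrite -ltNge => /ltW h.
      by rewrite -a2 -expr2 -[_ ^+ 2]real_normK ?num_real// lerXn2r ?nnegrE// ltW.
    by rewrite sumr_const -mulr_natr -/N divfK// gt_eqF.
  move: h1; rewrite -ltNge => h1.
  have : u ^+ 2 < dot g (Y w) ^+ 2.
    by rewrite -[ltRHS]real_normK ?num_real// ltr_pXn2r ?nnegrE.
  apply/negP; rewrite -leNgt dg expr_div_n r2 exprMn sqr_sqrtr ?mulr_ge0//.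
  rewrite ler_pdivrMr//; apply: le_trans Efw _.
  apply: (@le_trans _ _ (s * t ^+ 2)); first exact: ler_wpM2l.
  have st : 0 <= s * t ^+ 2 by rewrite mulr_ge0// exprn_ge0// ltW.
  rewrite (_ : _ * dot f f = (s * t ^+ 2) * (2 * dot f f)); last by ring.
  by rewrite ler_peMr//; lra.
apply: le_trans (measureU2 _ _ _) _ => //.
rewrite EFinD; apply: leeD.
  have gu := iid_normal_dot iY gg (measurable_ball0 u).
  apply: (le_trans _ (gauss_small_ball u0)).
  by rewrite le_eqVlt; apply/orP; left; apply/eqP; exact: gu.
have -> : 12 * N / t ^+ 2 = 12 / a ^+ 2 by rewrite a2 invf_div mulrA.
exact: PU.
Qed.

Lemma weight_cplx_dot n (Q A : 'M[C]_n) (l : 'I_n) (c : 'cV[R]_n) :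
  diagonalizes Q A -> simple_spectrum A ->
  weight A l (cplx c) = dot (fun j => complex.Re (Q l j)) (fun j => c j 0) ^+ 2 +
    dot (fun j => complex.Im (Q l j)) (fun j => c j 0) ^+ 2.
Proof.
move=> QA sA; rewrite (weightE _ _ QA)// /sqmod mxE Re_sum Im_sum.
congr (_ ^+ 2 + _ ^+ 2); apply: eq_bigr => j _; rewrite !mxE.
  by rewrite Re_mul /= mulr0 subr0.
by rewrite Im_mul /= mulr0 add0r.
Qed.

(** A reflection takes [c / |c|] to the axis without changing the law of the matrix, so the two
    probabilities agree when [c] is nonzero. For [c = 0] both sides of the second condition vanish
    and only the inequality remains. *)
Lemma weight_law_direction d (T : measurableType d) (P : probability T R) n
    (X : T -> 'I_n.+1 * 'I_n.+1 -> R) (k : 'I_n.+1) (c : 'cV[R]_n.+1) (s : R) :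
  iid_normal P X ->
  (P [set w | simple_spectrum (herm (X w)) /\
      (weight (herm (X w)) k (cplx (axis n)) <= s)%R] <=
   P [set w | simple_spectrum (herm (X w)) /\
      (weight (herm (X w)) k (cplx c) <= s * \sum_j c j 0%R ^+ 2)%R])%E.
Proof.
move=> iX; have [mX _] := iX.
pose V := @vect R ('I_n.+1 * 'I_n.+1)%type.
have mh : mxmeasurable setT (fun x : V => herm x).
  by apply: mxmeasurable_herm => p; exact: measurable_coord.
have mhX := mxmeasurable_herm mX.
have hX w : herm (X w) \is hermsymmx by exact: herm_hermsym.
set r2 := \sum_j c j 0 ^+ 2.
have r20 : 0 <= r2 by apply: sumr_ge0 => j _; exact: sqr_ge0.
have [c0|c0] := eqVneq c 0.
  apply: le_measure; rewrite ?inE.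
  - apply: measurable_weight_le => //; exact: mxmeasurable_cst.
  - apply: measurable_weight_le => //; exact: mxmeasurable_cst.
  - move=> w /= [sw _]; split => //.
    have -> : cplx c = (0 : R)%:C *: cplx c.
      by apply/matrixP => i j; rewrite c0 !mxE mul0r.
    rewrite weightZ// expr0n mul0r (_ : r2 = 0) ?mulr0//.
    by rewrite /r2 c0 big1// => j _; rewrite mxE expr0n.
have {}r20 : 0 < r2.
  rewrite lt_neqAle r20 andbT eq_sym; apply: contra_neq c0 => /eqP.
  rewrite psumr_eq0 => [/allP h|j _]; last exact: sqr_ge0.
  apply/matrixP => j i; rewrite ord1 mxE.
  by have := h j (mem_index_enum _); rewrite sqrf_eq0 => /eqP.
pose r := Num.sqrt r2; have r0 : 0 < r by rewrite sqrtr_gt0.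
have rr : r ^+ 2 = r2 by rewrite sqr_sqrtr// ltW.
pose b := r^-1 *: c.
have b1 : \sum_j b j 0 ^+ 2 = 1.
  under eq_bigr do rewrite mxE exprMn.
  by rewrite -mulr_sumr -/r2 -rr -exprMn mulVf ?expr1n// gt_eqF.
have cE : cplx c = r%:C *: cplx b.
  by rewrite -map_mxZ /b scalerA mulfV ?scale1r// gt_eqF.
have [U UU Ub] := householder b1.
pose Y w p := dot (conj_vec U p) (X w).
have iY : iid_normal P Y.
  by apply: iid_normal_orthonormal iX => p q; exact: conj_vec_orthonormal.
pose B : set V := [set x | simple_spectrum (herm x) /\ weight (herm x) k (cplx (axis n)) <= s].
have mB : measurable B.
  apply: (@measurable_weight_le R _ V n.+1 (fun x => herm x) _ mh (fun=> cplx (axis n)) k (fun=> s)) => //.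
  by move=> x; exact: herm_hermsym.
rewrite le_eqVlt; apply/orP; left; apply/eqP.
apply: (etrans (iid_normal_unique iX iY mB)); congr (P _).
have E w : herm (Y w) = conj_mx U (herm (X w)) by rewrite conj_mx_herm.
apply/seteqP; split=> w; rewrite /B /= E => -[sw ww].
  have {}sw : simple_spectrum (herm (X w)) by exact/(simple_conj_mx _ UU).
  split=> //; rewrite cE weightZ// rr mulrC ler_pM2r//.
  by rewrite -(weight_conj_mx _ _ UU)// -cplxM Ub.
split; first exact/simple_conj_mx.
move: ww; rewrite cE weightZ// rr mulrC ler_pM2r//.
by rewrite -(weight_conj_mx _ _ UU)// -cplxM Ub.
Qed.

(* Since the law of [herm (X w)] is invariant under orthogonal conjugation, the
   axis can be replaced by an independent Gaussian direction, to which the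
   small ball estimate applies for each fixed matrix. *)
Lemma axis_weight_small d (T : measurableType d) (P : probability T R) n
    (X : T -> 'I_n.+1 * 'I_n.+1 -> R) (k : 'I_n.+1) (s t : R) :
  iid_normal P X -> 0 <= s -> 0 < t ->
  (P [set w | simple_spectrum (herm (X w)) /\
      (weight (herm (X w)) k (cplx (axis n)) <= s)%R] <=
   (Num.sqrt (2 * s) * t + n.+1%:R * (2 * (12 * n.+1%:R / t ^+ 2) ^+ 3))%:E)%E.
Proof.
move=> iX s0 t0; have [mX _] := iX.
(* The first row serves only as a source of [n.+1] independent normal variables: on [T * T] it is
   read on one factor and the matrix on the other. *)
pose Y w (j : 'I_n.+1) := X w (ord0, j).
have iY : iid_normal P Y.
  by apply: (iid_normal_restrict (h := fun j : 'I_n.+1 => (ord0, j)) _ iX) => i j [].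
have [mY _] := iY.
pose c w : 'cV[R]_n.+1 := \col_j Y w j.
have cc w : \sum_j c w j 0 ^+ 2 = dot (Y w) (Y w).
  by apply: eq_bigr => j _; rewrite mxE.
pose E : set (T * T) := [set z | simple_spectrum (herm (X z.2)) /\
  weight (herm (X z.2)) k (cplx (c z.1)) <= s * dot (Y z.1) (Y z.1)].
have mE : measurable E.
  apply: measurable_weight_le.
  - by move=> z; exact: herm_hermsym.
  - apply: mxmeasurable_herm => p.
    by apply: (@measurableT_comp _ _ _ _ _ _ (fun w => X w p)) => //; exact: mX.
  - move=> j i; rewrite (_ : (fun _ => _) = fun z : T * T => (Y z.1 j)%:C).
      apply: cmeasurable_real.
      by apply: (@measurableT_comp _ _ _ _ _ _ (fun w => Y w j)) => //; exact: mY.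
    by apply/funext => z; rewrite !mxE.
  - apply: measurable_funM => //; apply: measurable_dot => j;
      by apply: (@measurableT_comp _ _ _ _ _ _ (fun w => Y w j)) => //; exact: mY.
apply: (sections_exchange (P1 := P) (P2 := P) mE) => [|w'|w].
- exact: measure_ge0.
- apply: le_trans (weight_law_direction k (c w') s iX) _.
  rewrite le_eqVlt; apply/orP; left; apply/eqP; congr (P _).
  by apply/seteqP; split=> w; rewrite /xsection/= inE /E /= cc.
have e0 : 0 <= Num.sqrt (2 * s) * t + n.+1%:R * (2 * (12 * n.+1%:R / t ^+ 2) ^+ 3).
  have t2 : 0 <= 12 * n.+1%:R / t ^+ 2 by rewrite divr_ge0 ?sqr_ge0 ?mulr_ge0.
  apply: addr_ge0; first by rewrite mulr_ge0 ?sqrtr_ge0 ?(ltW t0).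
  by apply: mulr_ge0 => //; apply: mulr_ge0 => //; exact: exprn_ge0.
have [sw|nsw] := pselect (simple_spectrum (herm (X w))); last first.
  rewrite (_ : ysection E w = classical_sets.set0) ?measure0//.
  by rewrite -subset0 => w'; rewrite /ysection /= inE => -[].
have [Q QA] := diagonalizable (herm_hermsym (X w)); have [Qu _] := QA.
pose f j := complex.Re (Q k j); pose g j := complex.Im (Q k j).
have fg : dot f f + dot g g = 1.
  rewrite -(unit_row k Qu) /dot -big_split; apply: eq_bigr => j _.
  by rewrite mxE /sqmod !expr2.
have fE w' : ysection E w w' ->
    dot f (Y w') ^+ 2 + dot g (Y w') ^+ 2 <= s * dot (Y w') (Y w').
  rewrite /ysection /= inE => -[_]; rewrite /= (weight_cplx_dot _ _ QA)//.
  suff -> : (fun j => c w' j 0) = Y w' by [].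
  by apply/funext => j; rewrite mxE.
have mS : measurable (ysection E w) by exact: measurable_ysection.
have cI : n.+1 = #|'I_n.+1| by rewrite card_ord.
(* The real or the imaginary part of a unit eigenvector has squared norm at least 1/2. *)
rewrite [in n.+1%:R]cI; have [ff|ff] := leP 2^-1 (dot f f).
  apply: (dot_small_ball _ iY ff) => //; first by rewrite card_ord.
  by move=> w' /fE; apply: le_trans; rewrite lerDl sqr_ge0.
have gg : 2^-1 <= dot g g by lra.
apply: (dot_small_ball _ iY gg) => //; first by rewrite card_ord.
by move=> w' /fE; apply: le_trans; rewrite lerDr sqr_ge0.
Qed.

End axis_weight.

(** * Conclusion *)

Section assembly.
Context {R : realType}.
Local Notation C := R[i].

Lemma measureU_le d (T : measurableType d) (P : {measure set T -> \bar R})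
    (A B : set T) (a b : R) : measurable A -> measurable B ->
  (P A <= a%:E)%E -> (P B <= b%:E)%E ->
  measurable (A `|` B) /\ (P (A `|` B) <= (a + b)%:E)%E.
Proof.
move=> mA mB PA PB; split; first exact: measurableU.
by rewrite EFinD; apply: le_trans (measureU2 _ _ _) _ => //; exact: leeD.
Qed.

(** The bad event [B] collects a multiple eigenvalue of the matrix or of its minor, a weight at most
    [s] at [k] or [k'], and a border weight above [K]. Its complement is the measurable event asked
    for by [with_probability_at_least]. *)
Lemma GUE_perturbed_eigenvalue d (T : measurableType d) (P : probability T R) n
    (G : T -> 'M[C]_n.+1) (b : 'cV[R]_n.+1) (k k' : 'I_n.+1) (K t s : R) :
  GUE P G -> \sum_j b j 0 ^+ 2 = 1 -> k' = k.+1 :> nat -> 0 < K -> 0 < t ->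
  s = 81 * K / n.+1%:R ^+ 2 ->
  with_probability_at_least P
    (1 - (2 * (Num.sqrt (2 * s) * t + n.+1%:R * (2 * (12 * n.+1%:R / t ^+ 2) ^+ 3)) +
          n.+1%:R * (4 * (12 / K) ^+ 3)))
    [set w | exists z : C, [/\ eigenvalue (perturbed (G w) b) z,
      eigval (G w) k < complex.Re z & complex.Re z < eigval (G w) k']].
Proof.
move=> GG b1 kk' K0 t0 sE; have hG := GUE_hermitian GG.
have N0 : 0 < n.+1%:R :> R by rewrite ltr0n.
have s0 : 0 <= s by rewrite sE divr_ge0 ?sqr_ge0// mulr_ge0// ltW.
have [U UU Ub] := householder b1.
pose X w p := dot (conj_vec U p) (coords (G w)).
have iX : iid_normal P X.
  by apply: (iid_normal_orthonormal _ (GUE_iid_normal GG)) => p q; exact: conj_vec_orthonormal.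
have XE w : herm (X w) = conj_mx U (G w) by rewrite -conj_mx_herm hermK.
have [mX _] := iX; have mh := mxmeasurable_herm mX.
have hX w : herm (X w) \is hermsymmx by exact: herm_hermsym.
have hM w : minor0 (herm (X w)) \is hermsymmx by exact: minor0_hermsym.
have mM := mxmeasurable_minor0 mh.
have sX : P [set w | ~ simple_spectrum (herm (X w))] = 0 by exact: herm_simple.
have iX' : iid_normal P (fun w (p : 'I_n * 'I_n) => X w (lift ord0 p.1, lift ord0 p.2)).
  apply: (iid_normal_restrict (h := fun p : 'I_n * 'I_n =>
    (lift ord0 p.1, lift ord0 p.2)) _ iX).
  move=> [i j] [i' j'] /= /eqP; rewrite xpair_eqE !(inj_eq lift_inj).
  by move=> /andP[/eqP-> /eqP->].
have sM : P [set w | ~ simple_spectrum (minor0 (herm (X w)))] = 0.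
  rewrite -[RHS](herm_simple iX'); congr (P _).
  by apply/seteqP; split=> w; rewrite /= minor0_herm.
have mW (c : R) l : measurable [set w | simple_spectrum (herm (X w)) /\
    weight (herm (X w)) l (cplx (axis n)) <= c].
  by apply: measurable_weight_le => //; exact: mxmeasurable_cst.
have mZ l : measurable [set w | simple_spectrum (minor0 (herm (X w))) /\
    K < weight (minor0 (herm (X w))) l (border0 (herm (X w)))].
  rewrite (_ : [set w | _] = [set w | simple_spectrum (minor0 (herm (X w)))] `\`
      [set w | simple_spectrum (minor0 (herm (X w))) /\
        weight (minor0 (herm (X w))) l (border0 (herm (X w))) <= K]).
    apply: measurableD; first exact: measurable_simple.
    by apply: measurable_weight_le => //; exact: mxmeasurable_border0.
  apply/seteqP; split=> w /= -[sw]; rewrite ltNge; first by move=> /negP h; split=> // -[].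
  by move=> h; split=> //; apply/negP => h'; apply: h.
have [mB1 PB1] := finite_union_bound mZ (fun l => border_weight_tail l iX K0).
have mS : measurable [set w | ~ simple_spectrum (herm (X w))].
  by apply: measurableC; exact: measurable_simple.
have mSM : measurable [set w | ~ simple_spectrum (minor0 (herm (X w)))].
  by apply: measurableC; exact: measurable_simple.
have z0 (A : set T) : P A = 0 -> (P A <= 0%:E)%E by move->.
have [mB2 PB2] := measureU_le mS mSM (z0 _ sX) (z0 _ sM).
have [mB3 PB3] := measureU_le (mW s k) (mW s k') (axis_weight_small k iX s0 t0)
  (axis_weight_small k' iX s0 t0).
have [mB4 PB4] := measureU_le mB3 mB1 PB3 PB1.
have [mB PB] := measureU_le mB2 mB4 PB2 PB4.
set B := _ `|` _ in mB PB; exists (~` B); split; first exact: measurableC.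
  move=> w /= /not_orP[/not_orP[/contrapT h1 /contrapT h2]].
  move=> /not_orP[/not_orP[h3 h4] /forallNP h5].
  have wK l : weight (minor0 (herm (X w))) l (border0 (herm (X w))) <= K.
    by rewrite leNgt; apply/negP => h; apply: (h5 l).
  have big l : ~ (simple_spectrum (herm (X w)) /\
      weight (herm (X w)) l (cplx (axis n)) <= s) ->
      81 * K <= n.+1%:R ^+ 2 * weight (herm (X w)) l (cplx (axis n)).
    move=> h; rewrite [leRHS]mulrC -ler_pdivrMr ?exprn_gt0// -sE; apply: ltW.
    by rewrite ltNge; apply/negP => h'; apply: h.
  have [z [ez kz zk']] := perturbed_eigenvalue_between (hX w) h1 h2 kk' K0 wK
    (big _ h3) (big _ h4).
  have eU l : eigval (herm (X w)) l = eigval (G w) l by rewrite XE eigval_conj_mx.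
  move: kz zk'; rewrite (eU k) (eU k') => kz zk'.
  exists z; split; [|exact: kz|exact: zk'].
  by apply: (eigenvalue_perturbed_conj UU); rewrite Ub -XE.
rewrite probability_setC// EFinB; apply: leeB => //.
apply: le_trans PB _; rewrite lee_fin !add0r sumr_const card_ord.
have dbl (x : R) : 2 * x = x + x by rewrite mulr_natl mulr2n.
rewrite [X in _ <= X + _]dbl lerD2l -[leLHS]mulr_natl; apply: ler_wpM2r.
  by rewrite mulr_ge0// exprn_ge0// divr_ge0// ltW.
by rewrite ler_nat.
Qed.

(** Here [z = N^(1/40)], with [K = z^20] and [t = z^28]. The three error terms have orders [z^-2],
    [z^-8] and [z^-20]; the constant is [2 (13 + 2 * 12^3) + 4 * 12^3], where 13 bounds [sqrt 162].
    Being at most a constant times [z^-2], the sum is at most [z^-1] once [z] exceeds that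
    constant. *)
Lemma error_bound (N z : R) : 26 + 8 * 12 ^+ 3 <= z -> N = z ^+ 40 ->
  2 * (Num.sqrt (2 * (81 * z ^+ 20 / N ^+ 2)) * z ^+ 28 +
    N * (2 * (12 * N / (z ^+ 28) ^+ 2) ^+ 3)) + N * (4 * (12 / z ^+ 20) ^+ 3) <= z^-1.
Proof.
move=> Cz NE; have z1 : 1 <= z by apply: le_trans Cz; lra.
have z0 : 0 < z by apply: lt_le_trans z1.
have zN0 : z != 0 by rewrite gt_eqF.
have v0 : 0 < z^-1 by rewrite invr_gt0.
have v1 : z^-1 <= 1 by rewrite invf_le1.
have vz : z^-1 * z = 1 by rewrite mulVf.
set v := z^-1 in v0 v1 vz *.
have cancel a b : (a <= b)%N -> v ^+ b * z ^+ a = v ^+ (b - a).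
  by move=> ab; rewrite -{1}(subnK ab) exprD -mulrA -exprMn vz expr1n mulr1.
have sq : Num.sqrt (2 * (81 * z ^+ 20 / N ^+ 2)) <= 13 * v ^+ 30.
  have v30 : 0 <= 13 * v ^+ 30 by rewrite mulr_ge0// exprn_ge0// ltW.
  rewrite -[leRHS]ger0_norm// -sqrtr_sqr ler_sqrt ?sqr_ge0//.
  have -> : 2 * (81 * z ^+ 20 / N ^+ 2) = 162 * v ^+ 60.
    rewrite NE -exprM /= -exprVn -/v mulrA mulrA -[X in _ = _ * X](cancel 20%N 80%N)//.
    by ring.
  rewrite exprMn -exprM; apply: ler_wpM2r; first by rewrite exprn_ge0// ltW.
  by lra.
have t1 : 12 * N / (z ^+ 28) ^+ 2 = 12 * v ^+ 16.
  by rewrite NE -exprM -exprVn -/v -mulrA [z ^+ _ * _]mulrC cancel.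
have t2 : N * (2 * (12 * v ^+ 16) ^+ 3) = 2 * 12 ^+ 3 * v ^+ 8.
  rewrite NE exprMn -exprM -[v ^+ 8](cancel 40%N 48%N)//; ring.
have t3 : N * (4 * (12 / z ^+ 20) ^+ 3) = 4 * 12 ^+ 3 * v ^+ 20.
  rewrite NE -exprVn -/v exprMn -exprM -[v ^+ 20](cancel 40%N 60%N)//; ring.
have s1 : Num.sqrt (2 * (81 * z ^+ 20 / N ^+ 2)) * z ^+ 28 <= 13 * v ^+ 2.
  apply: (@le_trans _ _ (13 * v ^+ 30 * z ^+ 28)).
    by apply: ler_wpM2r => //; rewrite exprn_ge0// ltW.
  by rewrite -mulrA cancel.
rewrite t1 t2 t3.
have v8 : v ^+ 8 <= v ^+ 2 by apply: ler_wiXn2l => //; exact: ltW.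
have v20 : v ^+ 20 <= v ^+ 2 by apply: ler_wiXn2l => //; exact: ltW.
have Cv : (26 + 8 * 12 ^+ 3) * v ^+ 2 <= v.
  apply: (@le_trans _ _ (z * v ^+ 2)); first by rewrite ler_wpM2r// sqr_ge0.
  by rewrite expr2 mulrA [z * v]mulrC vz mul1r.
apply: le_trans Cv; move: s1 v8 v20; set u := Num.sqrt _ * _; clearbody u.
have -> : (12 ^+ 3 : R) = 1728 by ring.
lra.
Qed.

End assembly.

Theorem theorem6 (R : realType) (n : nat) (n_gt0 : (0 < n)%N)
    (alpha : R) (alpha_gt0 : 0 < alpha) (alpha_lt1 : alpha < 1)
    (d : nat -> measure_display) (T : forall N : nat, measurableType (d N))
    (P : forall N : nat, probability (T N) R)
    (G : forall N : nat, T N -> 'M[R[i]]_N)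
    (G_GUE : forall N : nat, GUE (P N) (G N))
    (b : forall N : nat, 'cV[R]_N)
    (b_unit : forall N : nat, (0 < N)%N -> \sum_(k < N) b N k 0 ^+ 2 = 1) :
  exists2 eps : R, 0 < eps &
    exists N0 : nat, forall N : nat, (N0 <= N)%N ->
      forall i : nat,
        alpha * N%:R <= i%:R -> i%:R <= (1 - alpha) * N%:R ->
        forall j : nat, (j < n)%N ->
          with_probability_at_least (P N) (1 - N%:R `^ (- eps))
            [set w | exists z : R[i],
               [/\ eigenvalue (perturbed (G N w) (b N)) z,
                   ordered_eigenvalue (G N w) (i + j)%N < complex.Re z
                 & complex.Re z < ordered_eigenvalue (G N w) (i + j).+1]].
Proof.
exists (40%:R^-1); first by rewrite invr_gt0 ltr0n.
pose z0 : R := 26 + 8 * 12 ^+ 3.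
have z00 : 0 < z0 by rewrite /z0; lra.
(* The first summand ensures [n <= alpha N], hence [i + j < N]; the second ensures
   [z0 <= N^(1/40)]. *)
exists (Num.truncn (n%:R / alpha + z0 ^+ 40)).+1 => -[//|N] N0N i iN Ni j jn.
have NR : n%:R / alpha + z0 ^+ 40 < N.+1%:R :> R.
  by apply: lt_le_trans (truncnS_gt _) _; rewrite ler_nat.
have na : n%:R <= alpha * N.+1%:R :> R.
  rewrite mulrC -ler_pdivrMr//; apply: le_trans (ltW NR).
  by rewrite lerDl exprn_ge0// ltW.
have ijN : (i + j < N.+1)%N.
  rewrite -(ltr_nat R) natrD.
  have : j%:R < n%:R :> R by rewrite ltr_nat.
  by move: Ni na; lra.
have i0 : (0 < i)%N.
  rewrite -(ltr_nat R); apply: lt_le_trans iN.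
  by rewrite mulr_gt0// ltr0n.
have ij0 : (0 < i + j)%N by rewrite ltn_addr.
(* Counted from 0, the eigenvalue number [i + j + 1] has index [i + j], and its predecessor has
   index [i + j - 1], which requires [0 < i + j]. *)
pose k' := Ordinal ijN.
have kN : ((i + j).-1 < N.+1)%N by rewrite (leq_ltn_trans (leq_pred _) ijN).
pose k := Ordinal kN.
pose z : R := N.+1%:R `^ (40%:R^-1).
have zE : N.+1%:R = z ^+ 40 by rewrite -powR_mulrn ?powR_ge0// -powRrM mulVf ?powRr1.
have zge : z0 <= z.
  rewrite -(ler_pXn2r (n:=40)) ?nnegrE ?powR_ge0 ?(ltW z00)// -zE.
  by apply: le_trans (ltW NR); rewrite lerDr divr_ge0// ltW.
have zgt : 0 < z by apply: lt_le_trans zge.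
have [A [mA AE PA]] := GUE_perturbed_eigenvalue (k := k) (k' := k') (t := z ^+ 28)
  (K := z ^+ 20) (G_GUE N.+1) (b_unit N.+1 isT) (esym (prednK ij0))
  (exprn_gt0 _ zgt) (exprn_gt0 _ zgt) erefl.
exists A; split => //.
  move=> w /AE[x [ex kx xk']]; exists x; split => //.
    by move: kx; rewrite eigvalE /= prednK.
  by move: xk'; rewrite eigvalE.
apply: le_trans PA; rewrite lee_fin lerD2l lerN2 powRN -/z.
exact: error_bound zge zE.
Qed.
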